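(* Let $G$ be the simple algebraic group of type $G_2$ over $\mathbb{C}$, let $i\in\{1,2\}$, $\{j\}=\{1,2\}\setminus\{i\}$, and let $\mathcal{A}_i=\mathbb{C}[P_j^-\backslash G]=\bigoplus_{n\ge0}V_{n\omega_i}$. The projection $\mathcal{A}_i\to\mathbb{C}[N_i]$ induced from the inclusion $N_i\to P_j^-\backslash G$ defines a cluster algebra structure on $\mathbb{C}[N_i]$: if $\underline{\Sigma_i}|_{N_i}$ is the seed obtained from the seed $\underline{\Sigma_i}$ described in the context by applying this projection to its cluster variables and coefficients and omitting the index $-3$ (whose function $\Delta^{\omega_i}$ is mapped to $1$), with ground ring the polynomial ring over $\mathbb{Z}$ in the two coefficients with indices $-1,-2$, then $\mathcal{A}(\underline{\Sigma_i}|_{N_i})_{\mathbb{C}}=\mathbb{C}[N_i]$.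
   Context: **Group.** $G$ is simple of type $G_2$ over $\mathbb{C}$, $\mathfrak{g}$ its Lie algebra, $B^{\pm}$ opposite Borel subgroups with unipotent radicals $N^{\pm}$, $H=B^+\cap B^-$, Chevalley generators $f_1,f_2,h_1,h_2,e_1,e_2$, $x_i(t)=\exp(te_i)$, $y_i(t)=\exp(tf_i)$. Simple roots $\alpha_1$ (short), $\alpha_2$ (long); fundamental weights $\omega_1=2\alpha_1+\alpha_2$, $\omega_2=3\alpha_1+2\alpha_2$; Weyl group $W=\langle s_1,s_2\rangle$ with longest element $w_0$. $P_j^-$ is the parabolic subgroup generated by $B^-$ and $x_j(t)$; $P_j$ is the opposite parabolic, generated by $B^+$ and $y_j(t)$; $N_i$ ($\{i\}=\{1,2\}\setminus\{j\}$) is the unipotent radical of $P_j$, which embeds as an open subset of $P_j^-\backslash G$. $V_\lambda$ is the irreducible finite-dimensional $G$-module of highest weight $\lambda$. One has $\mathbb{C}[N^-\backslash G]=\bigoplus_{m,n\ge0}V_{m\omega_1+n\omega_2}$ (left $N^-$-invariant regular functions on $G$), and $\mathcal{A}_i$ is viewed as a subalgebra of it; the projection $\mathcal{A}_i\to\mathbb{C}[N_i]$ is restriction of functions from $G$ to $N_i$. **Minors and operators.** For $X\in\mathfrak{g}$ put $(X^\dagger f)(x)=\frac{d}{dt}f(x\exp(tX))|_{t=0}$. For $x=[x]_-[x]_0[x]_+\in N^-HN^+$ set $\Delta^{\omega_i}(x)=[x]_0^{\omega_i}$ (it extends to a regular function on $G$). Let $\varphi_i:SL_2(\mathbb{C})\to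 G$ send $\begin{pmatrix}1&t\\0&1\end{pmatrix}\mapsto x_i(t)$, $\begin{pmatrix}1&0\\t&1\end{pmatrix}\mapsto y_i(t)$; $\overline{s_i}=\varphi_i\begin{pmatrix}0&-1\\1&0\end{pmatrix}$ and $\overline{w}=\overline{s_{i_1}}\cdots\overline{s_{i_l}}$ for a reduced word of $w$. Put $\Delta^{w\omega_i}(x)=\Delta^{\omega_i}(x\overline{w})$ and $X_0=\frac12 f_1^\dagger f_2^\dagger f_1^\dagger\Delta^{\omega_1}$. **Cluster algebras.** A seed is a pair (extended cluster, exchange matrix): a set of free generators $x_k$ of a field of rational functions, some being cluster variables (mutable indices) and the others coefficients (frozen indices), and an integer matrix $(b_{kl})$ with rows indexed by all indices and columns by mutable ones, whose square mutable part is skew-symmetrizable. Mutation $\mu_k$ at mutable $k$ replaces $x_k$ by $x_k'$ with $x_kx_k'=\prod_i x_i^{[b_{ik}]_+}+\prod_i x_i^{[-b_{ik}]_+}$ ($[b]_+=\max(0,b)$), and the matrix by $b'_{ij}=-b_{ij}$ if $i=k$ or $j=k$, and $b'_{ij}=b_{ij}+\mathrm{sgn}(b_{ik})[b_{ik}b_{kj}]_+$ otherwise. For a ground ring $R$ between the polynomial and Laurent polynomial ring over $\mathbb{Z}$ in the coefficients, $\mathcal{A}(\Sigma)$ is the $R$-subalgebra generated by all cluster variables of all seeds obtained from $\Sigma$ by sequences of mutations; the subscript $\mathbb{C}$ denotes extension of scalars to $\mathbb{C}$. In both seeds below mutable indices are $1,2,3$ and frozen indices $-1,-2,-3$. Each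 row of the exchange matrix is listed as (column 1, column 2, column 3). **Seed $\underline{\Sigma_1}$.** Matrix rows: $1:(0,-3,1)$; $2:(1,0,-1)$; $3:(-1,3,0)$; $-1:(1,0,0)$; $-2:(-1,1,0)$; $-3:(0,-3,2)$. Functions: $X_{-1}=\Delta^{w_0\omega_1}$, $X_{-3}=\Delta^{\omega_1}$, $X_1=\Delta^{s_2s_1s_2s_1\omega_1}$, $X_3=\Delta^{s_2s_1\omega_1}$, $X_{-2}=X_0(\Delta^{\omega_1}\Delta^{w_0\omega_1}+\Delta^{s_1\omega_1}\Delta^{s_2s_1s_2s_1\omega_1})-\Delta^{\omega_1}\Delta^{s_1s_2s_1\omega_1}\Delta^{s_2s_1s_2s_1\omega_1}-\Delta^{s_1\omega_1}\Delta^{s_2s_1\omega_1}\Delta^{w_0\omega_1}$, $X_2=\Delta^{s_1\omega_1}(\Delta^{s_2s_1\omega_1})^2-\Delta^{\omega_1}\Delta^{s_2s_1\omega_1}X_0-(\Delta^{\omega_1})^2\Delta^{s_2s_1s_2s_1\omega_1}$. **Seed $\underline{\Sigma_2}$.** Matrix rows: $1:(0,-1,1)$; $2:(3,0,-3)$; $3:(-1,1,0)$; $-1:(1,0,0)$; $-2:(-3,1,0)$; $-3:(0,-1,2)$. Functions: $Y_{-1}=\Delta^{w_0\omega_2}$, $Y_{-3}=\Delta^{\omega_2}$, $Y_1=\Delta^{s_1s_2s_1s_2\omega_2}$, $Y_2=\frac16(f_1^\dagger)^2f_2^\dagger\Delta^{\omega_2}$, $Y_3=\Delta^{s_1s_2\omega_2}$,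 $Y_{-2}=(2f_1^\dagger f_2^\dagger-f_2^\dagger f_1^\dagger)Y_2$. *)

(* Defs.v *)
From HB Require Import structures.
From mathcomp Require Import all_boot all_order all_algebra ring.
From mathcomp Require Import boolp classical_sets functions.
From mathcomp Require Import reals topology normedtype derive.
From mathcomp.real_closed Require Import complex.
(* without notations, which clash with those of mathcomp-analysis *)
From mathcomp.multinomials Require Import -(notations) mpoly.
Set Implicit Arguments.
Unset Strict Implicit.
Unset Printing Implicit Defensive.
Import Order.TTheory GRing.Theory Num.Theory.
Import numFieldNormedType.Exports.
Local Open Scope classical_set_scope.
Local Open Scope ring_scope.

(** * Cluster algebras of geometric type *)

(* n mutable and m frozen indices; the mutable index k is [lshift m k], the
   frozen index l is [rshift n l]. *)
Record seed (n m : nat) (K : Type) := Seed {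
  extended_cluster : 'I_(n + m) -> K ;
  exchange_matrix : 'M[int]_(n + m, n) }.

Definition skew_symmetrizable (n : nat) (B : 'M[int]_n) : Prop :=
  exists d : 'I_n -> nat, (forall k, (0 < d k)%N) /\
    forall k l, (d k)%:Z * B k l = - ((d l)%:Z * B l k).

(* The field K, an extension of C through [c], is a field of rational
   functions over C with free generators the x_k. *)
Definition free_generators (C K : fieldType) (c : C -> K) (N : nat)
    (x : 'I_N -> K) : Prop :=
  (forall p : mpoly N C, mmap c x p = 0 -> p = 0) /\
  (forall z : K, exists p q : mpoly N C,
     mmap c x q != 0 /\ z = mmap c x p / mmap c x q).

Definition is_seed (C K : fieldType) (c : C -> K) (n m : nat)
    (S : seed n m K) : Prop :=
  free_generators c (extended_cluster S) /\
  skew_symmetrizable (rowsub (lshift m) (exchange_matrix S)).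

Definition mutate (n m : nat) (K : fieldType) (S : seed n m K) (k : 'I_n) :
    seed n m K :=
  let x := extended_cluster S in
  let b := exchange_matrix S in
  let k' := lshift m k in
  Seed
    (fun i => if i == k' then
       (\prod_l x l ^ Num.max 0 (b l k) + \prod_l x l ^ Num.max 0 (- b l k))
         / x k'
     else x i)
    (\matrix_(i, j) (if (i == k') || (j == k) then - b i j
       else b i j + Num.sg (b i k) * Num.max 0 (b i k * b k' j))).

Definition cluster_variables (n m : nat) (K : fieldType) (S : seed n m K) :
    set K :=
  [set z | exists (ks : seq 'I_n) (k : 'I_n),
             z = extended_cluster (foldl (@mutate n m K) S ks) (lshift m k)].

Definition generated_subring (K : pzRingType) (X : set K) : set K :=
  smallest (fun A : set K => GRing.subring_closed (mem A)) X.

Definition polynomial_ground_ring (n m : nat) (K : fieldType)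
    (S : seed n m K) : set K :=
  generated_subring (range (fun l : 'I_m => extended_cluster S (rshift n l))).

(* The subalgebra, over the ground ring [ground], generated by the cluster
   variables. *)
Definition cluster_algebra (n m : nat) (K : fieldType) (ground : set K)
    (S : seed n m K) : set K :=
  generated_subring (ground `|` cluster_variables S).

(* The C-linear span of A in K. If S is a seed in the sense of [is_seed] then
   the elements of its extended cluster are algebraically independent over C,
   so that for A = A(S), contained in Z[x_1^+-1, .., x_N^+-1], the canonical
   map from A (x)_Z C to K is injective with this image. *)
Definition extend_scalars (C K : fieldType) (c : C -> K) (A : set K) : set K :=
  [set z | exists (N : nat) (s : 'I_N -> C) (a : 'I_N -> K),
             (forall k, A (a k)) /\ z = \sum_(k < N) c (s k) * a k].

(** * The group of type G_2, in its 7-dimensional representation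

    G is simply connected with trivial center, so V_{omega_1} is a faithful
    representation; it has the basis v_0, .., v_6 of weight vectors of weights
    2a_1+a_2, a_1+a_2, a_1, 0, -a_1, -a_1-a_2, -2a_1-a_2 (a_1 short). *)

Notation i1 := (ord0 : 'I_2).
Notation i2 := (ord_max : 'I_2).

Definition Eij (C : numFieldType) (k l : nat) : 'M[C]_7 :=
  delta_mx (inord k) (inord l).

Definition e_ (C : numFieldType) (i : 'I_2) : 'M[C]_7 :=
  if i == i1 then Eij C 0 1 + 2 *: Eij C 2 3 + Eij C 3 4 + Eij C 5 6
  else Eij C 1 2 + Eij C 4 5.

Definition f_ (C : numFieldType) (i : 'I_2) : 'M[C]_7 :=
  if i == i1 then Eij C 1 0 + Eij C 3 2 + 2 *: Eij C 4 3 + Eij C 6 5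
  else Eij C 2 1 + Eij C 5 4.

(* the diagonal of h_i *)
Definition coroot (i : 'I_2) (k : 'I_7) : int :=
  nth 0 (if i == i1 then [:: 1; -1; 2; 0; -2; 1; -1]
         else [:: 0; 1; -1; 0; 1; -1; 0]) k.

Definition h_ (C : numFieldType) (i : 'I_2) : 'M[C]_7 :=
  diag_mx (\row_k (coroot i k)%:~R).

Definition cartan_G2 (i j : 'I_2) : int :=
  if i == j then 2 else if i == i1 then -3 else -1.

Definition lie (C : numFieldType) (x y : 'M[C]_7) : 'M[C]_7 := x * y - y * x.


Lemma chevalley_relations (C : numFieldType) (i j : 'I_2) :
  [/\ lie (h_ C i) (e_ C j) = (cartan_G2 i j)%:~R *: e_ C j,
      lie (h_ C i) (f_ C j) = - (cartan_G2 i j)%:~R *: f_ C j,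
      lie (e_ C i) (f_ C j) = (if i == j then h_ C i else 0) &
      lie (h_ C i) (h_ C j) = 0].
Proof.
have ord2 (k : 'I_2) : k = i1 \/ k = i2.
  by case: k => [[|[|//]]] hk; [left|right]; apply/val_inj.
have hM k (x : 'M[C]_7) : h_ C k * x = \matrix_(a, b) ((coroot k a)%:~R * x a b).
  by apply/matrixP => a b; rewrite -[_ * _]/(_ *m _) mul_diag_mx !mxE.
have Mh k (x : 'M[C]_7) : x * h_ C k = \matrix_(a, b) (x a b * (coroot k b)%:~R).
  by apply/matrixP => a b; rewrite -[_ * _]/(_ *m _) mul_mx_diag !mxE.
have EE (a b c d : nat) : (b < 7)%N -> (c < 7)%N ->
    Eij C a b * Eij C c d = if (b == c) then Eij C a d else 0.
  move=> *; rewrite /Eij -[_ * _]/(_ *m _) mul_delta_mx_cond -val_eqE /= !inordK//.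
  by case: (b == c).
have hE k (a b : nat) : (a < 7)%N -> (b < 7)%N -> lie (h_ C k) (Eij C a b)
    = (coroot k (inord a) - coroot k (inord b))%:~R *: Eij C a b.
  move=> ha hb; apply/matrixP => u v; rewrite /lie hM Mh !mxE rmorphB /=.
  by have [-> | _] := eqVneq u; have [-> | _] := eqVneq v; rewrite /=; ring.
have lieD (x y z : 'M[C]_7) : lie x (y + z) = lie x y + lie x z.
  by rewrite /lie mulrDr mulrDl opprD addrACA.
have lieZ (x y : 'M[C]_7) (c : C) : lie x (c *: y) = c *: lie x y.
  by rewrite /lie -scalerAr -scalerAl scalerBr.
have val7 (a : nat) (k : 'I_7) : (a < 7)%N -> (k == inord a) = (k == a :> nat).
  by move=> ha; rewrite -val_eqE /= inordK.
have [-> | ->] := ord2 i; have [-> | ->] := ord2 j.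
all: split; [ | | | by apply/matrixP => k l; rewrite /lie !hM !mxE; case: eqP => [->|_]; rewrite ?mulr0n ?mulr1n ?mulr0; ring].
all: try by rewrite /e_ /f_ /= ?(lieD, lieZ) !hE// /coroot !inordK//= /cartan_G2 /=
  ?(scalerDr, scalerA); do ?congr (_ + _); congr (_ *: _); ring.
all: rewrite /lie /e_ /f_ /= ?(mulrDl, mulrDr) -?(scalerAl, scalerAr) !EE //=.
all: rewrite ?(scaler0, addr0, add0r, subr0).
all: try by rewrite oppr0.
all: apply/matrixP => k l; rewrite !mxE !val7//;
  case: k => [[|[|[|[|[|[|[|//]]]]]]] hk]; case: l => [[|[|[|[|[|[|[|//]]]]]]] hl];
  rewrite /coroot /=; ring.
Qed.

(* exp X for nilpotent X, i.e. X ^+ 7 = 0 *)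
Definition exp_nil (C : numFieldType) (X : 'M[C]_7) : 'M[C]_7 :=
  \sum_(k < 7) (k`!%:R)^-1 *: X ^+ k.

Definition x_ (C : numFieldType) (i : 'I_2) (t : C) := exp_nil (t *: e_ C i).
Definition y_ (C : numFieldType) (i : 'I_2) (t : C) := exp_nil (t *: f_ C i).

(* t_1^{h_1} t_2^{h_2}, where t^{h_i} = phi_i(diag(t, t^-1)). Since the weight
   omega_i takes the value 1 on h_i and 0 on the other coroot,
   (tor t)^{omega_i} = t i. *)
Definition tor (C : numFieldType) (t : 'I_2 -> C) : 'M[C]_7 :=
  diag_mx (\row_k \prod_(i < 2) t i ^ coroot i k).

(* phi_i of (0 -1; 1 0) = (1 -1; 0 1)(1 0; 1 1)(1 -1; 0 1) *)
Definition sbar (C : numFieldType) (i : 'I_2) : 'M[C]_7 :=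
  x_ i (-1) * y_ i 1 * x_ i (-1).

Definition wbar (C : numFieldType) (w : seq 'I_2) : 'M[C]_7 :=
  \prod_(i <- w) sbar C i.

(** ** Linear algebraic groups *)

Definition is_subgroup (C : numFieldType) (H : set 'M[C]_7) : Prop :=
  [/\ forall x, H x -> x \is a GRing.unit,
      H 1,
      forall x y, H x -> H y -> H (x * y) &
      forall x, H x -> H x^-1].

Definition generated (C : numFieldType) (S : set 'M[C]_7) : set 'M[C]_7 :=
  smallest (@is_subgroup C) S.

Definition evalmx (C : numFieldType) (p : mpoly (7 * 7) C)
    (x : 'M[C]_7) : C :=
  meval (fun k => mxvec x 0 k) p.

(* Zariski closed subsets of GL_7 *)
Definition zariski_closed (C : numFieldType) (Z : set 'M[C]_7) : Prop :=
  exists I : set (mpoly (7 * 7) C),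
    Z = [set x | x \is a GRing.unit /\ forall p, I p -> evalmx p x = 0].

Definition zariski_connected (C : numFieldType) (Z : set 'M[C]_7) : Prop :=
  forall A B : set 'M[C]_7, zariski_closed A -> zariski_closed B ->
    A `|` B = Z -> A `&` B = set0 -> A = set0 \/ B = set0.

Definition unipotent (C : numFieldType) (x : 'M[C]_7) : Prop :=
  exists n : nat, (x - 1) ^+ n = 0.

(* The union of all closed connected normal unipotent subgroups of P. For a
   linear algebraic group P there is a largest one, which is thus the union. *)
Definition unipotent_radical (C : numFieldType) (P : set 'M[C]_7) :
    set 'M[C]_7 :=
  \bigcup_(U in [set U : set 'M[C]_7 |
      [/\ is_subgroup U /\ U `<=` P, zariski_closed U, zariski_connected U,
          (forall p u, P p -> U u -> U (p * u * p^-1)) &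
          (forall u, U u -> unipotent u)]]) U.

(* Regular functions on a Zariski closed subset X of 'M[C]_7, given by total
   functions whose values outside of X are irrelevant. The groups G and N_i are
   closed in SL_7, so the inverse of the determinant is not needed. *)
Definition regular (C : numFieldType) (X : set 'M[C]_7) (f : 'M[C]_7 -> C) :
    Prop :=
  exists p : mpoly (7 * 7) C, forall x, X x -> f x = evalmx p x.

(* K is the field of fractions C(X) of the ring C[X] of regular functions, and
   [iota f] is the restriction of f to X, as an element of K. *)
Record is_function_field (C : numFieldType) (X : set 'M[C]_7) (K : fieldType)
    (iota : ('M[C]_7 -> C) -> K) : Prop := {
  iota_1 : iota (cst 1) = 1 ;
  iota_B : forall f g, regular X f -> regular X g ->
    iota (f - g) = iota f - iota g ;
  iota_M : forall f g, regular X f -> regular X g ->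
    iota (f * g) = iota f * iota g ;
  iota_eq0 : forall f, regular X f ->
    (iota f = 0 <-> forall x, X x -> f x = 0) ;
  iota_frac : forall z, exists f g,
    [/\ regular X f, regular X g, iota g != 0 & z = iota f / iota g] }.

(** ** Subgroups of G *)

Definition G2 (C : numFieldType) : set 'M[C]_7 :=
  generated [set g | exists (i : 'I_2) (t : C), g = x_ i t \/ g = y_ i t].
Arguments G2 : clear implicits.

Definition borel (C : numFieldType) (u : 'I_2 -> C -> 'M[C]_7) : set 'M[C]_7 :=
  generated ([set g | exists2 t : 'I_2 -> C, forall i, t i != 0 & g = tor t]
             `|` [set g | exists (i : 'I_2) (t : C), g = u i t]).

Definition Bplus (C : numFieldType) := borel (@x_ C).
Arguments Bplus : clear implicits.
Definition Bminus (C : numFieldType) := borel (@y_ C).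
Arguments Bminus : clear implicits.
Definition Nplus (C : numFieldType) := unipotent_radical (Bplus C).
Arguments Nplus : clear implicits.
Definition Nminus (C : numFieldType) := unipotent_radical (Bminus C).
Arguments Nminus : clear implicits.

(* P_j *)
Definition parabolic (C : numFieldType) (j : 'I_2) : set 'M[C]_7 :=
  generated (Bplus C `|` range (@y_ C j)).
Arguments parabolic : clear implicits.

(** ** Minors and the algebras A_i *)

Definition is_Delta (C : numFieldType) (i : 'I_2) (f : 'M[C]_7 -> C) : Prop :=
  regular (G2 C) f /\
  forall (u v : 'M[C]_7) (t : 'I_2 -> C), Nminus C u -> Nplus C v ->
    (forall k, t k != 0) -> f (u * tor t * v) = t i.

(* The regular function on G such that Delta i x = [x]_0^{omega_i} on
   N^- H N^+; it is unique as a function on G. *)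
Definition Delta (C : numFieldType) (i : 'I_2) : 'M[C]_7 -> C :=
  xget (cst 0) [set f | is_Delta i f].

Definition DeltaW (C : numFieldType) (i : 'I_2) (w : seq 'I_2) :
    'M[C]_7 -> C :=
  fun x => Delta i (x * wbar C w).

(* X^dagger f, for nilpotent X *)
Definition dagger (C : numFieldType) (X : 'M[C]_7) (f : 'M[C]_7 -> C) :
    'M[C]_7 -> C :=
  fun x => derive1 (fun t : C => f (x * exp_nil (t *: X))) 0.

(* V_{n omega_i} inside C[N^- \ G]: the left N^- -invariant regular functions
   on G of left H-weight n omega_i *)
Definition V_ (C : numFieldType) (i : 'I_2) (n : nat) : set ('M[C]_7 -> C) :=
  [set f | regular (G2 C) f /\
     forall (u x : 'M[C]_7) (t : 'I_2 -> C), Nminus C u -> G2 C x ->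
       (forall k, t k != 0) -> f (u * tor t * x) = t i ^+ n * f x].

(* A_i, the sum of the V_{n omega_i} *)
Definition A_ (C : numFieldType) (i : 'I_2) : set ('M[C]_7 -> C) :=
  [set f | exists (N : nat) (F : nat -> 'M[C]_7 -> C),
     (forall n, V_ i n (F n)) /\
     forall x, G2 C x -> f x = \sum_(n < N) F n x].

(** ** The seeds; the order of the indices is 1, 2, 3, -1, -2, -3 *)

Definition w0 : seq 'I_2 := [:: i1; i2; i1; i2; i1; i2].

Definition X0 (C : numFieldType) : 'M[C]_7 -> C :=
  2^-1 *: dagger (f_ C i1) (dagger (f_ C i2) (dagger (f_ C i1) (Delta i1))).
Arguments X0 : clear implicits.

Definition functions1 (C : numFieldType) : seq ('M[C]_7 -> C) :=
  let D := @DeltaW C i1 in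
  let D0 := @Delta C i1 in
  let s1 := [:: i1] in
  let s21 := [:: i2; i1] in
  let s121 := [:: i1; i2; i1] in
  let s2121 := [:: i2; i1; i2; i1] in
  [:: D s2121;
      D s1 * D s21 ^+ 2 - D0 * D s21 * X0 C - D0 ^+ 2 * D s2121;
      D s21;
      D w0;
      X0 C * (D0 * D w0 + D s1 * D s2121)
        - D0 * D s121 * D s2121 - D s1 * D s21 * D w0;
      D0].

Definition Y2 (C : numFieldType) : 'M[C]_7 -> C :=
  6^-1 *: dagger (f_ C i1) (dagger (f_ C i1) (dagger (f_ C i2) (Delta i2))).
Arguments Y2 : clear implicits.

Definition functions2 (C : numFieldType) : seq ('M[C]_7 -> C) :=
  let D := @DeltaW C i2 in
  [:: D [:: i1; i2; i1; i2];
      Y2 C;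
      D [:: i1; i2];
      D w0;
      2 *: dagger (f_ C i1) (dagger (f_ C i2) (Y2 C))
        - dagger (f_ C i2) (dagger (f_ C i1) (Y2 C));
      Delta i2].

Definition rows1 : seq (seq int) :=
  [:: [:: 0; -3; 1];
      [:: 1; 0; -1];
      [:: -1; 3; 0];
      [:: 1; 0; 0];
      [:: -1; 1; 0];
      [:: 0; -3; 2] ].

Definition rows2 : seq (seq int) :=
  [:: [:: 0; -1; 1];
      [:: 3; 0; -3];
      [:: -1; 1; 0];
      [:: 1; 0; 0];
      [:: -3; 1; 0];
      [:: 0; -1; 2] ].

Definition Sigma (C : numFieldType) (i : 'I_2) : seed 3 3 ('M[C]_7 -> C) :=
  Seed (fun k => nth 0 (if i == i1 then functions1 C else functions2 C) k)
    (\matrix_(k, l) nth 0 (nth [::] (if i == i1 then rows1 else rows2) k) l).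

(* The seed obtained by applying [iota] and omitting the last index. *)
Definition restrict_seed (n m : nat) (F K : Type) (iota : F -> K)
    (S : seed n m.+1 F) : seed n m K :=
  let w := @widen_ord (n + m) (n + m.+1) (leq_add (leqnn n) (leqnSn m)) in
  Seed (fun k => iota (extended_cluster S (w k))) (rowsub w (exchange_matrix S)).

(* Main.v *)
(** Regular functions on [N_i] form a polynomial ring in five variables.  In it,
    consider seeds whose elements are pairwise coprime and whose exchange sums
    are divisible by the variable [y_k] that they replace.  Both properties survive
    mutation at [k].  Modulo [y_l] the new exchange sum of [l] is the old one up to
    monomials in the other variables.  The new variable is coprime to [y_l] when
    [b_lk <> 0], because there the exchange sum of [k] is a monomial modulo [y_l].
    If [b_lk = 0] and [y_l] is frozen, hence prime, use instead that the new
    variable is positive at a point where [y_l] vanishes.  If [b_lk = 0] and [y_l]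
    is mutable, a kernel vector of the mutable part of the matrix shows that a
    common divisor of [y_l] and the new variable must divide [F], which is
    [f1^3 - f2^2] for [i = 1] and [f1 - f2^2] for [i = 2] in the frozen variables
    [f1], [f2]; but [F] is prime and vanishes at a point where all variables are
    positive.  Hence every cluster variable is a polynomial on [N_i]; conversely
    the coordinates of [N_i] are polynomials in cluster variables.

    On the group side, the unipotent radical of [P_j] is parametrized explicitly by
    7 x 7 matrices, and the minors are identified with matrix entries and 2 x 2
    minors because the big cell [N^- H N^+] is dense in [G]. *)
From HB Require Import structures.
From mathcomp Require Import all_boot all_order all_algebra ring zify.
From mathcomp Require Import boolp classical_sets functions.
From mathcomp Require Import reals topology normedtype derive.
From mathcomp.real_closed Require Import complex.
From mathcomp.multinomials Require Import -(notations) mpoly.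
Require Import Defs.
Set Implicit Arguments.
Unset Strict Implicit.
Unset Printing Implicit Defensive.
Import Order.TTheory GRing.Theory Num.Theory.
Import numFieldNormedType.Exports.
Local Open Scope classical_set_scope.
Local Open Scope ring_scope.

(** * Divisibility and coprimality in an integral domain *)

(** Mutation at index 3 makes the mutable part acyclic, with a diagram of affine type $G_2$. There
    are thus infinitely many cluster variables but finitely many exchange matrices: the matrices are
    enumerated, the variables are controlled by an invariant. The obstacle is a pair of nonadjacent
    indices l, k. A skew-symmetrizable 3 x 3 matrix is singular, so the mutable part alone does not
    exclude a common divisor of the two exchange sums P1 + Q1 and P2 + Q2. In that case, however,
    the kernel vector kap is supported on l and k. Modulo a common divisor P1 = -Q1 and P2 = -Q2;
    raising these to the powers kap_l and kap_k and multiplying, all mutable variables cancel and F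
    remains, up to a coprime monomial. No sign is left because kap_l + kap_k is even. *)

Section Coprimality.
Variable A : idomainType.
Implicit Types a b x y z p : A.

Definition divides x y := exists z, y = z * x.

Definition prime_elt p := forall a b,
  divides p (a * b) -> divides p a \/ divides p b.

(* x is a nonzerodivisor modulo y, and conversely *)
Definition coprime_elt x y := forall a, divides x (y * a) -> divides x a.

Lemma divides_refl x : divides x x.
Proof. by exists 1; rewrite mul1r. Qed.

Lemma divides0 x : divides x 0.
Proof. by exists 0; rewrite mul0r. Qed.

Lemma divides_mull x y z : divides x y -> divides x (z * y).
Proof. by case=> w ->; exists (z * w); rewrite mulrA. Qed.

Lemma divides_mulr x y z : divides x y -> divides x (y * z).
Proof. by rewrite mulrC; apply: divides_mull. Qed.

Lemma dividesD x y z : divides x y -> divides x z -> divides x (y + z).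
Proof. by case=> u -> [v ->]; exists (u + v); rewrite mulrDl. Qed.

Lemma dividesN x y : divides x y -> divides x (- y).
Proof. by case=> u ->; exists (- u); rewrite mulNr. Qed.

Lemma dividesB x y z : divides x y -> divides x z -> divides x (y - z).
Proof. by move=> h1 h2; apply: dividesD (dividesN h2). Qed.

Lemma divides_prod (I : finType) (i : I) x (F : I -> A) :
  divides x (F i) -> divides x (\prod_j F j).
Proof. by move=> h; rewrite (bigD1 i) //=; apply: divides_mulr. Qed.

Lemma divides_exp x y n : (0 < n)%N -> divides x y -> divides x (y ^+ n).
Proof. by case: n => // n _ h; rewrite exprS; apply: divides_mulr. Qed.

(** No gcd is available in a general domain. With this formulation symmetry results from cancelling
    x: if x a = z y, then x divides y z, hence z, and a is a multiple of y. *)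
Lemma coprime_eltC x y : x != 0 -> coprime_elt x y -> coprime_elt y x.
Proof.
move=> x0 h a [z e]; have [w ew] : divides x z.
  by apply: h; exists a; rewrite [RHS]mulrC e mulrC.
by exists w; apply: (mulfI x0); rewrite e ew; ring.
Qed.

Lemma coprime_elt1 x : coprime_elt x 1.
Proof. by move=> a; rewrite mul1r. Qed.

Lemma coprime_eltM x y z :
  coprime_elt x y -> coprime_elt x z -> coprime_elt x (y * z).
Proof. by move=> hy hz a; rewrite -mulrA => /hy/hz. Qed.

Lemma coprime_eltX x y n : coprime_elt x y -> coprime_elt x (y ^+ n).
Proof.
move=> h; elim: n => [|n IHn]; first exact: coprime_elt1.
by rewrite exprS; apply: coprime_eltM.
Qed.

Lemma coprime_elt_prod (I : finType) (P : pred I) x (F : I -> A) :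
  (forall i, P i -> coprime_elt x (F i)) -> coprime_elt x (\prod_(i | P i) F i).
Proof.
move=> h; elim/big_rec: _ => [|i y Pi hy]; first exact: coprime_elt1.
exact: coprime_eltM (h i Pi) hy.
Qed.

Lemma prime_coprime p x : prime_elt p -> ~ divides p x -> coprime_elt p x.
Proof. by move=> pp npx a /pp[]. Qed.

End Coprimality.

(* A prime of a subring remains prime once the subring and the ring become
   equal by inverting an element coprime to it. *)
Lemma prime_elt_localization (A A0 : idomainType) (psi : {rmorphism A0 -> A})
    (p0 q0 : A0) :
  injective psi -> (forall x : A, exists n (y : A0), psi q0 ^+ n * x = psi y) ->
  prime_elt p0 -> ~ divides p0 q0 -> p0 != 0 ->
  coprime_elt (psi p0) (psi q0) -> prime_elt (psi p0).
Proof.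
move=> inj loc pp npq p00 cop a b [w ew].
have [na [a' ea]] := loc a; have [nb [b' eb]] := loc b.
have [nw [w' ew']] := loc w.
(* The denominators of a, b and of the quotient w are cleared by powers of [q0], which moves the
   divisibility into [A0]. *)
have : divides p0 (q0 ^+ nw * (a' * b')).
  exists (w' * q0 ^+ (na + nb)); apply: inj.
  rewrite !rmorphM /= !rmorphXn /= -ea -eb -ew' exprD.
  transitivity (psi q0 ^+ na * psi q0 ^+ nb * psi q0 ^+ nw * (a * b)); first ring.
  by rewrite ew; ring.
have copX n : coprime_elt (psi p0) (psi q0 ^+ n) by apply: coprime_eltX.
move=> /(coprime_eltX (n := nw) (prime_coprime pp npq))/pp[] [z ez].
  by left; apply: (copX na); rewrite ea ez rmorphM; exists (psi z).
by right; apply: (copX nb); rewrite eb ez rmorphM; exists (psi z).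
Qed.

(** * Exchange relations *)

(** The exponent $[z]_+$ as a natural number, since the variables are not invertible in the ring
    [A]. *)
Definition pexp (z : int) : nat := if z is Posz n then n else 0%N.

Lemma exprz_max0 (A : unitRingType) (x : A) (z : int) :
  x ^ Num.max 0 z = x ^+ pexp z.
Proof. by case: z => n; [rewrite max_r | rewrite max_l]. Qed.

Lemma pexp_subN z : (pexp z)%:Z - (pexp (- z))%:Z = z.
Proof. by case: z => [[|n]|n] /=; rewrite ?subr0 // NegzE; lia. Qed.


Section ExchangeRelations.
Variables (A : idomainType) (N : nat).
Implicit Types (y : 'I_N -> A) (b : 'I_N -> int).

Definition exchange_sum y b :=
  \prod_i y i ^+ pexp (b i) + \prod_i y i ^+ pexp (- b i).

Definition update y (k : 'I_N) (z : A) i := if i == k then z else y i.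

(* column l of the mutation at k of a matrix with columns bk and bl *)
Definition mutate_column (k : 'I_N) (bk bl : 'I_N -> int) i : int :=
  if i == k then - bl k
  else bl i + Num.sg (bk i) * Num.max 0 (bk i * bl k).

Lemma exchange_sumN y b : exchange_sum y (fun i => - b i) = exchange_sum y b.
Proof.
rewrite /exchange_sum addrC; congr (_ + _).
by apply: eq_bigr => i _; rewrite opprK.
Qed.

Lemma eq_exchange_sum y b y' b' :
  y =1 y' -> b =1 b' -> exchange_sum y b = exchange_sum y' b'.
Proof.
by move=> ey eb; rewrite /exchange_sum; congr (_ + _); apply: eq_bigr => i _;
  rewrite ey eb.
Qed.

Lemma exchange_sum_update y k z b :
  b k = 0 -> exchange_sum (update y k z) b = exchange_sum y b.
Proof.
move=> bk0; rewrite /exchange_sum /update; congr (_ + _); apply: eq_bigr => i _;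
  by case: eqP => // ->; rewrite bk0 ?oppr0 !expr0.
Qed.

(** According to the sign of b_i one of the two monomials contains y_i; e is the exponent vector of
    the other one. *)
Lemma exchange_sum_dvd y b i :
  b i != 0 -> exists e : 'I_N -> nat,
    [/\ divides (y i) (exchange_sum y b - \prod_j y j ^+ e j),
        e i = 0%N & forall j, b j = 0 -> e j = 0%N].
Proof.
move=> bi0; case: (ltrP 0 (b i)) => bi.
  exists (fun j => pexp (- b j)); split; first 1 last.
  - by case: (b i) bi => // -[].
  - by move=> j ->.
  rewrite addrK; apply: (divides_prod (i := i)).
  by apply: divides_exp; [case: (b i) bi => // -[] | apply: divides_refl].
exists (fun j => pexp (b j)); split; first 1 last.
- by case: (b i) bi bi0 => // -[].
- by move=> j ->.
rewrite [exchange_sum _ _]addrC addrK; apply: (divides_prod (i := i)).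
by apply: divides_exp; [case: (b i) bi bi0 => // -[] | apply: divides_refl].
Qed.

Lemma mutate_columnN k bk bl i :
  mutate_column k (fun j => - bk j) (fun j => - bl j) i
    = - mutate_column k bk bl i.
Proof.
by rewrite /mutate_column; case: eqP => // _; rewrite sgrN mulrNN mulNr opprD.
Qed.

(** Here b_kl = -c < 0 < b_lk. Modulo y_l the first monomial of [exchange_sum y bk] vanishes, so y_k
    z is the monomial with exponents m. Multiplying the old sum of l by z^c and replacing (y_k z)^c
    by the c-th power of that monomial gives the new sum times [mon g], which is coprime to y_l. *)
Lemma exchange_step_lt0 y (k l : 'I_N) bk bl z :
  bk k = 0 -> bl l = 0 -> bl k < 0 -> 0 < bk l ->
  y k * z = exchange_sum y bk ->
  divides (y l) (exchange_sum y bl) ->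
  (forall i, i != l -> coprime_elt (y l) (y i)) ->
  divides (y l) (exchange_sum (update y k z) (mutate_column k bk bl)).
Proof.
move=> bkk bll blk bkl hz hl cop.
have neq_lk : l != k by apply/eqP => elk; rewrite -elk bll in blk.
pose mon (e : 'I_N -> nat) := \prod_(i | i != k) y i ^+ e i.
have monD e e' : mon (fun i => e i + e' i)%N = mon e * mon e'.
  by rewrite -big_split /=; apply: eq_bigr => i _; rewrite exprD.
have monX e c : mon (fun i => e i * c)%N = mon e ^+ c.
  by rewrite -prodrXl; apply: eq_bigr => i _; rewrite exprM.
have eq_mon e e' : (forall i, i != k -> e i = e' i) -> mon e = mon e'.
  by move=> h; apply: eq_bigr => i /h ->.
pose c := pexp (- bl k).
have blkE : bl k = - c%:Z by rewrite /c; case: (bl k) blk => n //= _; rewrite NegzE.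
pose p i := pexp (bl i); pose q i := pexp (- bl i).
pose m i := pexp (- bk i).
pose b' i := mutate_column k bk bl i.
pose p' i := pexp (b' i); pose q' i := pexp (- b' i).
(* The substitution produces the exponents p and q + m c, whereas the mutated column only records
   their difference; g is the common part to be cancelled. *)
pose g i := minn (p i) (q i + m i * c).
have b'E i : i != k -> b' i = (p i)%:Z - (q i)%:Z - (m i)%:Z * c%:Z.
  move=> ik; rewrite /b' /mutate_column (negbTE ik) blkE /p /q /m pexp_subN.
  congr (_ + _); case: (bk i) => n.
    rewrite max_l ?mulr0; last by rewrite mulrN oppr_le0 mulr_ge0.
    by case: n => [|n]; rewrite /= ?oppr0 /= ?mul0r ?oppr0.
  rewrite NegzE opprK /= max_r; last by rewrite mulrNN mulr_ge0.
  by rewrite sgrN /= gtr0_sg // mulN1r mulrNN.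
have gp i : i != k -> (g i + p' i = p i)%N.
  move=> ik; have := pexp_subN (b' i); have := b'E i ik.
  rewrite -/(p' i) -/(q' i) /g.
  have : p' i = 0%N \/ q' i = 0%N by rewrite /p' /q'; case: (b' i) => -[|?]; auto.
  by rewrite -PoszM; lia.
have gq i : i != k -> (g i + q' i = q i + m i * c)%N.
  move=> ik; have := pexp_subN (b' i); have := b'E i ik.
  rewrite -/(p' i) -/(q' i) /g.
  have : p' i = 0%N \/ q' i = 0%N by rewrite /p' /q'; case: (b' i) => -[|?]; auto.
  by rewrite -PoszM; lia.
have copg : coprime_elt (y l) (mon g).
  apply: coprime_elt_prod => i ik; have [->|il] := eqVneq i l.
    rewrite /g /p /q bll /m; case: (bk l) bkl => // -[|n] // _.
    by rewrite /= minn0 expr0; apply: coprime_elt1.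
  exact/coprime_eltX/cop.
apply: copg.
have -> : exchange_sum (update y k z) b' = z ^+ c * mon p' + mon q'.
  rewrite /exchange_sum (bigD1 k) //= [X in _ + X](bigD1 k) //=.
  rewrite /update eqxx /b' /mutate_column eqxx opprK -/c.
  have -> : pexp (bl k) = 0%N by rewrite blkE; case: (c).
  rewrite expr0 mul1r -/b'; congr (_ * _ + _);
    by apply: eq_bigr => i ik; rewrite (negbTE ik) // /p' /q' /b' /mutate_column (negbTE ik).
have El : exchange_sum y bl = mon p + y k ^+ c * mon q.
  rewrite /exchange_sum (bigD1 k) //= [X in _ + X](bigD1 k) //=.
  have -> : pexp (bl k) = 0%N by rewrite blkE; case: (c).
  by rewrite expr0 mul1r.
have Mz : divides (y l) ((y k * z) ^+ c - mon m ^+ c).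
  rewrite subrXX; apply: divides_mulr; rewrite hz /exchange_sum.
  have -> : \prod_i y i ^+ pexp (- bk i) = mon m.
    by rewrite (bigD1 k) //= bkk expr0 mul1r.
  rewrite addrK; apply: (divides_prod (i := l)); apply: divides_exp.
    by case: (bk l) bkl => // -[].
  exact: divides_refl.
have -> : mon g * (z ^+ c * mon p' + mon q')
    = z ^+ c * (mon p + y k ^+ c * mon q) - mon q * ((y k * z) ^+ c - mon m ^+ c).
  rewrite -monX mulrDr mulrCA -!monD (eq_mon _ _ gp) (eq_mon _ _ gq) monD exprMn.
  by ring.
by apply: dividesB; [rewrite -El|]; apply: divides_mull.
Qed.

(** The case b_kl > 0 reduces to b_kl < 0 by negating both columns, which exchanges the two
    monomials of each sum; for b_kl = 0 column l does not change. *)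
Lemma exchange_step y (k l : 'I_N) bk bl z :
  bk k = 0 -> bl l = 0 -> (bl k = 0 \/ bl k * bk l < 0) ->
  l != k ->
  y k * z = exchange_sum y bk ->
  divides (y l) (exchange_sum y bl) ->
  (forall i, i != l -> coprime_elt (y l) (y i)) ->
  divides (y l) (exchange_sum (update y k z) (mutate_column k bk bl)).
Proof.
move=> bkk bll sgn lk hz hl cop.
have [blk|blk|blk] := ltrgtP (bl k) 0.
- apply: exchange_step_lt0 => //; case: sgn => [e|]; first by rewrite e in blk.
  by rewrite nmulr_rlt0.
- rewrite -exchange_sumN.
  have -> : exchange_sum (update y k z) (fun i => - mutate_column k bk bl i)
    = exchange_sum (update y k z)
        (mutate_column k (fun i => - bk i) (fun i => - bl i)).
    by apply: eq_exchange_sum => // i; rewrite mutate_columnN.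
  apply: exchange_step_lt0; rewrite ?bkk ?bll ?oppr0 ?oppr_lt0 ?oppr_gt0 //.
  + by case: sgn => [e|]; [rewrite e in blk | rewrite pmulr_rlt0].
  + by rewrite exchange_sumN.
  + by rewrite exchange_sumN.
- have -> : exchange_sum (update y k z) (mutate_column k bk bl)
    = exchange_sum (update y k z) bl.
    apply: eq_exchange_sum => // i; rewrite /mutate_column blk mulr0 maxxx.
    by rewrite mulr0 addr0 oppr0; case: eqP => [->|].
  by rewrite exchange_sum_update.
Qed.

Lemma coprime_exchange y (i k : 'I_N) bk z :
  bk i != 0 -> bk k = 0 ->
  y k * z = exchange_sum y bk ->
  (forall j, j != i -> coprime_elt (y i) (y j)) -> coprime_elt (y i) z.
Proof.
move=> bi bkk hz cop a ha; have [e [he ei _]] := exchange_sum_dvd y bi.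
have cope : coprime_elt (y i) (\prod_j y j ^+ e j).
  apply: coprime_elt_prod => j _; have [->|ji] := eqVneq j i.
    by rewrite ei expr0; apply: coprime_elt1.
  exact/coprime_eltX/cop.
apply: cope; rewrite -hz in he.
have -> : (\prod_j y j ^+ e j) * a
    = y k * (z * a) - (y k * z - \prod_j y j ^+ e j) * a by ring.
by apply: dividesB; [apply: divides_mull | apply: divides_mulr].
Qed.

End ExchangeRelations.

(** * Common divisors of the exchange sums of two nonadjacent indices *)

Section NonAdjacent.
Variables (A : idomainType) (N : nat).
Implicit Types (y : 'I_N -> A) (b w : 'I_N -> int).

Definition balance y w := \prod_i y i ^+ pexp (w i) - \prod_i y i ^+ pexp (- w i).

(** Modulo d, and after multiplication by a, one has P1 = -Q1 and P2 = -Q2; the total sign (-1)^(n +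
    m) is 1. *)
Lemma divides_balance_aux (d P1 Q1 P2 Q2 a : A) (n m : nat) :
  ~~ odd (n + m) -> divides d ((P1 + Q1) * a) -> divides d ((P2 + Q2) * a) ->
  divides d ((P1 ^+ n * P2 ^+ m - Q1 ^+ n * Q2 ^+ m) * a).
Proof.
move=> nm h1 h2.
have pow P Q c : divides d ((P + Q) * a) ->
    divides d ((P ^+ c - (- Q) ^+ c) * a).
  by move=> h; rewrite subrXX opprK mulrAC; apply: divides_mulr.
have -> : (P1 ^+ n * P2 ^+ m - Q1 ^+ n * Q2 ^+ m) * a
    = P2 ^+ m * ((P1 ^+ n - (- Q1) ^+ n) * a)
      + (- Q1) ^+ n * ((P2 ^+ m - (- Q2) ^+ m) * a).
  have -> : Q1 ^+ n * Q2 ^+ m = (- Q1) ^+ n * (- Q2) ^+ m.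
    by rewrite (exprNn Q1) (exprNn Q2) mulrACA -exprD -signr_odd (negbTE nm) mul1r.
  by ring.
by apply: dividesD; apply: divides_mull; apply: pow.
Qed.

(** The product of powers of the two exchange relations has exponents p and q; their common monomial
    g does not involve y_i and cancels. *)
Lemma divides_balance_nat y (i : 'I_N) bi bk w (a : A) (u v : nat) :
  ~~ odd (u + v) -> (forall j, w j = u%:Z * bi j + v%:Z * bk j) ->
  bi i = 0 -> bk i = 0 ->
  (forall j, j != i -> coprime_elt (y i) (y j)) ->
  divides (y i) (exchange_sum y bi * a) ->
  divides (y i) (exchange_sum y bk * a) ->
  divides (y i) (balance y w * a).
Proof.
move=> uv wE bii bki cop h1 h2.
pose mon (e : 'I_N -> nat) := \prod_j y j ^+ e j.
have monD e e' : mon (fun j => e j + e' j)%N = mon e * mon e'.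
  by rewrite -big_split /=; apply: eq_bigr => j _; rewrite exprD.
have monX e c : mon (fun j => e j * c)%N = mon e ^+ c.
  by rewrite -prodrXl; apply: eq_bigr => j _; rewrite exprM.
have eq_mon e e' : (forall j, e j = e' j) -> mon e = mon e'.
  by move=> h; apply: eq_bigr => j _; rewrite h.
pose p j := (pexp (bi j) * u + pexp (bk j) * v)%N.
pose q j := (pexp (- bi j) * u + pexp (- bk j) * v)%N.
pose g j := minn (p j) (q j).
have wpq j : w j = (p j)%:Z - (q j)%:Z.
  by rewrite wE -{1}(pexp_subN (bi j)) -{1}(pexp_subN (bk j)) /p /q !PoszD !PoszM; ring.
have gp j : (p j = g j + pexp (w j))%N.
  rewrite /g; have := wpq j; case: (w j) => n /=; rewrite ?NegzE; lia.
have gq j : (q j = g j + pexp (- w j))%N.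
  by rewrite /g; have := wpq j; have := gp j; have := pexp_subN (w j); rewrite /g; lia.
have copg : coprime_elt (y i) (mon g).
  apply: coprime_elt_prod => j _; have [->|ji] := eqVneq j i.
    by rewrite /g /p /q bii bki /= expr0; apply: coprime_elt1.
  exact/coprime_eltX/cop.
apply: copg; rewrite mulrA.
have -> : mon g * balance y w = mon p - mon q.
  by rewrite (eq_mon _ _ gp) (eq_mon _ _ gq) !monD mulrBr.
rewrite !monD !monX; exact: divides_balance_aux.
Qed.

(** Negating a column exchanges the monomials of its exchange sum, which absorbs the signs of u and
    v. *)
Lemma divides_balance y (i : 'I_N) bi bk w (a : A) (u v : int) :
  ~~ odd `|u + v| -> (forall j, w j = u * bi j + v * bk j) ->
  bi i = 0 -> bk i = 0 ->
  (forall j, j != i -> coprime_elt (y i) (y j)) ->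
  divides (y i) (exchange_sum y bi * a) ->
  divides (y i) (exchange_sum y bk * a) ->
  divides (y i) (balance y w * a).
Proof.
move=> uv wE bii bki cop h1 h2.
pose sb (t : int) b j := if 0 <= t then b j else - b j.
have sbE t b j : `|t|%N%:Z * sb t b j = t * b j.
  by rewrite /sb; case: (lerP 0 t) => ht; rewrite ?mulrN -?mulNr; congr (_ * _); lia.
have sb0 t b j : b j = 0 -> sb t b j = 0.
  by rewrite /sb => ->; rewrite oppr0; case: ifP.
have sb_sum t b : exchange_sum y (sb t b) = exchange_sum y b.
  by rewrite /sb; case: (0 <= t); rewrite ?exchange_sumN.
apply: (divides_balance_nat (bi := sb u bi) (bk := sb v bk) (u := `|u|) (v := `|v|)).
- by move: uv; lia.
- by move=> j; rewrite !sbE.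
- exact: sb0.
- exact: sb0.
- exact: cop.
- by rewrite sb_sum.
- by rewrite sb_sum.
Qed.

End NonAdjacent.

(** * Seeds of regular functions *)

Section RegularSeeds.
Variables (A : idomainType) (C : numDomainType) (n m : nat).
Variables (f : 'I_m -> A) (w : 'I_m -> int).
Variables (ev : 'I_m -> {rmorphism A -> C}) (evF : {rmorphism A -> C}).
Variable good : ('I_n -> 'I_n -> int) -> ('I_n -> int) -> Prop.

Definition mutate_entries (N : nat) (h : 'I_n -> 'I_N) (b : 'I_N -> 'I_n -> int)
    (k : 'I_n) (i : 'I_N) (j : 'I_n) : int :=
  if (i == h k) || (j == k) then - b i j
  else b i j + Num.sg (b i k) * Num.max 0 (b i k * b (h k) j).

(** Matrix mutation has the form b' = E b E', where E' is an involution that differs from the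
    identity in row k only; the kernel vector is transformed by E'. *)
Definition mutate_kernel (b : 'I_n -> 'I_n -> int) (kap : 'I_n -> int)
    (k j : 'I_n) : int :=
  if j == k then \sum_l Num.max 0 (b k l) * kap l - kap k else kap j.

Hypothesis good_mutate : forall b kap k, good b kap ->
  good (mutate_entries id b k) (mutate_kernel b kap k).
Hypothesis good_diag : forall b kap k, good b kap -> b k k = 0.
Hypothesis good_sign : forall b kap k l, good b kap ->
  (b k l = 0 /\ b l k = 0) \/ b k l * b l k < 0.
Hypothesis good_kernel : forall b kap k, good b kap -> \sum_l b k l * kap l = 0.
Hypothesis good_nonadjacent : forall b kap i k, good b kap -> i != k ->
  b i k = 0 -> ~~ odd `|kap i + kap k| /\
    forall l, l != i -> l != k -> kap l = 0.

Let F := \prod_j f j ^+ pexp (w j) - \prod_j f j ^+ pexp (- w j).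
Hypothesis f_prime : forall j, prime_elt (f j).
Hypothesis F_prime : prime_elt F.
Hypothesis F_neq0 : F != 0.

Notation fro := (@rshift n m).
Notation mut := (@lshift n m).

(* The kernel vector kap of the mutable part of b is sent by the frozen part
   of b to w, whatever the seed. *)
Record regular_seed (y : 'I_(n + m) -> A) (b : 'I_(n + m) -> 'I_n -> int)
    (kap : 'I_n -> int) : Prop := {
  rs_good : good (fun i => b (mut i)) kap ;
  rs_frozen : forall j, \sum_l b (fro j) l * kap l = w j ;
  rs_f : forall j, y (fro j) = f j ;
  rs_div : forall k, divides (y (mut k)) (exchange_sum y (b^~ k)) ;
  rs_cop : forall i j, i != j -> coprime_elt (y i) (y j) ;
  rs_ev0 : forall j, ev j (f j) = 0 ;
  rs_evF0 : evF F = 0 ;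
  rs_ev : forall j i, i != fro j -> 0 < ev j (y i) ;
  rs_evF : forall i, 0 < evF (y i) }.

(** [T] is the same for the positive and the negative parts of row k, since that row kills kap. The
    columns other than k contribute the extra term b_ik T whatever the sign of b_ik, and column k
    subtracts it again. The arbitrary row set covers mutable and frozen rows at once. *)
Lemma mutate_kernelP (N : nat) (h : 'I_n -> 'I_N) b kap (k : 'I_n) i :
  b (h k) k = 0 -> \sum_l b (h k) l * kap l = 0 ->
  i != h k ->
  \sum_l mutate_entries h b k i l * mutate_kernel (fun i => b (h i)) kap k l
    = \sum_l b i l * kap l.
Proof.
move=> bkk ker ik; rewrite (bigD1 k) //= [RHS](bigD1 k) //=.
rewrite /mutate_entries /mutate_kernel !eqxx orbT.
pose T := \sum_l Num.max 0 (b (h k) l) * kap l.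
have TN : \sum_l Num.max 0 (- b (h k) l) * kap l = T.
  apply: subr0_eq; rewrite -sumrB -[RHS]oppr0 -[in RHS]ker -sumrN; apply: eq_bigr => l _.
  by case: (b (h k) l) => -[|c]; rewrite ?NegzE; lia.
have -> : \sum_(l | l != k) (if (i == h k) || (l == k) then - b i l
      else b i l + Num.sg (b i k) * Num.max 0 (b i k * b (h k) l))
      * (if l == k then T - kap k else kap l)
    = \sum_(l | l != k) b i l * kap l + b i k * T.
  rewrite -/T; have -> : b i k * T
      = \sum_(l | l != k) Num.sg (b i k) * Num.max 0 (b i k * b (h k) l) * kap l.
    have [bik|bik|bik] := ltrgtP (b i k) 0.
    - rewrite -TN mulr_sumr (bigD1 k) //= bkk oppr0 maxxx mul0r mulr0 add0r.
      apply: eq_bigr => l _; rewrite ltr0_sg // mulrA; congr (_ * _).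
      case: (lerP 0 (b (h k) l)) => hb.
        by rewrite !max_l ?mulr0 ?oppr_le0 ?nmulr_rle0.
      by rewrite !max_r ?mulNr ?mul1r ?mulrN ?oppr_ge0 ?(ltW hb) // nmulr_rge0 // ltW.
    - rewrite mulr_sumr (bigD1 k) //= bkk maxxx mul0r mulr0 add0r.
      apply: eq_bigr => l _; rewrite gtr0_sg // mul1r mulrA; congr (_ * _).
      case: (lerP 0 (b (h k) l)) => hb.
        by rewrite !max_r // pmulr_rge0.
      by rewrite !max_l ?mulr0 ?(ltW hb) // pmulr_rle0 // ltW.
    - by rewrite bik mul0r big1 // => l _; rewrite sgr0 !mul0r.
  rewrite -big_split /=; apply: eq_bigr => l lk.
  by rewrite (negbTE ik) (negbTE lk) /= mulrDl.
by rewrite -/T; ring.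
Qed.

(** Only [y i0] may vanish at e; by the sign of b_i0 one of the two monomials avoids it and is
    positive. *)
Lemma pos_exchange_sum (e : {rmorphism A -> C}) (y : 'I_(n + m) -> A) (b : _ -> int)
    (i0 : 'I_(n + m)) :
  (forall i, i != i0 -> 0 < e (y i)) -> 0 <= e (y i0) ->
  0 < e (exchange_sum y b).
Proof.
move=> pos nneg; rewrite /exchange_sum rmorphD !rmorph_prod.
have ge0 (c : _ -> nat) : 0 <= \prod_i e (y i ^+ c i).
  apply: prodr_ge0 => i _; rewrite rmorphXn; apply: exprn_ge0.
  by have [->//|/pos/ltW] := eqVneq i i0.
have gt0 (c : _ -> nat) : c i0 = 0%N -> 0 < \prod_i e (y i ^+ c i).
  move=> c0; apply: prodr_gt0 => i _; rewrite rmorphXn.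
  by have [->|/pos h] := eqVneq i i0; rewrite ?c0 ?expr0 ?ltr01 ?exprn_gt0.
case: (leP 0 (b i0)) => hb.
  by apply: ltr_wpDl; [apply: ge0 | apply: gt0; case: (b i0) hb => // -[]].
by apply: ltr_pwDl; [apply: gt0; case: (b i0) hb | apply: ge0].
Qed.

Lemma regular_seed_mutate y b kap k :
  regular_seed y b kap -> exists z,
    y (mut k) * z = exchange_sum y (b^~ k) /\
    regular_seed (update y (mut k) z) (mutate_entries mut b k)
      (mutate_kernel (fun i => b (mut i)) kap k).
Proof.
case=> gd frz fE hdiv hcop ev0 evF0 hev hevF.
have [z ez] := hdiv k; rewrite mulrC in ez.
have bkk : b (mut k) k = 0 by apply: good_diag gd.
have y_neq0 i : y i != 0.
  by apply: contraTneq (hevF i) => ->; rewrite rmorph0 ltxx.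
have pos_z (e : {rmorphism A -> C}) i0 : i0 != mut k ->
    (forall i, i != i0 -> 0 < e (y i)) -> 0 <= e (y i0) -> 0 < e z.
  move=> i0k pos nneg; have := pos_exchange_sum (b^~ k) pos nneg.
  by rewrite ez rmorphM pmulr_rgt0 // pos // eq_sym.
have fro_mut j l : fro j != mut l.
  by rewrite -val_eqE /= neq_ltn orbC (leq_trans (ltn_ord l)) // leq_addr.
have mut_eq l l' : (mut l == mut l') = (l == l').
  by rewrite -val_eqE.
have ev_z j : 0 < ev j z.
  by apply: (pos_z _ (fro j)); [apply: fro_mut | apply: hev | rewrite fE ev0].
have evF_z : 0 < evF z.
  (* [pos_z] asks for an index other than k. A frozen one serves; for m = 0 the positivity of the
     exchange sum is applied directly at k. *)
  case: (posnP m) => m0.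
    have := pos_exchange_sum (i0 := mut k) (e := evF) (y := y) (b^~ k).
    by move=> /(_ (fun i _ => hevF i) (ltW (hevF _))); rewrite ez rmorphM pmulr_rgt0.
  apply: (pos_z _ (fro (Ordinal m0))); first exact: fro_mut.
    by move=> i _; apply: hevF.
  exact/ltW/hevF.
have z0 : z != 0 by apply: contraTneq evF_z => ->; rewrite rmorph0 ltxx.
have cop_z i : i != mut k -> coprime_elt (y i) z.
  move=> ik; have [bik|bik] := eqVneq (b i k) 0; last first.
    apply: (coprime_exchange (bk := b^~ k) (k := mut k)) => // j ji.
    by apply: hcop; rewrite eq_sym.
  case: (split_ordP i) => l ei; rewrite ei in ik bik *; last first.
    rewrite fE; apply: prime_coprime => // -[v ev_].
    by have := ev_z l; rewrite ev_ rmorphM ev0 mulr0 ltxx.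
  rewrite mut_eq in ik.
  have [par supp] := good_nonadjacent gd ik bik.
  have bkl : b (mut k) l = 0.
    by case: (good_sign l k gd) => [[_ ->]//|]; rewrite bik mul0r ltxx.
  have copF : coprime_elt (y (mut l)) F.
    apply: coprime_eltC => //; apply: prime_coprime => // -[v ev_].
    by have := hevF (mut l); rewrite ev_ rmorphM evF0 mulr0 ltxx.
  move=> a ha; apply: copF.
  (* The vector w, extended by 0 to the mutable indices, is b applied to kap on all rows. *)
  pose wt (j : 'I_(n + m)) := match fintype.split j with inl _ => 0 | inr j => w j end.
  have wt_mut t : wt (mut t) = 0 by rewrite /wt -[mut t]/(unsplit (inl t)) unsplitK.
  have wt_fro t : wt (fro t) = w t by rewrite /wt -[fro t]/(unsplit (inr t)) unsplitK.
  have -> : F = balance y wt.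
    have prodE (g : int -> nat) : g 0 = 0%N ->
        \prod_j y j ^+ g (wt j) = \prod_j f j ^+ g (w j).
      move=> g0; rewrite big_split_ord /= big1 ?mul1r => [|t _].
        by apply: eq_bigr => t _; rewrite wt_fro fE.
      by rewrite wt_mut g0.
    by rewrite /balance prodE // (prodE (fun t => pexp (- t))) ?oppr0.
  have wtE j : wt j = \sum_i b j i * kap i.
    by rewrite /wt; case: (split_ordP j) => t ->; rewrite ?(good_kernel t gd) ?frz.
  (* The other entries of kap vanish, so [wt] is kap_l times column l plus kap_k times column k. *)
  apply: (divides_balance (bi := b^~ l) (bk := b^~ k) (u := kap l) (v := kap k)) => //.
  - move=> j; rewrite wtE (bigD1 l) //= (bigD1 k) //=; last by rewrite eq_sym.
    rewrite big1 ?addr0 => [|t /andP[tl tk]]; last by rewrite supp ?mulr0.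
    by rewrite mulrC [kap k * _]mulrC.
  - by apply: good_diag gd.
  - by move=> j jl; apply: hcop; rewrite eq_sym.
  - by apply: divides_mulr.
  - rewrite ez; case: ha => v hv; exists (y (mut k) * v).
    by rewrite -[LHS]mulrA hv mulrA.
exists z; split=> //; split=> //.
- exact: good_mutate.
- move=> j; rewrite mutate_kernelP ?frz //.
  exact: (good_kernel k gd).
- by move=> j; rewrite /update ifN ?fE //; apply: fro_mut.
- have colE l : l != k ->
      mutate_entries mut b k ^~ l =1 mutate_column (mut k) (b^~ k) (b^~ l).
    move=> lk i; rewrite /mutate_entries /mutate_column (negbTE lk) orbF.
    by case: eqP => [->|].
  move=> l; have [->|lk] := eqVneq l k.
    (* Column k only changes its sign, so its exchange sum is still y_k z, and the quotient by the
       new variable is the old one. *)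
    have -> : exchange_sum (update y (mut k) z) (mutate_entries mut b k ^~ k)
        = y (mut k) * z.
      rewrite -ez -[RHS](@exchange_sum_update _ _ _ (mut k) z) //.
      rewrite -[RHS]exchange_sumN; apply: eq_exchange_sum => // i.
      by rewrite /mutate_entries eqxx orbT.
    by rewrite /update eqxx; apply/divides_mull/divides_refl.
  rewrite {1}/update mut_eq (negbTE lk).
  rewrite (eq_exchange_sum (fun _ => erefl) (colE l lk)).
  apply: exchange_step => //.
  + by apply: good_diag gd.
  + by case: (good_sign k l gd) => [[]|]; [left|right].
  + by move=> i il; apply: hcop; rewrite eq_sym.
- move=> i j ij; rewrite /update.
  have [ei|ik] := eqVneq i (mut k); have [ej|jk] := eqVneq j (mut k).
  + by rewrite ei ej eqxx in ij.
  + by apply: coprime_eltC; [apply: y_neq0 | apply: cop_z].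
  + exact: cop_z.
  + exact: hcop.
- by move=> j i ij; rewrite /update; case: eqP => // _; apply: hev.
- by move=> i; rewrite /update; case: eqP.
Qed.

End RegularSeeds.

(** * Mutation classes of 3 x 3 matrices with a kernel vector *)

(* [:: b00; b01; b02; b10; ...; b22; kap0; kap1; kap2] *)
Section MutationClass.
Implicit Types (s : seq int) (L : seq (seq int)).

Definition entry s (i j : nat) : int := nth 0 s (3 * i + j).
Definition kernel_entry s (i : nat) : int := nth 0 s (9 + i).

Definition mutate_seq s k :=
  mkseq (fun p => let i := (p %/ 3)%N in let j := (p %% 3)%N in
    if (i == k) || (j == k) then - entry s i j
    else entry s i j + Num.sg (entry s i k) * Num.max 0 (entry s i k * entry s k j)) 9
  ++ mkseq (fun j => if j == k then
       foldr (fun l z => Num.max 0 (entry s k l) * kernel_entry s l + z) 0 (iota 0 3)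
         - kernel_entry s k
     else kernel_entry s j) 3.

Definition good_seq s :=
  let I := iota 0 3 in
  [&& all (fun k => entry s k k == 0) I,
      all (fun k => all (fun l =>
        (entry s k l == 0) && (entry s l k == 0) || (entry s k l * entry s l k < 0)) I) I,
      all (fun k => foldr (fun l z => entry s k l * kernel_entry s l + z) 0 I == 0) I
    & all (fun i => all (fun k => (i != k) && (entry s i k == 0) ==>
        ~~ odd `|kernel_entry s i + kernel_entry s k| &&
        all (fun l => (l == i) || (l == k) || (kernel_entry s l == 0)) I) I) I].

Definition mutation_closed L :=
  all (fun s => good_seq s && all (fun k => mutate_seq s k \in L) (iota 0 3)) L.

Definition mutation_class (t : nat) s :=
  iter t (fun L => undup (L ++ [seq mutate_seq r k | r <- L, k <- iota 0 3])) [:: s].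

Definition in_class L (b : 'I_3 -> 'I_3 -> int) (kap : 'I_3 -> int) :=
  exists s, [/\ s \in L, forall i j, b i j = entry s i j
    & forall i, kap i = kernel_entry s i].

Variable L : seq (seq int).
Hypothesis closedL : mutation_closed L.
Implicit Types (b : 'I_3 -> 'I_3 -> int) (kap : 'I_3 -> int) (i k l : 'I_3).

Let mem_iota3 i : (i : nat) \in iota 0 3.
Proof. by rewrite mem_iota add0n ltn_ord. Qed.

Let sum_foldr (F : nat -> int) :
  \sum_(l < 3) F l = foldr (fun (l : nat) z => F l + z) 0 (iota 0 3).
Proof. by rewrite !big_ord_recl big_ord0. Qed.

Lemma in_class_mutate b kap k : in_class L b kap ->
  in_class L (mutate_entries id b k) (mutate_kernel b kap k).
Proof.
case=> s [sL bE kE]; exists (mutate_seq s k); split.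
- by have /andP[_ /allP] := allP closedL s sL; apply.
- move=> i j; rewrite {1}/entry nth_cat size_mkseq.
  have lt9 : (3 * i + j < 9)%N by have := ltn_ord i; have := ltn_ord j; lia.
  rewrite lt9 nth_mkseq // /mutate_entries.
  have -> : ((3 * i + j) %/ 3)%N = i by have := ltn_ord j; lia.
  have -> : ((3 * i + j) %% 3)%N = j by have := ltn_ord j; lia.
  by rewrite /= !bE -!val_eqE.
- move=> i; rewrite {1}/kernel_entry nth_cat size_mkseq.
  have -> : (9 + i < 9)%N = false by lia.
  rewrite addKn nth_mkseq // /mutate_kernel.
  rewrite -val_eqE !kE; case: eqP => // _; congr (_ - _).
  rewrite -(sum_foldr (fun l : nat => Num.max 0 (entry s k l) * kernel_entry s l)).
  by apply: eq_bigr => l _; rewrite bE kE.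
Qed.

Let good b kap : in_class L b kap -> exists s,
  [/\ good_seq s, forall i j, b i j = entry s i j & forall i, kap i = kernel_entry s i].
Proof.
by case=> s [sL bE kE]; exists s; split=> //; have /andP[] := allP closedL s sL.
Qed.

Lemma in_class_diag b kap k : in_class L b kap -> b k k = 0.
Proof.
by case/good=> s [/and4P[/allP h _ _ _] bE _]; rewrite bE; apply/eqP/h.
Qed.

Lemma in_class_sign b kap k l : in_class L b kap ->
  (b k l = 0 /\ b l k = 0) \/ b k l * b l k < 0.
Proof.
case/good=> s [/and4P[_ /allP/(_ k (mem_iota3 k))/allP/(_ l (mem_iota3 l)) h _ _] bE _].
by rewrite !bE; case/orP: h => [/andP[/eqP -> /eqP ->]|]; [left|right].
Qed.

Lemma in_class_kernel b kap k : in_class L b kap -> \sum_l b k l * kap l = 0.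
Proof.
case/good=> s [/and4P[_ _ /allP/(_ k (mem_iota3 k))/eqP h _] bE kE].
rewrite -[RHS]h -(sum_foldr (fun l : nat => entry s k l * kernel_entry s l)).
by apply: eq_bigr => l _; rewrite bE kE.
Qed.

Lemma in_class_nonadjacent b kap i k : in_class L b kap -> i != k ->
  b i k = 0 -> ~~ odd `|kap i + kap k| /\ forall l, l != i -> l != k -> kap l = 0.
Proof.
case/good=> s [/and4P[_ _ _ /allP/(_ i (mem_iota3 i))/allP/(_ k (mem_iota3 k)) h] bE kE].
move=> ik /eqP; rewrite bE => bik; rewrite !kE.
move: h; rewrite -val_eqE in ik; rewrite ik bik => /implyP/(_ isT)/andP[-> /allP h]; split=> // l.
rewrite -!val_eqE /= kE => li lk; have := h l (mem_iota3 l).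
by rewrite (negbTE li) (negbTE lk) => /eqP.
Qed.

End MutationClass.

(** Each list holds the rows of the mutable part, then the kernel vector (3, 1, 3), respectively (1,
    1, 1). Twelve rounds of mutation reach a closed list, which evaluation of [mutation_closed]
    confirms. *)
Definition class1 := mutation_class 12 [:: 0; -3; 1; 1; 0; -1; -1; 3; 0; 3; 1; 3].
Definition class2 := mutation_class 12 [:: 0; -1; 1; 3; 0; -3; -1; 1; 0; 1; 1; 1].


(** * Cluster variables as regular functions *)

Section ClusterVariables.
Variables (A : idomainType) (K : fieldType) (phi : {rmorphism A -> K}).
Hypothesis phi_inj : injective phi.

Let phi_neq0 x : x != 0 -> phi x != 0.
Proof. by move=> x0; rewrite -(rmorph0 phi) (inj_eq phi_inj). Qed.

Lemma rmorph_exchange_sum (N : nat) (y : 'I_N -> A) (b : 'I_N -> int) :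
  phi (exchange_sum y b)
    = \prod_l phi (y l) ^ Num.max 0 (b l) + \prod_l phi (y l) ^ Num.max 0 (- b l).
Proof.
rewrite /exchange_sum rmorphD !rmorph_prod.
by congr (_ + _); apply: eq_bigr => l _; rewrite exprz_max0 rmorphXn.
Qed.

Definition seed_rel (n m : nat) (S : seed n m K) (y : 'I_(n + m) -> A)
    (b : 'I_(n + m) -> 'I_n -> int) :=
  (forall i, extended_cluster S i = phi (y i)) /\
  (forall i j, exchange_matrix S i j = b i j).

Lemma seed_rel_mutate n m (S : seed n m K) y b (k : 'I_n) z :
  seed_rel S y b -> y (lshift m k) != 0 ->
  y (lshift m k) * z = exchange_sum y (b^~ k) ->
  seed_rel (mutate S k) (update y (lshift m k) z) (mutate_entries (@lshift n m) b k).
Proof.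
case=> eS eB yk0 ez; split=> [i|i j]; rewrite /mutate /=.
  rewrite /update; case: eqP => // _.
  have -> : phi z = phi (exchange_sum y (b^~ k)) / phi (y (lshift m k)).
    by rewrite -ez rmorphM mulrC mulKf // phi_neq0.
  rewrite rmorph_exchange_sum eS; congr ((_ + _) / _);
    by apply: eq_bigr => l _; rewrite eS eB.
by rewrite mxE /mutate_entries !eB.
Qed.

(** The induction on the mutation sequence runs over all regular seeds at once; each new variable is
    found inside A because the exchange sum is divisible there. *)
Lemma cluster_variables_regular (C : numDomainType) (m : nat) (f : 'I_m -> A)
    (w : 'I_m -> int) (ev : 'I_m -> {rmorphism A -> C}) (evF : {rmorphism A -> C})
    (L : seq (seq int)) (S : seed 3 m K) y b kap :
  mutation_closed L -> (forall j, prime_elt (f j)) ->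
  let F := \prod_j f j ^+ pexp (w j) - \prod_j f j ^+ pexp (- w j) in
  prime_elt F -> F != 0 ->
  regular_seed f w ev evF (in_class L) y b kap -> seed_rel S y b ->
  cluster_variables S `<=` range phi.
Proof.
move=> closedL fP F FP F0 reg rel z [ks [k ->]] {z}.
elim: ks S y b kap reg rel => [|k0 ks IHks] S y b kap reg rel /=.
  by exists (y (lshift m k)) => //; rewrite (proj1 rel).
have [z [ez reg']] := regular_seed_mutate (in_class_mutate closedL)
  (in_class_diag closedL) (in_class_sign closedL) (in_class_kernel closedL)
  (in_class_nonadjacent closedL) fP FP F0 k0 reg.
apply: IHks reg' _; apply: seed_rel_mutate => //.
by apply: contraTneq (rs_evF reg (lshift m k0)) => ->; rewrite rmorph0 ltxx.
Qed.

Definition seed_seq (m : nat) (S : seed 3 m K) (ys : seq A) (rows : seq (seq int)) :=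
  seed_rel S (fun i => nth 0 ys i) (fun i j => nth 0 (nth [::] rows i) j).

Definition mutate_rows (k : nat) (rows : seq (seq int)) :=
  let b i j := nth 0 (nth [::] rows i) j in
  mkseq (fun i => mkseq (fun j => if (i == k) || (j == k) then - b i j
    else b i j + Num.sg (b i k) * Num.max 0 (b i k * b k j)) 3) (size rows).

Definition monomial_seq (ys : seq A) (p : seq nat) :=
  foldr *%R 1 [seq u.1 ^+ u.2 | u <- zip ys p].

Definition column_exponents (g : int -> int) (k : nat) (rows : seq (seq int)) :=
  [seq pexp (g (nth 0 r k)) | r <- rows].

Lemma monomial_seqE (ys : seq A) (N : nat) (c : nat -> nat) :
  size ys = N -> \prod_(i < N) nth 0 ys i ^+ c i = monomial_seq ys (mkseq c N).
Proof.
move=> <-; rewrite /monomial_seq; elim: ys c => [|y ys IH] c; first by rewrite big_ord0.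
rewrite /= big_ord_recl /= (IH (fun i => c i.+1)) /mkseq -[1%N]addn0 iotaDl.
by rewrite -map_comp.
Qed.

(** Made for explicit mutation paths: the matrix and the exponents are obtained by evaluation, and a
    single polynomial identity remains to be checked. *)
Lemma seed_seq_mutate m (S : seed 3 m K) ys rows (k : 'I_3) rows' p q z :
  seed_seq S ys rows -> size ys = (3 + m)%N -> size rows = (3 + m)%N ->
  (mutate_rows k rows, column_exponents id k rows, column_exponents -%R k rows)
    = (rows', p, q) ->
  nth 0 ys k != 0 ->
  nth 0 ys k * z = monomial_seq ys p + monomial_seq ys q ->
  seed_seq (mutate S k) (set_nth 0 ys k z) rows'.
Proof.
move=> rel sy sr [er ep eq] yk0 ez.
have expE (g : int -> int) : column_exponents g k rows
    = mkseq (fun i => pexp (g (nth 0 (nth [::] rows i) k))) (3 + m).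
  apply: (@eq_from_nth _ 0%N); rewrite ?size_mkseq ?size_map // sr => i lti.
  by rewrite (nth_map [::]) ?sr // nth_mkseq.
have := seed_rel_mutate (k := k) (z := z) rel yk0; rewrite /exchange_sum.
rewrite (monomial_seqE (fun i => pexp (nth 0 (nth [::] rows i) k)) sy).
rewrite (monomial_seqE (fun i => pexp (- nth 0 (nth [::] rows i) k)) sy).
rewrite -(expE id) -(expE -%R) ep eq => /(_ ez)[eS eB]; split=> [i|i j].
  by rewrite eS /update nth_set_nth /= -val_eqE.
by rewrite eB -er /mutate_rows nth_mkseq ?sr // nth_mkseq.
Qed.

Lemma seed_seq_variable m (S S' : seed 3 m K) ks ys rows (k : 'I_3) :
  S' = foldl (@mutate 3 m K) S ks -> seed_seq S' ys rows ->
  cluster_variables S (phi (nth 0 ys k)).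
Proof. by move=> -> [h _]; exists ks, k; rewrite h. Qed.

End ClusterVariables.

(** * The two initial seeds *)

Section Paths.
Variables (A : idomainType) (K : fieldType) (phi : {rmorphism A -> K}).
Hypothesis phi_inj : injective phi.
Variable S : seed 3 2 K.

Definition o0 : 'I_3 := @Ordinal 3 0 isT.
Definition o1 : 'I_3 := @Ordinal 3 1 isT.
Definition o2 : 'I_3 := @Ordinal 3 2 isT.

(** The initial seed on N_1, in the order 1, 2, 3, -1, -2, written in coordinates each of which is a
    cluster variable. *)
Definition ys1 (a b c d e : A) :=
  [:: a * b - d; d; a; a * c + b ^+ 2 - e * d; b * e * d - b ^+ 3 - d * c].

(** Mutations at 3, 1, 2, 3 produce b, c, b e - c and e in turn; a and d belong to the initial
    seed. *)
Lemma path1 (a b c d e : A) :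
  a != 0 -> b != 0 -> d != 0 -> a * b - d != 0 ->
  seed_seq phi S (ys1 a b c d e) (take 5 rows1) ->
  forall x, x \in [:: a; b; c; d; e] -> cluster_variables S (phi x).
Proof.
move=> a0 b0 d0 y0 rel.
have r1 := seed_seq_mutate phi_inj (k := o2) (z := b) rel erefl erefl
  ltac:(vm_compute; reflexivity) a0 ltac:(rewrite /monomial_seq /=; ring).
have r2 := seed_seq_mutate phi_inj (k := o0) (z := c) r1 erefl erefl
  ltac:(vm_compute; reflexivity) y0 ltac:(rewrite /monomial_seq /=; ring).
have r3 := seed_seq_mutate phi_inj (k := o1) (z := b * e - c) r2 erefl erefl
  ltac:(vm_compute; reflexivity) d0 ltac:(rewrite /monomial_seq /=; ring).
have r4 := seed_seq_mutate phi_inj (k := o2) (z := e) r3 erefl erefl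
  ltac:(vm_compute; reflexivity) b0 ltac:(rewrite /monomial_seq /=; ring).
move=> x; rewrite !inE => /or4P[|||/orP[]] /eqP ->.
- exact: (seed_seq_variable (ks := [::]) o2 erefl rel).
- exact: (seed_seq_variable (ks := [:: o2]) o2 erefl r1).
- exact: (seed_seq_variable (ks := [:: o2; o0]) o0 erefl r2).
- exact: (seed_seq_variable (ks := [::]) o1 erefl rel).
- exact: (seed_seq_variable (ks := [:: o2; o0; o1; o2]) o2 erefl r4).
Qed.

(** The initial seed on N_2. The coordinate t is the coefficient of index -2, the other coordinates
    are cluster variables. *)
Definition ys2 (p q r s t : A) :=
  [:: q * r * s - r ^+ 3 - s * t; r; s;
      p * q * r * s - p * r ^+ 3 - p * s * t - q ^+ 3 * s + q ^+ 2 * r ^+ 2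
        + q * r * t + t ^+ 2; t].

(** Mutations at 3, 1, 2, 3 produce q r - t, p (q r - t) - q^3, q and p in turn; r and s belong to
    the initial seed. *)
Lemma path2 (p q r s t : A) :
  s != 0 -> r != 0 -> q * r - t != 0 -> q * r * s - r ^+ 3 - s * t != 0 ->
  seed_seq phi S (ys2 p q r s t) (take 5 rows2) ->
  forall x, x \in [:: p; q; r; s] -> cluster_variables S (phi x).
Proof.
move=> s0 r0 z0 y0 rel.
have r1 := seed_seq_mutate phi_inj (k := o2) (z := q * r - t) rel erefl erefl
  ltac:(vm_compute; reflexivity) s0 ltac:(rewrite /monomial_seq /=; ring).
have r2 := seed_seq_mutate phi_inj (k := o0) (z := p * q * r - p * t - q ^+ 3)
  r1 erefl erefl
  ltac:(vm_compute; reflexivity) y0 ltac:(rewrite /monomial_seq /=; ring).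
have r3 := seed_seq_mutate phi_inj (k := o1) (z := q) r2 erefl erefl
  ltac:(vm_compute; reflexivity) r0 ltac:(rewrite /monomial_seq /=; ring).
have r4 := seed_seq_mutate phi_inj (k := o2) (z := p) r3 erefl erefl
  ltac:(vm_compute; reflexivity) z0 ltac:(rewrite /monomial_seq /=; ring).
move=> x; rewrite !inE => /or4P[] /eqP ->.
- exact: (seed_seq_variable (ks := [:: o2; o0; o1; o2]) o2 erefl r4).
- exact: (seed_seq_variable (ks := [:: o2; o0; o1]) o1 erefl r3).
- exact: (seed_seq_variable (ks := [::]) o1 erefl rel).
- exact: (seed_seq_variable (ks := [::]) o2 erefl rel).
Qed.

End Paths.

(** * Polynomial rings *)

(** Uniqueness of digits in base D keeps distinct monomials of small degree distinct under the
    Kronecker substitution below. *)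
Lemma base_expansion_inj (D n : nat) (f g : 'I_n -> nat) :
  (forall i, f i < D)%N -> (forall i, g i < D)%N ->
  (\sum_i f i * D ^ i)%N = (\sum_i g i * D ^ i)%N -> f =1 g.
Proof.
elim: n f g => [|n IHn] f g fD gD; first by move=> _ [].
have shift (h : 'I_n.+1 -> nat) :
    (\sum_i h i * D ^ i = h ord0 + (\sum_(i < n) h (lift ord0 i) * D ^ i) * D)%N.
  rewrite big_ord_recl muln1 big_distrl /=; congr (_ + _)%N.
  by apply: eq_bigr => i _; rewrite /bump /= add1n expnSr mulnA.
rewrite !shift => e.
have D0 : (0 < D)%N by apply: leq_ltn_trans (fD ord0).
have e0 : f ord0 = g ord0.
  have := congr1 (modn^~ D) e.
  by rewrite /= ![(_ + _ * D)%N]addnC !modnMDl !modn_small.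
move: e; rewrite e0 => /addnI/eqP; rewrite eqn_pmul2r // => /eqP e.
by move=> i; case: (unliftP ord0 i) => [j ->|-> //]; apply: IHn e j.
Qed.

(* Kronecker substitution X_i := X^(D^i) *)
Lemma mpoly_eval_eq0 (C : numFieldType) (n : nat) (p : mpoly n C) :
  (forall v : 'I_n -> C, meval v p = 0) -> p = 0.
Proof.
move=> p0; apply/eqP/negPn/negP => nz.
pose D := (msize p).+1.
pose K (m : multinom n) := (\sum_i m i * D ^ i)%N.
pose q : {poly C} := \sum_(m <- msupp p) mcoeff m p *: 'X^(K m).
have degD m : m \in msupp p -> forall i, (m i < D)%N.
  move=> /msize_mdeg_lt hm i; apply: leq_ltn_trans (leqW hm).
  by rewrite mdegE (bigD1 i) //= leq_addr.
have q0 t : q.[t] = 0.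
  rewrite -(p0 (fun i => t ^+ (D ^ i))) /q horner_sum /meval /mmap.
  apply: eq_bigr => m _; rewrite hornerZ hornerXn /K expr_sum; congr (_ * _).
  by apply: eq_bigr => i _; rewrite -exprM mulnC.
have {}q0 : q = 0.
  (* Every natural number is a root, and these are distinct in characteristic 0. *)
  apply: (roots_geq_poly_eq0 (rs := [seq k%:R | k <- iota 0 (size q)])).
  - by apply/allP => t _; rewrite /root q0.
  - by rewrite map_inj_uniq ?iota_uniq // => i j /eqP; rewrite eqr_nat => /eqP.
  - by rewrite size_map size_iota.
case em : (msupp p) => [|m0 s]; first by move/eqP: em; rewrite msupp_eq0 (negbTE nz).
have m0p : m0 \in msupp p by rewrite em mem_head.
have := congr1 (fun r : {poly C} => r`_(K m0)) q0; rewrite /q coef_sum coef0.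
rewrite (bigD1_seq m0) //= ?msupp_uniq // big_seq_cond big1 => [|m /andP[mp mm0]].
  by rewrite addr0 coefZ coefXn eqxx mulr1 => /eqP; apply/negP; rewrite -mcoeff_msupp.
rewrite coefZ coefXn; case: eqP => [e|]; rewrite ?mulr0 //; case/eqP: mm0.
by apply/mnmP/(base_expansion_inj (D := D)); [apply: degD|apply: degD|rewrite -/(K m) -e].
Qed.

(* A polynomial ring over C, given by its universal property; points are
   separated by evaluation. *)
Record polynomial_ring (n : nat) (C : fieldType) (A : idomainType) := PolynomialRing {
  pcst : {rmorphism C -> A} ;
  pvar : 'I_n -> A ;
  peval : forall B : comNzRingType, {rmorphism C -> B} -> ('I_n -> B) -> {rmorphism A -> B} ;
  peval_cst : forall (B : comNzRingType) (g : {rmorphism C -> B}) v c,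
    peval g v (pcst c) = g c ;
  peval_var : forall (B : comNzRingType) (g : {rmorphism C -> B}) v i,
    peval g v (pvar i) = v i ;
  pind : forall P : A -> Prop, (forall c, P (pcst c)) -> (forall i, P (pvar i)) ->
    (forall x y, P x -> P y -> P (x + y)) -> (forall x y, P x -> P y -> P (x * y)) ->
    forall x, P x ;
  psep : forall x, (forall v : 'I_n -> C, peval idfun v x = 0) -> x = 0 }.

Section MpolyRing.
Variables (n : nat) (C : numFieldType).

Definition mpoly_eval (B : comNzRingType) (g : {rmorphism C -> B}) (v : 'I_n -> B) :
  {rmorphism mpoly n C -> B} := mmap g v.

Lemma mpoly_ind (P : mpoly n C -> Prop) :
  (forall c, P (mpolyC n c)) -> (forall i, P (mpolyX C (mnm1 i))) ->
  (forall x y, P x -> P y -> P (x + y)) -> (forall x y, P x -> P y -> P (x * y)) ->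
  forall x, P x.
Proof.
move=> Pc Px PD PM; elim/mpolyind; first by rewrite -(mpolyC0 n C).
move=> c m p _ _ Pp; apply: PD => //; rewrite -mul_mpolyC; apply: (PM) => //.
rewrite mpolyXE_id; elim/big_rec: _ => [|i x _ Px']; first exact: (Pc 1).
apply: (PM) Px'; elim: (m i) => [|k IHk]; first exact: (Pc 1).
by rewrite exprS; apply: PM (Px i) IHk.
Qed.

Definition mpoly_polynomial_ring : polynomial_ring n C (mpoly n C).
Proof.
exists (mpolyC n (R := C)) (fun i => mpolyX C (mnm1 i)) mpoly_eval.
- by move=> B g v c; rewrite /mpoly_eval /= mmapC.
- by move=> B g v i; rewrite /mpoly_eval /= mmapX mmap1U.
- exact: mpoly_ind.
- exact: mpoly_eval_eq0.
Defined.

End MpolyRing.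

Section PolynomialPrimes.
Variables (n : nat) (C : numClosedFieldType) (A : idomainType).
Variable PR : polynomial_ring n C A.

Notation cst := (pcst PR).
Notation X := (pvar PR).

Definition point (v : 'I_n -> C) : {rmorphism A -> C} := peval PR idfun v.

Lemma point_cst v c : point v (cst c) = c.
Proof. exact: peval_cst. Qed.

Lemma point_var v i : point v (X i) = v i.
Proof. exact: peval_var. Qed.

Lemma eq_rmorphism (B : comNzRingType) (g h : {rmorphism A -> B}) :
  (forall c, g (cst c) = h (cst c)) -> (forall i, g (X i) = h (X i)) -> g =1 h.
Proof.
move=> ec ex; apply: (pind (p := PR)) => [c|i|x y ex' ey|x y ex' ey].
- exact: ec.
- exact: ex.
- by rewrite !rmorphD ex' ey.
- by rewrite !rmorphM ex' ey.
Qed.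

(** Being fixed modulo y passes to sums and products, hence from the variables to all of A. *)
Lemma subst_kernel (sigma : {rmorphism A -> A}) y :
  (forall c, sigma (cst c) = cst c) ->
  (forall i, divides y (sigma (X i) - X i)) ->
  forall x, divides y (sigma x - x).
Proof.
move=> sc sx; apply: (pind (p := PR)) => [c|i|a b ha hb|a b ha hb].
- by rewrite sc subrr; apply: divides0.
- exact: sx.
- have -> : sigma (a + b) - (a + b) = (sigma a - a) + (sigma b - b).
    by rewrite rmorphD; ring.
  exact: dividesD.
- have -> : sigma (a * b) - a * b = sigma a * (sigma b - b) + (sigma a - a) * b.
    by rewrite rmorphM; ring.
  by apply: dividesD; [apply: divides_mull | apply: divides_mulr].
Qed.

(** A modulo y embeds in the domain B. *)
Lemma prime_of_kernel (B : idomainType) (tau : {rmorphism A -> B}) y :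
  tau y = 0 -> (forall x, tau x = 0 -> divides y x) -> prime_elt y.
Proof.
move=> ty0 ker a b [z e]; have : tau a * tau b == 0.
  by rewrite -rmorphM e rmorphM ty0 mulr0.
by rewrite mulf_eq0 => /orP[] /eqP h; [left|right]; apply: ker.
Qed.

(** The substitution is the identity modulo y and kills y, so its kernel is the ideal of y. *)
Lemma prime_subst (v : 'I_n -> A) y :
  (forall i, divides y (v i - X i)) -> peval PR cst v y = 0 -> prime_elt y.
Proof.
move=> hv s0; apply: (prime_of_kernel s0) => x sx.
rewrite -[x]opprK -[- x]add0r -sx; apply: dividesN.
apply: subst_kernel => [c|i]; first exact: peval_cst.
by rewrite peval_var.
Qed.

Lemma prime_var i : prime_elt (X i).
Proof.
apply: (@prime_subst (fun k => if k == i then 0 else X k)) => [k|].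
  case: eqP => [->|_]; last by rewrite subrr; apply: divides0.
  by rewrite sub0r; apply/dividesN/divides_refl.
by rewrite peval_var eqxx.
Qed.

(* The cusp is parametrized by X_i = s^2, X_j = s^3, with s := X_j. *)
Lemma prime_cusp (i j : 'I_n) : i != j -> prime_elt (X i ^+ 3 - X j ^+ 2).
Proof.
move=> ij; have ji : (j == i) = false by rewrite eq_sym (negbTE ij).
set y := _ - _.
pose tau : {rmorphism A -> A} :=
  peval PR cst (fun k => if k == i then X j ^+ 2 else if k == j then X j ^+ 3 else X k).
pose sigma : {rmorphism A -> A} := peval PR cst (fun k => if k == j then 0 else X k).
pose nu : {rmorphism A -> A} := peval PR cst (fun k => if k == j then - X j else X k).
have tauc c : tau (cst c) = cst c by apply: peval_cst.
have sigmac c : sigma (cst c) = cst c by apply: peval_cst.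
have nuc c : nu (cst c) = cst c by apply: peval_cst.
have tauX k : tau (X k) = if k == i then X j ^+ 2 else if k == j then X j ^+ 3 else X k.
  exact: peval_var.
have sigmaX k : sigma (X k) = if k == j then 0 else X k by apply: peval_var.
have nuX k : nu (X k) = if k == j then - X j else X k by apply: peval_var.
have tauy : tau y = 0 by rewrite /y rmorphB !rmorphXn /= !tauX eqxx ji eqxx; ring.
(* Division by y, which is monic in X_j up to sign, leaves a remainder of degree at most 1 in X_j;
   [sigma] makes its coefficients free of X_j. *)
have split_y x : exists r0 r1, divides y (x - (sigma r0 + sigma r1 * X j)).
  move: x; apply: (pind (p := PR)) =>
    [c|k|a b [a0 [a1 ha]] [b0 [b1 hb]]|a b [a0 [a1 ha]] [b0 [b1 hb]]].
  - by exists (cst c), 0; rewrite sigmac rmorph0 mul0r addr0 subrr; apply: divides0.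
  - have [->|kj] := eqVneq k j.
      exists 0, 1; rewrite rmorph0 rmorph1 mul1r add0r subrr; exact: divides0.
    exists (X k), 0; rewrite sigmaX (negbTE kj) rmorph0 mul0r addr0 subrr.
    exact: divides0.
  - exists (a0 + b0), (a1 + b1).
    have -> : a + b - (sigma (a0 + b0) + sigma (a1 + b1) * X j)
      = (a - (sigma a0 + sigma a1 * X j)) + (b - (sigma b0 + sigma b1 * X j)).
      by rewrite !rmorphD; ring.
    exact: dividesD.
  - exists (a0 * b0 + a1 * b1 * X i ^+ 3), (a0 * b1 + a1 * b0).
    have -> : a * b - (sigma (a0 * b0 + a1 * b1 * X i ^+ 3)
          + sigma (a0 * b1 + a1 * b0) * X j)
      = a * (b - (sigma b0 + sigma b1 * X j))
        + ((a - (sigma a0 + sigma a1 * X j)) * (sigma b0 + sigma b1 * X j)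
        - sigma a1 * sigma b1 * y).
      by rewrite /y !(rmorphD, rmorphM, rmorphXn) /= sigmaX (negbTE ij); ring.
    apply: dividesD; first exact: divides_mull.
    by apply: dividesB; [apply: divides_mulr | apply/divides_mull/divides_refl].
(* [tau] maps an element free of X_j to one that is even in X_j. *)
have nts r : nu (tau (sigma r)) = tau (sigma r).
  have := @eq_rmorphism _ (nu \o tau \o sigma) (tau \o sigma); apply=> [c|k] /=.
    by rewrite sigmac tauc nuc.
  rewrite sigmaX; case: (eqVneq k j) => [_|kj]; first by rewrite !rmorph0.
  rewrite tauX; case: (eqVneq k i) => _; last by rewrite (negbTE kj) nuX (negbTE kj).
  by rewrite rmorphXn nuX eqxx; ring.
(* Every value of X_i is reached by taking a square root as the parameter, so [tau] is injective on
   elements free of X_j. *)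
have ts0 r : tau (sigma r) = 0 -> sigma r = 0.
  move=> h; apply: (psep (p := PR)) => v; rewrite -/(point v).
  pose u k := if k == j then sqrtC (v i) else v k.
  transitivity (point u (tau (sigma r))); last by rewrite h rmorph0.
  have := @eq_rmorphism _ (point v \o sigma) (point u \o tau \o sigma); apply=> [c|k] /=.
    by rewrite sigmac tauc !point_cst.
  rewrite sigmaX; case: (eqVneq k j) => [_|kj]; first by rewrite !rmorph0.
  rewrite tauX; case: (eqVneq k i) => [->|_].
    by rewrite rmorphXn !point_var /u eqxx sqrtCK.
  by rewrite (negbTE kj) !point_var /u (negbTE kj).
apply: (prime_of_kernel tauy) => x tx.
have [r0 [r1 hr]] := split_y x.
have e1 : tau (sigma r0) + tau (sigma r1) * X j ^+ 3 = 0.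
  case: hr => z /(congr1 tau); rewrite rmorphM tauy mulr0 rmorphB tx rmorphD rmorphM.
  by rewrite tauX ji eqxx sub0r => /eqP; rewrite oppr_eq0 => /eqP.
(* The reflection [nu] separates the even part of [e1] from its odd part tau (sigma r1) X_j^3. *)
have e2 : tau (sigma r0) - tau (sigma r1) * X j ^+ 3 = 0.
  have := congr1 nu e1; rewrite rmorphD rmorphM rmorphXn !nts nuX eqxx rmorph0 => <-.
  by ring.
have Xj0 : X j != 0.
  apply/eqP => /(congr1 (point (fun=> 1))); rewrite point_var rmorph0 => /eqP.
  by rewrite oner_eq0.
have two0 : (2%:R : A) != 0.
  apply/eqP => /(congr1 (point (fun=> 1))); rewrite rmorph_nat rmorph0 => /eqP.
  by rewrite pnatr_eq0.
have T0 : tau (sigma r0) = 0.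
  apply: (mulfI two0); rewrite mulr0 -{}[RHS](addr0 0) -{1}e1 -e2; ring.
have T1 : tau (sigma r1) = 0.
  move/eqP: e1; rewrite T0 add0r mulf_eq0 expf_eq0 /= (negbTE Xj0) orbF => /eqP //.
by move: hr; rewrite (ts0 _ T0) (ts0 _ T1) mul0r addr0 subr0.
Qed.

(** * Birational charts of affine space *)

Section Chart.
Variables (ys : 'I_n -> A) (q0 : A).

(** The pullback along the map v |-> (ys_i(v)) of affine spaces. The hypotheses below say that this
    map reaches every point where q0 is nonzero, and that it is inverted there by fractions whose
    denominators are powers of q0. *)
Definition chart_map : {rmorphism A -> A} := peval PR cst ys.

Hypothesis chart_points : forall u, point u q0 != 0 ->
  exists v, forall i, point v (ys i) = u i.
Hypothesis q0_neq0 : q0 != 0.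
Hypothesis chart_vars : forall i, exists k y, chart_map q0 ^+ k * X i = chart_map y.

Lemma point_chart v x : point v (chart_map x) = point (fun i => point v (ys i)) x.
Proof.
have := @eq_rmorphism _ (point v \o chart_map) (point (fun i => point v (ys i))).
apply=> [c|i] /=; first by rewrite peval_cst !point_cst.
by rewrite peval_var point_var.
Qed.

(** A difference killed by the pullback vanishes wherever q0 does not, so its product with q0
    vanishes at every point. *)
Lemma chart_map_inj : injective chart_map.
Proof.
move=> x y e; apply: subr0_eq; apply: (mulfI q0_neq0); rewrite mulr0.
apply: (psep (p := PR)) => u; rewrite -/(point u) rmorphM.
have [->|/chart_points[v hv]] := eqVneq (point u q0) 0; first by rewrite mul0r.
have -> : point u (x - y) = point v (chart_map (x - y)).
  by rewrite point_chart; apply: eq_rmorphism => [c|i];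
    rewrite ?point_cst ?point_var ?hv.
by rewrite rmorphB e subrr rmorph0 mulr0.
Qed.

Lemma chart_loc x : exists k y, chart_map q0 ^+ k * x = chart_map y.
Proof.
move: x; apply: (pind (p := PR)) => [c|i|a b [k [a' ea]] [l [b' eb]]|a b [k [a' ea]] [l [b' eb]]].
- by exists 0%N, (cst c); rewrite mul1r peval_cst.
- exact: chart_vars.
- exists (k + l)%N, (q0 ^+ l * a' + q0 ^+ k * b').
  by rewrite rmorphD !rmorphM !rmorphXn /= -ea -eb exprD; ring.
- exists (k + l)%N, (a' * b').
  by rewrite rmorphM /= -ea -eb exprD; ring.
Qed.

Lemma coprime_point p x v :
  prime_elt p -> point v p = 0 -> point v x != 0 -> coprime_elt p x.
Proof.
move=> pp pv xv; apply: prime_coprime => // -[z ez].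
by move: xv; rewrite ez rmorphM pv mulr0 eqxx.
Qed.

(** Primality is transported from the ring in which the ys are the variables; there the elements of
    interest are variables or a binomial. *)
Lemma prime_chart p : prime_elt p -> p != 0 -> ~ divides p q0 ->
  coprime_elt (chart_map p) (chart_map q0) -> prime_elt (chart_map p).
Proof.
move=> pp p0 npq cop; apply: (prime_elt_localization _ _ pp npq p0 cop).
  exact: chart_map_inj.
exact: chart_loc.
Qed.

End Chart.
End PolynomialPrimes.

(** * Cluster structures on polynomial rings *)

Section ClusterStructure.
Variables (m : nat) (C : numClosedFieldType) (A : idomainType).
Variable PR : polynomial_ring (3 + m) C A.
Variables (ys : 'I_(3 + m) -> A) (b : 'I_(3 + m) -> 'I_3 -> int) (kap : 'I_3 -> int).
Variables (w : 'I_m -> int) (L : seq (seq int)).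

Notation cst := (pcst PR).
Notation X := (pvar PR).
Notation fro := (@rshift 3 m).
Notation mut := (@lshift 3 m).
Notation psi := (chart_map PR ys).

(** Only the mutable initial variables are inverted, so coefficients and F stay nonunits and their
    primality can be transported. *)
Definition q0 : A := \prod_(k < 3) X (mut k).
Definition F0 : A :=
  \prod_j X (fro j) ^+ pexp (w j) - \prod_j X (fro j) ^+ pexp (- w j).

Hypothesis chart_points : forall u : 'I_(3 + m) -> C, (forall k, u (mut k) != 0) ->
  exists v, forall i, point PR v (ys i) = u i.
Hypothesis chart_vars : forall i, exists k y, psi q0 ^+ k * X i = psi y.
Hypothesis mutable_prime : forall k, prime_elt (ys (mut k)).
Hypothesis mutable_point : forall k, exists v, [/\ point PR v (ys (mut k)) = 0,
  forall i, i != mut k -> point PR v (ys i) != 0 & point PR v (psi F0) != 0].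
Hypothesis F0_prime : prime_elt F0.
Hypothesis L_closed : mutation_closed L.
Hypothesis b_in_class : in_class L (fun i => b (mut i)) kap.
Hypothesis b_frozen : forall j, \sum_l b (fro j) l * kap l = w j.
Hypothesis exchangeable : forall k, divides (ys (mut k)) (exchange_sum ys (b^~ k)).

Let point_q0 u : point PR u q0 = \prod_k u (mut k).
Proof. by rewrite rmorph_prod; apply: eq_bigr => k _; rewrite point_var. Qed.

Let q0_points u : point PR u q0 != 0 -> exists v, forall i, point PR v (ys i) = u i.
Proof.
rewrite point_q0 => /prodf_neq0 h; apply: chart_points => k; exact: h.
Qed.

Let fro_mut j k : fro j != mut k.
Proof.
by rewrite -val_eqE /= neq_ltn orbC (leq_trans (ltn_ord k)) // leq_addr.
Qed.

Let mut_fro j k : (mut k == fro j) = false.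
Proof. by rewrite eq_sym (negbTE (fro_mut j k)). Qed.

Let q0_neq0 : q0 != 0.
Proof.
apply/eqP => /(congr1 (point PR (fun=> 1))); rewrite point_q0 rmorph0 big1 // => /eqP.
by rewrite oner_eq0.
Qed.

Let psi_X i : psi (X i) = ys i.
Proof. exact: peval_var. Qed.

Let psi_F0 : psi F0 = \prod_j ys (fro j) ^+ pexp (w j)
  - \prod_j ys (fro j) ^+ pexp (- w j).
Proof.
by rewrite rmorphB !rmorph_prod; congr (_ - _); apply: eq_bigr => j _;
  rewrite rmorphXn psi_X.
Qed.

Lemma coprime_mutable p k v : point PR v (ys (mut k)) = 0 ->
  point PR v p != 0 -> coprime_elt p (ys (mut k)).
Proof.
move=> yv pv.
have y0 : ys (mut k) != 0.
  have [u hu] := @chart_points (fun=> 1) (fun=> oner_neq0 _).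
  apply/eqP => /(congr1 (point PR u)); rewrite hu rmorph0 => /eqP.
  by rewrite oner_eq0.
exact: (coprime_eltC y0 (coprime_point (@mutable_prime k) yv pv)).
Qed.

(** The point u, in the coordinates of the seed, shows that p does not divide [q0]; the points v, in
    the coordinates of A, show that psi p is coprime to every mutable variable. *)
Lemma prime_chart_mutable p u : prime_elt p -> point PR u p = 0 ->
  (forall k, u (mut k) != 0) ->
  (forall k, exists2 v, point PR v (ys (mut k)) = 0 & point PR v (psi p) != 0) ->
  prime_elt (psi p).
Proof.
move=> pp pu0 u0 hv; have p0 : psi p != 0.
  by have [v _] := hv o0; apply: contraNneq => ->; rewrite rmorph0.
apply: (prime_chart q0_points q0_neq0 chart_vars pp).
- by apply: contraNneq p0 => ->; rewrite rmorph0.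
- case=> z /(congr1 (point PR u)); rewrite rmorphM pu0 mulr0 point_q0 => /eqP.
  by apply/negP/prodf_neq0 => k _.
- rewrite rmorph_prod; apply: coprime_elt_prod => k _; rewrite psi_X.
  by have [v h1 h2] := hv k; apply: coprime_mutable h1 h2.
Qed.

Lemma frozen_prime j : prime_elt (ys (fro j)).
Proof.
rewrite -psi_X; apply: (@prime_chart_mutable _ (fun i => (i != fro j)%:R)).
- exact: prime_var.
- by rewrite point_var eqxx.
- by move=> k; rewrite mut_fro oner_eq0.
- move=> k; have [v [h1 h2 _]] := mutable_point k; exists v => //.
  by rewrite psi_X h2.
Qed.

Lemma psi_F0_prime : prime_elt (psi F0).
Proof.
apply: (@prime_chart_mutable _ (fun=> 1)) => //.
- rewrite rmorphB !rmorph_prod !big1 ?subrr // => j _;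
  by rewrite rmorphXn point_var expr1n.
- by move=> k; rewrite oner_eq0.
- by move=> k; have [v [h1 _ h2]] := mutable_point k; exists v.
Qed.

Lemma psi_F0_neq0 : psi F0 != 0.
Proof.
have [v [_ _ h]] := mutable_point o0.
by apply: contraNneq h => ->; rewrite rmorph0.
Qed.

(** All initial variables are set to 1, except that [ev j] sets the j-th coefficient to 0. Such
    points exist because no mutable variable vanishes at them, and F is 1 - 1 when all variables are
    1. *)
Lemma initial_seed_regular : exists (ev : 'I_m -> {rmorphism A -> C})
    (evF : {rmorphism A -> C}),
  regular_seed (fun j => ys (fro j)) w ev evF (in_class L) ys b kap.
Proof.
have /choice[ev hev] : forall j, exists v, forall i,
    point PR v (ys i) = (i != fro j)%:R.
  by move=> j; apply: chart_points => k; rewrite mut_fro oner_eq0.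
have [evF hevF] := @chart_points (fun=> 1) (fun=> oner_neq0 _).
exists (fun j => point PR (ev j)), (point PR evF); split=> //.
- have copm k i : i != mut k -> coprime_elt (ys i) (ys (mut k)).
    move=> ik; have [v [h1 h2 _]] := mutable_point k.
    by apply: coprime_mutable h1 _; apply: h2.
  have y0 i : ys i != 0.
    apply/eqP => /(congr1 (point PR evF)); rewrite hevF rmorph0 => /eqP.
    by rewrite oner_eq0.
  move=> i j ij; case: (split_ordP j) => l el; rewrite el in ij *; first exact: copm.
  case: (split_ordP i) => k ek; rewrite ek in ij *.
    by apply: coprime_eltC; [apply: y0 | apply: copm; rewrite eq_sym].
  apply: (coprime_point (PR := PR) (v := ev k)) (@frozen_prime k) _ _.
    by rewrite hev eqxx.
  by rewrite hev [fro l == _]eq_sym ij oner_eq0.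
- by move=> j; rewrite hev eqxx.
- by rewrite -psi_F0 point_chart rmorphB !rmorph_prod !big1 ?subrr // => j _;
    rewrite rmorphXn point_var hevF expr1n.
- by move=> j i ij; rewrite hev ij ltr01.
- by move=> i; rewrite hevF ltr01.
Qed.

Section Realization.
Variables (K : fieldType) (phi : {rmorphism A -> K}) (S : seed 3 m K).
Hypothesis phi_inj : injective phi.
Hypothesis S_rel : seed_rel phi S ys b.

Lemma cluster_variables_range : cluster_variables S `<=` range phi.
Proof.
have [ev [evF reg]] := initial_seed_regular.
apply: (cluster_variables_regular phi_inj L_closed _ _ _ reg S_rel).
- exact: frozen_prime.
- by rewrite -psi_F0; apply: psi_F0_prime.
- by rewrite -psi_F0; apply: psi_F0_neq0.
Qed.

Lemma generated_subring_closed (G : set K) :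
  [/\ generated_subring G 1,
    forall x y, generated_subring G x -> generated_subring G y ->
      generated_subring G (x - y)
  & forall x y, generated_subring G x -> generated_subring G y ->
      generated_subring G (x * y)].
Proof.
split=> [|x y hx hy|x y hx hy] B [cB GB]; have [h1 hB hM] := cB.
- by rewrite -in_setE.
- by have := hB x y; rewrite !in_setE; apply; [apply: hx | apply: hy].
- by have := hM x y; rewrite !in_setE; apply; [apply: hx | apply: hy].
Qed.

Lemma sub_generated_subring (G : set K) : G `<=` generated_subring G.
Proof. by move=> x Gx B [_]; apply. Qed.

Lemma generated_subring_min (G B : set K) : B 1 ->
  (forall x y, B x -> B y -> B (x - y)) -> (forall x y, B x -> B y -> B (x * y)) ->
  G `<=` B -> generated_subring G `<=` B.
Proof.
move=> h1 hB hM GB x; apply; split=> //; split=> [|u v|u v]; rewrite !in_setE //.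
  exact: hB.
exact: hM.
Qed.

Lemma generated_subring_range (G : set K) :
  G `<=` range phi -> generated_subring G `<=` range phi.
Proof.
apply: generated_subring_min.
- by exists 1 => //; rewrite rmorph1.
- by move=> _ _ [u _ <-] [v _ <-]; exists (u - v) => //; rewrite rmorphB.
- by move=> _ _ [u _ <-] [v _ <-]; exists (u * v) => //; rewrite rmorphM.
Qed.

Lemma extend_scalars_seq (c : C -> K) (B : set K) (s : seq (C * K)) :
  (forall u, u \in s -> B u.2) -> extend_scalars c B (\sum_(u <- s) c u.1 * u.2).
Proof.
move=> hs; exists (size s), (fun k => (tnth (in_tuple s) k).1),
  (fun k => (tnth (in_tuple s) k).2).
by split=> [k|]; [apply/hs/mem_tnth | rewrite big_tnth].
Qed.

Lemma extend_scalarsE (c : C -> K) (B : set K) z : extend_scalars c B z ->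
  exists2 s : seq (C * K), (forall u, u \in s -> B u.2) & z = \sum_(u <- s) c u.1 * u.2.
Proof.
case=> N [s [a [ha ->]]]; exists [seq (s k, a k) | k <- enum 'I_N].
  by move=> u /mapP[k _ ->]; apply: ha.
by rewrite big_map big_enum.
Qed.

Hypothesis vars_generate : forall i, cluster_variables S (phi (X i)) \/
  polynomial_ground_ring S (phi (X i)).

Lemma cluster_algebra_range :
  extend_scalars (fun z => phi (cst z)) (cluster_algebra (polynomial_ground_ring S) S)
    = range phi.
Proof.
set c := fun z => _; set CA := cluster_algebra _ _.
have [CA1 CAB CAM] := generated_subring_closed (polynomial_ground_ring S `|` cluster_variables S).
apply/seteqP; split=> [_ [N [s [a [ha ->]]]]|_ [x _ <-]].
  have CAr : CA `<=` range phi.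
    apply: generated_subring_range => z [|]; last exact: cluster_variables_range.
    apply: generated_subring_range => _ [l _ <-].
    by exists (ys (fro l)) => //; rewrite (proj1 S_rel).
  have /choice[r hr] : forall k, exists r, phi r = a k.
    by move=> k; have [r _ <-] := CAr _ (ha k); exists r.
  exists (\sum_k cst (s k) * r k) => //.
  by rewrite rmorph_sum; apply: eq_bigr => k _; rewrite rmorphM hr.
move: x; apply: (pind (p := PR)) => [z|i|x y ex ey|x y ex ey].
- have -> : phi (cst z) = \sum_(u <- [:: (z, 1)]) c u.1 * u.2.
    by rewrite big_seq1 mulr1.
  by apply: extend_scalars_seq => u; rewrite inE => /eqP ->.
- have CAi : CA (phi (X i)).
    by apply: sub_generated_subring; have [] := vars_generate i; [right|left].
  have -> : phi (X i) = \sum_(u <- [:: (1, phi (X i))]) c u.1 * u.2.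
    by rewrite big_seq1 /= /c !rmorph1 mul1r.
  by apply: extend_scalars_seq => u; rewrite inE => /eqP ->.
- have [s hs es] := extend_scalarsE ex; have [t ht et] := extend_scalarsE ey.
  rewrite rmorphD es et -big_cat; apply: extend_scalars_seq => u.
  by rewrite mem_cat => /orP[/hs|/ht].
- have [s hs es] := extend_scalarsE ex; have [t ht et] := extend_scalarsE ey.
  rewrite rmorphM es et big_distrlr /=.
  have -> : \sum_(i <- s) \sum_(j <- t) c i.1 * i.2 * (c j.1 * j.2)
      = \sum_(u <- [seq (i.1 * j.1, i.2 * j.2) | i <- s, j <- t]) c u.1 * u.2.
    rewrite big_allpairs_dep; apply: eq_bigr => i _; apply: eq_bigr => j _ /=.
    by rewrite /c !rmorphM mulrACA.
  apply: extend_scalars_seq => u /allpairsP[[i j] /= [hi hj ->]].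
  by apply: CAM; [apply: hs | apply: ht].
Qed.

End Realization.
End ClusterStructure.

(** * The initial seed generates the function field freely *)

Section FreeGenerators.
Variables (n : nat) (C : numClosedFieldType) (A : idomainType).
Variable PR : polynomial_ring n C A.
Variables (ys : 'I_n -> A) (q : A).
Hypothesis chart_points : forall u, point PR u q != 0 ->
  exists v, forall i, point PR v (ys i) = u i.
Hypothesis q_neq0 : q != 0.
Hypothesis chart_vars : forall i, exists k y,
  chart_map PR ys q ^+ k * pvar PR i = chart_map PR ys y.

(** Algebraic independence is the injectivity of the chart map; every fraction is reached after
    clearing powers of q. *)
Lemma free_generators_chart (K : fieldType) (phi : {rmorphism A -> K}) (x : 'I_n -> K) :
  injective phi -> (forall z, exists a b, phi b != 0 /\ z = phi a / phi b) ->
  (forall i, x i = phi (ys i)) -> free_generators (fun z => phi (pcst PR z)) x.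
Proof.
move=> phi_inj frac xE.
pose j : {rmorphism mpoly n C -> A} := mpoly_eval (pcst PR) (pvar PR).
have jC c : j (mpolyC n c) = pcst PR c by apply: mmapC.
have jX i : j (mpolyX C (mnm1 i)) = pvar PR i by rewrite /j /= mmapX mmap1U.
pose g : {rmorphism C -> K} := phi \o pcst PR.
have mE p : mmap (fun z => phi (pcst PR z)) x p = phi (chart_map PR ys (j p)).
  move: p; change (forall p, mpoly_eval g x p = phi (chart_map PR ys (j p))).
  apply: mpoly_ind => [c|i|a b ea eb|a b ea eb].
  - by rewrite jC peval_cst /mpoly_eval /= mmapC.
  - by rewrite jX peval_var /mpoly_eval /= mmapX mmap1U.
  - by rewrite !rmorphD ea eb.
  - by rewrite !rmorphM ea eb.
have j_point v p : point PR v (j p) = meval v p.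
  move: p; change (forall p, point PR v (j p) = mpoly_eval idfun v p).
  apply: mpoly_ind => [c|i|a b ea eb|a b ea eb].
  - by rewrite jC point_cst /mpoly_eval /= mmapC.
  - by rewrite jX point_var /mpoly_eval /= mmapX mmap1U.
  - by rewrite !rmorphD ea eb.
  - by rewrite !rmorphM ea eb.
have j_surj y : exists p, j p = y.
  move: y; apply: (pind (p := PR)) => [c|i|a b [a' <-] [b' <-]|a b [a' <-] [b' <-]].
  - by exists (mpolyC n c).
  - by exists (mpolyX C (mnm1 i)).
  - by exists (a' + b'); rewrite rmorphD.
  - by exists (a' * b'); rewrite rmorphM.
have psi_inj := chart_map_inj chart_points q_neq0.
split=> [p|z].
  rewrite mE -(rmorph0 phi) => /phi_inj; rewrite -(rmorph0 (chart_map PR ys)).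
  move=> /psi_inj jp0; apply: mpoly_eval_eq0 => v.
  by rewrite -j_point jp0 rmorph0.
have [a [b [b0 ->]]] := frac z.
have [k [a' ea]] := chart_loc chart_vars a; have [l [b' eb]] := chart_loc chart_vars b.
pose Q := chart_map PR ys q.
have Q0 : Q != 0 by rewrite /Q -(rmorph0 (chart_map PR ys)) (inj_eq psi_inj).
have pQ0 i : phi (Q ^+ i) != 0.
  by rewrite rmorphXn expf_neq0 // -(rmorph0 phi) (inj_eq phi_inj).
(* Crossing the exponents k and l gives numerator and denominator the same factor Q^(k + l). *)
have [p hp] := j_surj (q ^+ l * a'); have [r hr] := j_surj (q ^+ k * b').
have psiE i y y' : chart_map PR ys y = y' ->
    phi (chart_map PR ys (q ^+ i * y)) = phi (Q ^+ i) * phi y'.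
  by move=> <-; rewrite [chart_map PR ys _]rmorphM [chart_map PR ys (q ^+ i)]rmorphXn
    [LHS]rmorphM.
exists p, r; rewrite !mE hp hr (psiE l a' _ (esym ea)) (psiE k b' _ (esym eb)) -/Q.
rewrite [phi (_ * a)]rmorphM [phi (_ * b)]rmorphM; split; first by rewrite !mulf_neq0.
by rewrite [in RHS]mulrCA -mulf_div divff ?mul1r // -mulf_div divff ?mul1r.
Qed.

End FreeGenerators.

Lemma ord2P (P : 'I_2 -> Prop) : P ord0 -> P ord_max -> forall k, P k.
Proof.
move=> p0 p1 [[|[|//]] hk].
  by rewrite (_ : Ordinal hk = ord0) //; apply/val_inj.
by rewrite (_ : Ordinal hk = ord_max) //; apply/val_inj.
Qed.

Lemma ord3P (P : 'I_3 -> Prop) : P o0 -> P o1 -> P o2 -> forall k, P k.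
Proof.
move=> p0 p1 p2 [[|[|[|//]]] hk]; first by rewrite (_ : Ordinal hk = o0) //; apply/val_inj.
  by rewrite (_ : Ordinal hk = o1) //; apply/val_inj.
by rewrite (_ : Ordinal hk = o2) //; apply/val_inj.
Qed.

Definition j0 : 'I_(3 + 2) := @Ordinal (3 + 2) 0 isT.
Definition j1 : 'I_(3 + 2) := @Ordinal (3 + 2) 1 isT.
Definition j2 : 'I_(3 + 2) := @Ordinal (3 + 2) 2 isT.
Definition j3 : 'I_(3 + 2) := @Ordinal (3 + 2) 3 isT.
Definition j4 : 'I_(3 + 2) := @Ordinal (3 + 2) 4 isT.

Lemma ord5P (P : 'I_(3 + 2) -> Prop) :
  P j0 -> P j1 -> P j2 -> P j3 -> P j4 -> forall k, P k.
Proof.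
move=> p0 p1 p2 p3 p4 [[|[|[|[|[|//]]]]] hk].
- by rewrite (_ : Ordinal hk = j0) //; apply/val_inj.
- by rewrite (_ : Ordinal hk = j1) //; apply/val_inj.
- by rewrite (_ : Ordinal hk = j2) //; apply/val_inj.
- by rewrite (_ : Ordinal hk = j3) //; apply/val_inj.
- by rewrite (_ : Ordinal hk = j4) //; apply/val_inj.
Qed.

(** * Explicit charts: index set, test points, and the seed for i = 1 *)

Section ConcreteCharts.
Variables (C : numClosedFieldType) (A : idomainType).
Variable PR : polynomial_ring (3 + 2) C A.
Notation X := (pvar PR).

Lemma q0E : q0 PR = X j0 * X j1 * X j2.
Proof.
rewrite /q0 !big_ord_recl big_ord0 mulr1 mulrA.
by congr (X _ * X _ * X _); apply/val_inj.
Qed.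

Lemma F0E (w : 'I_2 -> int) : F0 PR w =
  X j3 ^+ pexp (w ord0) * X j4 ^+ pexp (w ord_max)
    - X j3 ^+ pexp (- w ord0) * X j4 ^+ pexp (- w ord_max).
Proof.
rewrite /F0 !big_ord_recl !big_ord0 !mulr1.
have -> : lift ord0 ord0 = ord_max :> 'I_2 by apply/val_inj.
have -> : rshift 3 ord0 = j3 by apply/val_inj.
by have -> : rshift 3 ord_max = j4 by apply/val_inj.
Qed.

Definition pt_seq (s : seq int) (i : 'I_(3 + 2)) : C := (nth 0 s i)%:~R.

(* vals lists the values of the functions ys and psi F0 *)
Lemma mutable_point_seq (ys : 'I_(3 + 2) -> A) (F : A) (s vals : seq int) k :
  (forall i, point PR (pt_seq s) (ys i) = (nth 0 vals i)%:~R) ->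
  point PR (pt_seq s) F = (nth 0 vals 5)%:~R ->
  [seq i <- iota 0 6 | nth 0 vals i == 0] = [:: (k : 'I_3) : nat] ->
  exists v, [/\ point PR v (ys (lshift 2 k)) = 0,
    forall i, i != lshift 2 k -> point PR v (ys i) != 0 & point PR v F != 0].
Proof.
move=> hy hF hz; exists (pt_seq s).
have memz i : (i < 6)%N -> (nth 0 vals i == 0) = (i == k).
  by move=> lti; have := mem_filter (fun i => nth 0 vals i == 0) i (iota 0 6);
    rewrite hz inE mem_iota leq0n add0n lti !andbT => <-.
split=> [|i ik|].
- by rewrite hy; apply/eqP; rewrite intr_eq0 memz //= (leq_trans (ltn_ord k)).
- by rewrite hy intr_eq0 memz ?(leq_trans (ltn_ord i)).
- by rewrite hF intr_eq0 memz // neq_ltn orbC (leq_trans (ltn_ord k)).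
Qed.

Lemma exchangeable_seq (ys : seq A) (rows : seq (seq int)) (k : 'I_3) p q z :
  size ys = 5 ->
  (mkseq (fun i => pexp (nth 0 (nth [::] rows i) k)) 5,
    mkseq (fun i => pexp (- nth 0 (nth [::] rows i) k)) 5) = (p, q) ->
  monomial_seq ys p + monomial_seq ys q = z * nth 0 ys k ->
  divides (nth 0 ys (lshift 2 k))
    (exchange_sum (fun i : 'I_(3 + 2) => nth 0 ys i)
      (fun i : 'I_(3 + 2) => nth 0 (nth [::] rows i) k)).
Proof.
move=> sy [ep eq] ez; exists z; rewrite -ez /exchange_sum.
rewrite (monomial_seqE (fun i => pexp (nth 0 (nth [::] rows i) k)) sy).
by rewrite (monomial_seqE (fun i => pexp (- nth 0 (nth [::] rows i) k)) sy) ep eq.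
Qed.

Section Chart1.
Notation a := (X j0).
Notation b := (X j1).
Notation c := (X j2).
Notation d := (X j3).
Notation e := (X j4).
Notation y_ := (fun i : 'I_(3 + 2) => nth 0 (ys1 a b c d e) i).
Notation psi := (chart_map PR y_).

Definition w1 (j : 'I_2) : int := nth 0 [:: 3; -2] j.
Definition kap1 (l : 'I_3) : int := nth 0 [:: 3; 1; 3] l.
Definition b1 (i : 'I_(3 + 2)) (j : 'I_3) : int := nth 0 (nth [::] (take 5 rows1) i) j.

Lemma chart1_points (u : 'I_(3 + 2) -> C) : (forall k : 'I_3, u (lshift 2 k) != 0) ->
  exists v, forall i, point PR v (y_ i) = u i.
Proof.
move=> hu; have u0 := hu o0; have u1 := hu o1; have u2 := hu o2.
pose va := u j2; pose vd := u j1; pose vb := (u j0 + u j1) / u j2.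
(* This value of c comes from the identity c y_1 = b y_{-1} + y_{-2}, in which e cancels. *)
pose vc := (u j4 + vb * u j3) / u j0.
exists (fun i => nth 0 [:: va; vb; vc; vd; (va * vc + vb ^+ 2 - u j3) / u j1] i).
have e0 : lshift 2 o0 = j0 by apply/val_inj.
have e1 : lshift 2 o1 = j1 by apply/val_inj.
have e2 : lshift 2 o2 = j2 by apply/val_inj.
rewrite {}e0 {}e1 {}e2 in u0 u1 u2.
apply: ord5P => /=; rewrite ?(rmorphD, rmorphN, rmorphM, rmorphXn) /= ?point_var /=
  /vc /va /vb /vd; field; rewrite ?u0 ?u1 ?u2 //.
Qed.

Let psi_q0 : psi (q0 PR) = (a * b - d) * d * a.
Proof. by rewrite q0E !rmorphM !peval_var. Qed.

(** These are the formulas of [chart1_points] with denominators cleared; e has the square of y_3 in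
    its denominator, whence the exponent 2. *)
Lemma chart1_vars i : exists k y, psi (q0 PR) ^+ k * X i = psi y.
Proof.
pose Y0 := X j0; pose Y1 := X j1; pose Y2 := X j2; pose Y3 := X j3; pose Y4 := X j4.
rewrite psi_q0; elim/ord5P: i.
- by exists 0%N, Y2; rewrite mul1r peval_var.
- exists 1%N, (Y0 * Y1 * (Y0 + Y1)).
  by rewrite !(rmorphD, rmorphM) /= !peval_var /=; ring.
- exists 1%N, (Y1 * (Y2 * Y4 + (Y0 + Y1) * Y3)).
  by rewrite !(rmorphD, rmorphM) /= !peval_var /=; ring.
- by exists 0%N, Y1; rewrite mul1r peval_var.
- exists 2%N, (Y0 * Y1 * (Y2 ^+ 2 * Y1 * Y3 + Y2 ^+ 3 * Y4 + Y0 * (Y0 + Y1) ^+ 2)).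
  by rewrite !(rmorphD, rmorphM, rmorphXn) /= !peval_var /=; ring.
Qed.

Lemma chart1_mutable_prime (k : 'I_3) : prime_elt (y_ (lshift 2 k)).
Proof.
elim/ord3P: k => /=; [|exact: prime_var..].
(* a b - d is linear in d, so d is eliminated. *)
apply: (@prime_subst _ _ _ PR (fun i => if i == j3 then a * b else X i)) => [i|].
  have [->|_] := eqVneq i j3; first exact: divides_refl.
  by rewrite subrr; apply: divides0.
by rewrite rmorphB rmorphM !peval_var /= subrr.
Qed.

Let F0E1 : F0 PR w1 = X j3 ^+ 3 - X j4 ^+ 2.
Proof. by rewrite F0E /= expr0 mulr1 mul1r. Qed.

Lemma chart1_mutable_point (k : 'I_3) : exists v,
  [/\ point PR v (y_ (lshift 2 k)) = 0,
    forall i, i != lshift 2 k -> point PR v (y_ i) != 0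
    & point PR v (psi (F0 PR w1)) != 0].
Proof.
elim/ord3P: k.
- apply: (@mutable_point_seq _ _ [:: 1; 1; 1; 1; 0] [:: 0; 1; 1; 2; -2; 4]) => //.
    by apply: ord5P; rewrite /= ?(rmorphD, rmorphN, rmorphM, rmorphXn) /=
        ?point_var /pt_seq /=; ring.
  by rewrite F0E1 ?(rmorphD, rmorphN, rmorphXn) /= !peval_var /=
    ?(rmorphD, rmorphN, rmorphM, rmorphXn) /= ?point_var /pt_seq /=; ring.
- apply: (@mutable_point_seq _ _ [:: 1; 1; 1; 0; 0] [:: 1; 0; 1; 2; -1; 7]) => //.
    by apply: ord5P; rewrite /= ?(rmorphD, rmorphN, rmorphM, rmorphXn) /=
        ?point_var /pt_seq /=; ring.
  by rewrite F0E1 ?(rmorphD, rmorphN, rmorphXn) /= !peval_var /=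
    ?(rmorphD, rmorphN, rmorphM, rmorphXn) /= ?point_var /pt_seq /=; ring.
- apply: (@mutable_point_seq _ _ [:: 0; 1; 1; 1; 0] [:: -1; 1; 0; 1; -2; -3]) => //.
    by apply: ord5P; rewrite /= ?(rmorphD, rmorphN, rmorphM, rmorphXn) /=
        ?point_var /pt_seq /=; ring.
  by rewrite F0E1 ?(rmorphD, rmorphN, rmorphXn) /= !peval_var /=
    ?(rmorphD, rmorphN, rmorphM, rmorphXn) /= ?point_var /pt_seq /=; ring.
Qed.

Lemma chart1_exchangeable (k : 'I_3) :
  divides (y_ (lshift 2 k)) (exchange_sum y_ (b1^~ k)).
Proof.
elim/ord3P: k.
- apply: (exchangeable_seq (z := e * d - b ^+ 2));
    [by []|by vm_compute|].
  by rewrite /monomial_seq /=; ring.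
- apply: (exchangeable_seq (z := a ^+ 3 * b * e - a ^+ 3 * c - 3 * a ^+ 2 * b ^+ 2
    + 3 * a * b * d - d ^+ 2));
    [by []|by vm_compute|].
  by rewrite /monomial_seq /=; ring.
- apply: (exchangeable_seq (z := b));
    [by []|by vm_compute|].
  by rewrite /monomial_seq /=; ring.
Qed.

Lemma chart1_class : in_class class1 (fun i => b1 (lshift 2 i)) kap1.
Proof.
exists [:: 0; -3; 1; 1; 0; -1; -1; 3; 0; 3; 1; 3]; split=> //.
by elim/ord3P; elim/ord3P.
Qed.

Lemma chart1_frozen (j : 'I_2) : \sum_l b1 (rshift 3 j) l * kap1 l = w1 j.
Proof. by rewrite !big_ord_recl big_ord0; elim/ord2P: j. Qed.

Section Realization1.
Variables (K : fieldType) (phi : {rmorphism A -> K}) (S : seed 3 2 K).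
Hypothesis phi_inj : injective phi.
Hypothesis phi_frac : forall z, exists x y, phi y != 0 /\ z = phi x / phi y.
Hypothesis S_cluster : forall i, extended_cluster S i = phi (y_ i).
Hypothesis S_matrix : forall i j, exchange_matrix S i j = b1 i j.

Lemma cluster_algebra_chart1 :
  free_generators (fun z => phi (pcst PR z)) (extended_cluster S) /\
  extend_scalars (fun z => phi (pcst PR z))
    (cluster_algebra (polynomial_ground_ring S) S) = range phi.
Proof.
have nz x (s : seq int) z : point PR (pt_seq s) x = z%:~R -> z != 0 -> x != 0.
  by move=> h; apply: contraNneq => x0; rewrite -(intr_eq0 C) -h x0 rmorph0.
have nz1 x : point PR (pt_seq [:: 1; 2; 1; 1; 1]) x = 1%:~R -> x != 0 by move/nz; apply.
split.
  apply: (@free_generators_chart _ _ _ PR y_ (q0 PR)) => //.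
  - move=> u; rewrite rmorph_prod => /prodf_neq0 h; apply: chart1_points => k.
    by have := h k isT; rewrite point_var.
  - apply: (nz _ [:: 1; 2; 1; 1; 1] 2) => //.
    by rewrite q0E !rmorphM /= !point_var /pt_seq /=; ring.
  - exact: chart1_vars.
apply: (@cluster_algebra_range _ _ _ PR y_ b1 kap1 w1 class1) => //.
- exact: chart1_points.
- exact: chart1_vars.
- exact: chart1_mutable_prime.
- exact: chart1_mutable_point.
- by rewrite F0E1; apply: prime_cusp.
- exact: chart1_class.
- exact: chart1_frozen.
- exact: chart1_exchangeable.
- move=> i; left.
  have := @path1 A K phi phi_inj S a b c d e.
  apply; try by [].
  + by apply: nz1; rewrite point_var.
  + by apply: (nz _ [:: 1; 2; 1; 1; 1] 2) => //; rewrite point_var.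
  + by apply: nz1; rewrite point_var.
  + by apply: nz1; rewrite rmorphB rmorphM /= !point_var /pt_seq /=; ring.
  + by elim/ord5P: i; rewrite !inE eqxx ?orbT.
Qed.

End Realization1.
End Chart1.
End ConcreteCharts.

(** * Explicit charts: the seed for i = 2 *)

Section Chart2.
Variables (C : numClosedFieldType) (A : idomainType).
Variable PR : polynomial_ring (3 + 2) C A.
Notation X := (pvar PR).
Notation p := (X j0).
Notation q := (X j1).
Notation r := (X j2).
Notation s := (X j3).
Notation t := (X j4).
Notation y_ := (fun i : 'I_(3 + 2) => nth 0 (ys2 p q r s t) i).
Notation psi := (chart_map PR y_).

Definition w2 (j : 'I_2) : int := nth 0 [:: 1; -2] j.
Definition kap2 (l : 'I_3) : int := nth 0 [:: 1; 1; 1] l.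
Definition b2 (i : 'I_(3 + 2)) (j : 'I_3) : int := nth 0 (nth [::] (take 5 rows2) i) j.

Lemma chart2_points (u : 'I_(3 + 2) -> C) : (forall k : 'I_3, u (lshift 2 k) != 0) ->
  exists v, forall i, point PR v (y_ i) = u i.
Proof.
move=> hu; have u0 := hu o0; have u1 := hu o1; have u2 := hu o2.
pose vr := u j1; pose vs := u j2; pose vt := u j4.
pose vq := (u j0 + vr ^+ 3 + vs * vt) / (vr * vs).
(* The coefficient y_{-1} is linear in p with leading coefficient y_1, which determines p. *)
exists (fun i => nth 0 [:: (u j3 + vq ^+ 3 * vs - vq ^+ 2 * vr ^+ 2 - vq * vr * vt
  - vt ^+ 2) / u j0; vq; vr; vs; vt] i).
have e0 : lshift 2 o0 = j0 by apply/val_inj.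
have e1 : lshift 2 o1 = j1 by apply/val_inj.
have e2 : lshift 2 o2 = j2 by apply/val_inj.
rewrite {}e0 {}e1 {}e2 in u0 u1 u2.
apply: ord5P => /=; rewrite ?(rmorphD, rmorphN, rmorphM, rmorphXn) /= ?point_var /=
  /vq /vr /vs /vt; field; rewrite ?u0 ?u1 ?u2 //.
Qed.

Let psi_q0 : psi (q0 PR) = (q * r * s - r ^+ 3 - s * t) * r * s.
Proof. by rewrite q0E !rmorphM !peval_var. Qed.

(** The expression for p contains q^3, hence the cube of y_2 in its denominator; this gives the
    exponent 3. *)
Lemma chart2_vars i : exists k y, psi (q0 PR) ^+ k * X i = psi y.
Proof.
pose Y0 := X j0; pose r' := X j1; pose s' := X j2; pose Y3 := X j3; pose t' := X j4.
pose W := Y0 + r' ^+ 3 + s' * t'.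
rewrite psi_q0; elim/ord5P: i.
- exists 3%N, (Y0 ^+ 2 * (Y3 * r' ^+ 3 * s' ^+ 3 + W ^+ 3 * s' - W ^+ 2 * r' ^+ 3 * s'
    - W * r' ^+ 3 * s' ^+ 2 * t' - t' ^+ 2 * r' ^+ 3 * s' ^+ 3)).
  by rewrite !(rmorphD, rmorphN, rmorphM, rmorphXn) /= !peval_var /=; ring.
- exists 1%N, (Y0 * W).
  by rewrite !(rmorphD, rmorphN, rmorphM, rmorphXn) /= !peval_var /=; ring.
- by exists 0%N, r'; rewrite mul1r peval_var.
- by exists 0%N, s'; rewrite mul1r peval_var.
- by exists 0%N, t'; rewrite mul1r peval_var.
Qed.

(* The minor q r s - r^3 - s t is a variable after t is eliminated by inverting s. *)
Let y0_prime : prime_elt (q * r * s - r ^+ 3 - s * t).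
Proof.
pose y' (i : 'I_(3 + 2)) := nth 0 [:: p; q; r; s; q * r * s - r ^+ 3 - s * t] i.
have -> : q * r * s - r ^+ 3 - s * t = chart_map PR y' t by rewrite peval_var.
have s0 : s != 0.
  apply/eqP => /(congr1 (point PR (fun=> 1))); rewrite point_var rmorph0 => /eqP.
  by rewrite oner_eq0.
have t0 : t != 0.
  apply/eqP => /(congr1 (point PR (fun=> 1))); rewrite point_var rmorph0 => /eqP.
  by rewrite oner_eq0.
apply: (@prime_chart _ _ _ PR y' s) => //.
- move=> u; rewrite point_var => us.
  exists (fun i => nth 0 [:: u j0; u j1; u j2; u j3;
    (u j1 * u j2 * u j3 - u j2 ^+ 3 - u j4) / u j3] i).
  by apply: ord5P; rewrite /y' /= ?(rmorphD, rmorphN, rmorphM, rmorphXn) /= ?point_var /=;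
    field.
- elim/ord5P; first 4 last.
  + exists 1%N, (q * r * s - r ^+ 3 - t).
    by rewrite !(rmorphD, rmorphN, rmorphM, rmorphXn) /= !peval_var /y' /=; ring.
  + by exists 0%N, p; rewrite mul1r peval_var.
  + by exists 0%N, q; rewrite mul1r peval_var.
  + by exists 0%N, r; rewrite mul1r peval_var.
  + by exists 0%N, s; rewrite mul1r peval_var.
- exact: prime_var.
- case=> z /(congr1 (point PR (pt_seq C [:: 0; 0; 0; 1; 0]))).
  by rewrite rmorphM !point_var /pt_seq /= mulr0 => /eqP; rewrite oner_eq0.
- rewrite !peval_var; apply: coprime_eltC => //.
  apply: (@coprime_point _ _ _ PR _ _ (pt_seq C [:: 0; 0; 1; 0; 0])).
  + exact: prime_var.
  + by rewrite point_var.
  + rewrite /y' /= !(rmorphD, rmorphN, rmorphM, rmorphXn) /= !point_var /pt_seq /=.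
    have -> : (0%:~R * 1%:~R * 0%:~R - 1%:~R ^+ 3 - 0%:~R * 0%:~R : C) = -1 by ring.
    by rewrite oppr_eq0 oner_eq0.
Qed.

Lemma chart2_mutable_prime (k : 'I_3) : prime_elt (y_ (lshift 2 k)).
Proof. by elim/ord3P: k; [exact: y0_prime | exact: prime_var..]. Qed.

Let F0E2 : F0 PR w2 = X j3 - X j4 ^+ 2.
Proof. by rewrite F0E /= expr0 mulr1 mul1r. Qed.

Let F0_prime : prime_elt (F0 PR w2).
Proof.
rewrite F0E2.
apply: (@prime_subst _ _ _ PR (fun i => if i == j3 then X j4 ^+ 2 else X i)) => [i|].
  have [->|_] := eqVneq i j3; last by rewrite subrr; apply: divides0.
  by rewrite -[X in divides _ X]opprB; apply/dividesN/divides_refl.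
by rewrite rmorphB rmorphXn !peval_var /= subrr.
Qed.

Lemma chart2_mutable_point (k : 'I_3) : exists v,
  [/\ point PR v (y_ (lshift 2 k)) = 0,
    forall i, i != lshift 2 k -> point PR v (y_ i) != 0
    & point PR v (psi (F0 PR w2)) != 0].
Proof.
elim/ord3P: k.
- apply: (@mutable_point_seq _ _ PR _ _ [:: 0; 2; 1; 1; 1] [:: 0; 1; 1; -1; 1; -2]) => //.
    by apply: ord5P; rewrite /= ?(rmorphD, rmorphN, rmorphM, rmorphXn) /=
        ?point_var /pt_seq /=; ring.
  by rewrite F0E2 ?(rmorphD, rmorphN, rmorphXn) /= !peval_var /=
    ?(rmorphD, rmorphN, rmorphM, rmorphXn) /= ?point_var /pt_seq /=; ring.
- apply: (@mutable_point_seq _ _ PR _ _ [:: 2; 0; 0; 1; 1] [:: -1; 0; 1; -1; 1; -2]) => //.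
    by apply: ord5P; rewrite /= ?(rmorphD, rmorphN, rmorphM, rmorphXn) /=
        ?point_var /pt_seq /=; ring.
  by rewrite F0E2 ?(rmorphD, rmorphN, rmorphXn) /= !peval_var /=
    ?(rmorphD, rmorphN, rmorphM, rmorphXn) /= ?point_var /pt_seq /=; ring.
- apply: (@mutable_point_seq _ _ PR _ _ [:: 2; 0; 1; 0; 1] [:: -1; 1; 0; -1; 1; -2]) => //.
    by apply: ord5P; rewrite /= ?(rmorphD, rmorphN, rmorphM, rmorphXn) /=
        ?point_var /pt_seq /=; ring.
  by rewrite F0E2 ?(rmorphD, rmorphN, rmorphXn) /= !peval_var /=
    ?(rmorphD, rmorphN, rmorphM, rmorphXn) /= ?point_var /pt_seq /=; ring.
Qed.

Lemma chart2_exchangeable (k : 'I_3) :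
  divides (y_ (lshift 2 k)) (exchange_sum y_ (b2^~ k)).
Proof.
elim/ord3P: k.
- apply: (exchangeable_seq (z := p * r ^+ 3 - q ^+ 2 * r ^+ 2 - q * r * t - t ^+ 2));
    [by []|by vm_compute|].
  by rewrite /monomial_seq /=; ring.
- apply: (exchangeable_seq (z := q * s - r ^+ 2)); [by []|by vm_compute|].
  by rewrite /monomial_seq /=; ring.
- apply: (exchangeable_seq (z := q * r - t)); [by []|by vm_compute|].
  by rewrite /monomial_seq /=; ring.
Qed.

Lemma chart2_class : in_class class2 (fun i => b2 (lshift 2 i)) kap2.
Proof.
exists [:: 0; -1; 1; 3; 0; -3; -1; 1; 0; 1; 1; 1]; split=> //.
by elim/ord3P; elim/ord3P.
Qed.

Lemma chart2_frozen (j : 'I_2) : \sum_l b2 (rshift 3 j) l * kap2 l = w2 j.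
Proof. by rewrite !big_ord_recl big_ord0; elim/ord2P: j. Qed.

Section Realization2.
Variables (K : fieldType) (phi : {rmorphism A -> K}) (S : seed 3 2 K).
Hypothesis phi_inj : injective phi.
Hypothesis phi_frac : forall z, exists x y, phi y != 0 /\ z = phi x / phi y.
Hypothesis S_cluster : forall i, extended_cluster S i = phi (y_ i).
Hypothesis S_matrix : forall i j, exchange_matrix S i j = b2 i j.

Lemma cluster_algebra_chart2 :
  free_generators (fun z => phi (pcst PR z)) (extended_cluster S) /\
  extend_scalars (fun z => phi (pcst PR z))
    (cluster_algebra (polynomial_ground_ring S) S) = range phi.
Proof.
have nz x z : point PR (pt_seq C [:: 1; 3; 1; 1; 1]) x = z%:~R -> z != 0 -> x != 0.
  by move=> h; apply: contraNneq => x0; rewrite -(intr_eq0 C) -h x0 rmorph0.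
have nz1 x : point PR (pt_seq C [:: 1; 3; 1; 1; 1]) x = 1%:~R -> x != 0 by move/nz; apply.
split.
  apply: (@free_generators_chart _ _ _ PR y_ (q0 PR)) => //.
  - move=> u; rewrite rmorph_prod => /prodf_neq0 h; apply: chart2_points => k.
    by have := h k isT; rewrite point_var.
  - apply: (nz _ 3) => //.
    by rewrite q0E !rmorphM /= !point_var /pt_seq /=; ring.
  - exact: chart2_vars.
apply: (@cluster_algebra_range _ _ _ PR y_ b2 kap2 w2 class2) => //.
- exact: chart2_points.
- exact: chart2_vars.
- exact: chart2_mutable_prime.
- exact: chart2_mutable_point.
- exact: chart2_class.
- exact: chart2_frozen.
- exact: chart2_exchangeable.
- have pth := @path2 A K phi phi_inj S p q r s t.
  move=> i; have [->|i4] := eqVneq i j4.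
    by right; apply: sub_generated_subring; exists ord_max.
  left; apply: pth; try by [].
  + by apply: nz1; rewrite point_var.
  + by apply: nz1; rewrite point_var.
  + apply: (nz _ 2) => //.
    by rewrite rmorphB rmorphM /= !point_var /pt_seq /=; ring.
  + by apply: nz1; rewrite !(rmorphD, rmorphN, rmorphM, rmorphXn) /= !point_var /pt_seq /=; ring.
  + by move: i4; elim/ord5P: i => // _; rewrite !inE eqxx ?orbT.
Qed.

End Realization2.
End Chart2.

(** * Explicit 7 x 7 matrices *)

Lemma eq_cons (T : Type) (x y : T) s t : x = y -> s = t -> x :: s = y :: t.
Proof. by move=> -> ->. Qed.

Section Matrices7.
Variable C : numClosedFieldType.
Implicit Types (z : seq C).

Definition mx7 (s : seq (seq C)) : 'M[C]_7 := \matrix_(i, j) nth 0 (nth [::] s i) j.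

Definition mulseq (s t : seq (seq C)) :=
  mkseq (fun i => mkseq (fun j => foldr (fun k x =>
    nth 0 (nth [::] s i) k * nth 0 (nth [::] t k) j + x) 0 (iota 0 7)) 7) 7.

Lemma mulmx7 s t : mx7 s * mx7 t = mx7 (mulseq s t).
Proof.
apply/matrixP => i j; rewrite !mxE !nth_mkseq //=.
by rewrite !big_ord_recl big_ord0 !mxE.
Qed.

(* The elements of U+, by the six coordinates z = [:: a; p1; p2; q; p4; p5]
   which are read off at the positions (1,2), (0,1), (0,2), (0,3)/2, (0,4), (0,5). *)
Definition Nseq z : seq (seq C) :=
  let a := nth 0 z 0 in let p1 := nth 0 z 1 in let p2 := nth 0 z 2 in
  let q := nth 0 z 3 in let p4 := nth 0 z 4 in let p5 := nth 0 z 5 in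
  [:: [:: 1; p1; p2; 2 * q; p4; p5; p1 * p5 - p2 * p4 + q ^+ 2];
      [:: 0; 1; a; 2 * a * p1 - 2 * p2; a * p1 ^+ 2 - p1 * p2 - q;
          a * p1 * p2 - a * q - p2 ^+ 2; a * p1 * q - a * p4 - p2 * q + p5];
      [:: 0; 0; 1; 2 * p1; p1 ^+ 2; p1 * p2 - q; p1 * q - p4];
      [:: 0; 0; 0; 1; p1; p2; q];
      [:: 0; 0; 0; 0; 1; a; a * p1 - p2];
      [:: 0; 0; 0; 0; 0; 1; p1];
      [:: 0; 0; 0; 0; 0; 0; 1]].

(** The last entry of row 0 is forced: that row is isotropic for the invariant quadratic form x_0
    x_6 - x_1 x_5 + x_2 x_4 - x_3^2 / 4. *)
Definition N_ z := mx7 (Nseq z).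

Lemma N_eta z :
  N_ z = N_ [:: nth 0 z 0; nth 0 z 1; nth 0 z 2; nth 0 z 3; nth 0 z 4; nth 0 z 5].
Proof. by []. Qed.

(** With V the natural representation of GL_2, the blocks are V, S^2 V / det and V / det for j = 1,
    and det, V, 1, V / det and 1 / det for j = 2. Since w is a separate parameter, multiplicativity
    is a polynomial identity. *)
Definition rho_seq (j : 'I_2) (al be ga de w : C) : seq (seq C) :=
  if j == i1 then
   [:: [:: al; be; 0; 0; 0; 0; 0];
       [:: ga; de; 0; 0; 0; 0; 0];
       [:: 0; 0; al ^+ 2 * w; 2 * al * be * w; be ^+ 2 * w; 0; 0];
       [:: 0; 0; al * ga * w; (al * de + be * ga) * w; be * de * w; 0; 0];
       [:: 0; 0; ga ^+ 2 * w; 2 * ga * de * w; de ^+ 2 * w; 0; 0];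
       [:: 0; 0; 0; 0; 0; al * w; be * w];
       [:: 0; 0; 0; 0; 0; ga * w; de * w]]
  else
   [:: [:: al * de - be * ga; 0; 0; 0; 0; 0; 0];
       [:: 0; al; be; 0; 0; 0; 0];
       [:: 0; ga; de; 0; 0; 0; 0];
       [:: 0; 0; 0; 1; 0; 0; 0];
       [:: 0; 0; 0; 0; al * w; be * w; 0];
       [:: 0; 0; 0; 0; ga * w; de * w; 0];
       [:: 0; 0; 0; 0; 0; 0; w]].

(* The Levi subgroup GL_2 of P_j, where w stands for the inverse determinant. *)
Definition rho j al be ga de w := mx7 (rho_seq j al be ga de w).

End Matrices7.

Ltac entries tac :=
  cbv [N_ rho rho_seq mulseq Nseq mkseq iota map foldr nth]; rewrite /=;
  apply: (congr1 (@mx7 _));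
  do 7 (apply: eq_cons;
    [do 7 (apply: eq_cons; [first [reflexivity | by tac] |]); reflexivity|]);
  reflexivity.

(** * The group law of U+ and conjugation by the Levi subgroup *)

Section MatrixIdentities.
Variable C : numClosedFieldType.
Implicit Types (z : seq C).

Lemma N_mul (a p u q v x a' p' u' q' v' x' : C) :
  N_ [:: a; p; u; q; v; x] * N_ [:: a'; p'; u'; q'; v'; x'] =
  N_ [:: a + a'; p + p'; p * a' + u + u'; p * a' * p' - p * u' + u * p' + q + q';
    p * a' * p' ^+ 2 - p * p' * u' - p * q' + u * p' ^+ 2 + 2 * q * p' + v + v';
    p * a' * p' * u' - p * a' * q' - p * u' ^+ 2 + u * p' * u' - u * q' + 2 * q * u'
      + v * a' + x + x'].
Proof. rewrite mulmx7; entries ltac:(ring). Qed.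

Lemma rho_mul j (al be ga de w al' be' ga' de' w' : C) :
  rho j al be ga de w * rho j al' be' ga' de' w' =
  rho j (al * al' + be * ga') (al * be' + be * de') (ga * al' + de * ga')
    (ga * be' + de * de') (w * w').
Proof. rewrite mulmx7 /rho /rho_seq; case: ifP => _; entries ltac:(ring). Qed.

(** The zero coordinate persists on the right-hand side; this and the next three identities express
    that the unipotent radical of P_j is normalized by x_j and y_j. *)
Lemma rho1_N_x (a u q v x s : C) :
  N_ [:: a; 0; u; q; v; x] * rho i1 1 s 0 1 1 = rho i1 1 s 0 1 1 *
    N_ [:: a; 0; - a * s + u; - a * s ^+ 2 + 2 * u * s + q;
      - a * s ^+ 3 + 3 * u * s ^+ 2 + 3 * q * s + v; a * q * s + u ^+ 2 * s + x].
Proof. rewrite !mulmx7 /rho_seq /=; entries ltac:(ring). Qed.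

Lemma rho1_N_y (a u q v x s : C) :
  N_ [:: a; 0; u; q; v; x] * rho i1 1 0 s 1 1 = rho i1 1 0 s 1 1 *
    N_ [:: a - 3 * u * s - 3 * q * s ^+ 2 - v * s ^+ 3; 0;
      u + 2 * q * s + v * s ^+ 2; q + v * s; v; - u * v * s + q ^+ 2 * s + x].
Proof. rewrite !mulmx7 /rho_seq /=; entries ltac:(ring). Qed.

Lemma rho2_N_x (p u q v x s : C) :
  N_ [:: 0; p; u; q; v; x] * rho i2 1 s 0 1 1 = rho i2 1 s 0 1 1 *
    N_ [:: 0; p; p * s + u; q; v; v * s + x].
Proof. rewrite !mulmx7 /rho_seq /=; entries ltac:(ring). Qed.

Lemma rho2_N_y (p u q v x s : C) :
  N_ [:: 0; p; u; q; v; x] * rho i2 1 0 s 1 1 = rho i2 1 0 s 1 1 *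
    N_ [:: 0; p + u * s; u; q; v + x * s; x].
Proof. rewrite !mulmx7 /rho_seq /=; entries ltac:(ring). Qed.

End MatrixIdentities.

Lemma ord7P (P : 'I_7 -> Prop) :
  (forall (k : nat) (hk : (k < 7)%N), P (Ordinal hk)) -> forall k, P k.
Proof. by move=> h [k hk]. Qed.

(** * Generators in explicit form and the anti-automorphism theta *)

Section Generators.
Variable C : numClosedFieldType.
Implicit Types (s : C) (t : 'I_2 -> C) (z : seq C).

Lemma val_eq7 (a : nat) (k : 'I_7) : (a < 7)%N -> (k == inord a) = (k == a :> nat).
Proof. by move=> ha; rewrite -val_eqE /= inordK. Qed.

Lemma mx7_1 : mx7 [seq [seq (i == j)%:R | j <- iota 0 7] | i <- iota 0 7] = 1 :> 'M[C]_7.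
Proof.
apply/matrixP => i j; rewrite !mxE -val_eqE.
by rewrite (nth_map 0%N) ?size_iota // (nth_map 0%N) ?size_iota // !nth_iota.
Qed.

Definition eseq (i : 'I_2) : seq (seq C) :=
  let z := [:: 0; 0; 0; 0; 0; 0; 0] in
  if i == i1 then [:: [:: 0; 1; 0; 0; 0; 0; 0]; z; [:: 0; 0; 0; 2; 0; 0; 0];
    [:: 0; 0; 0; 0; 1; 0; 0]; z; [:: 0; 0; 0; 0; 0; 0; 1]; z]
  else [:: z; [:: 0; 0; 1; 0; 0; 0; 0]; z; z; [:: 0; 0; 0; 0; 0; 1; 0]; z; z].

Definition fseq (i : 'I_2) : seq (seq C) :=
  let z := [:: 0; 0; 0; 0; 0; 0; 0] in
  if i == i1 then [:: z; [:: 1; 0; 0; 0; 0; 0; 0]; z; [:: 0; 0; 1; 0; 0; 0; 0];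
    [:: 0; 0; 0; 2; 0; 0; 0]; z; [:: 0; 0; 0; 0; 0; 1; 0]]
  else [:: z; z; [:: 0; 1; 0; 0; 0; 0; 0]; z; z; [:: 0; 0; 0; 0; 1; 0; 0]; z].

Lemma e_E i : e_ C i = mx7 (eseq i).
Proof.
rewrite /e_ /eseq; case: eqP => _; apply/matrixP; do 2 (apply: ord7P;
  case=> [|[|[|[|[|[|[|//]]]]]]] ?); rewrite /Eij !mxE !val_eq7 //=; ring.
Qed.

Lemma f_E i : f_ C i = mx7 (fseq i).
Proof.
rewrite /f_ /fseq; case: eqP => _; apply/matrixP; do 2 (apply: ord7P;
  case=> [|[|[|[|[|[|[|//]]]]]]] ?); rewrite /Eij !mxE !val_eq7 //=; ring.
Qed.

Lemma exp_nil3 (X : 'M[C]_7) : X * X * X = 0 ->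
  exp_nil X = 1 + X + 2^-1 *: (X * X).
Proof.
move=> X3; have X33 : X ^+ 3 = 0 by rewrite !exprS expr0 mulr1 mulrA.
have Xn k : X ^+ (k + 3) = 0 by rewrite exprD X33 mulr0.
rewrite /exp_nil 7!big_ord_recl big_ord0 /=.
rewrite (Xn 0%N) (Xn 1%N) (Xn 2%N) (Xn 3%N) !scaler0 !addr0 expr0 expr1 expr2.
by rewrite !invr1 !scale1r addrA.
Qed.

Definition scale_seq s (l : seq (seq C)) :=
  mkseq (fun i => mkseq (fun j => s * nth 0 (nth [::] l i) j) 7) 7.

Lemma scale_mx7 s l : s *: mx7 l = mx7 (scale_seq s l).
Proof. by apply/matrixP => i j; rewrite !mxE !nth_mkseq. Qed.

Definition add_seq (l l' : seq (seq C)) :=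
  mkseq (fun i => mkseq (fun j => nth 0 (nth [::] l i) j + nth 0 (nth [::] l' i) j) 7) 7.

Lemma add_mx7 l l' : mx7 l + mx7 l' = mx7 (add_seq l l').
Proof. by apply/matrixP => i j; rewrite !mxE !nth_mkseq. Qed.

Lemma mx7_0 : mx7 (mkseq (fun=> mkseq (fun=> 0) 7) 7) = 0 :> 'M[C]_7.
Proof. by apply/matrixP => i j; rewrite !mxE !nth_mkseq. Qed.

(** The strings of a simple root in the seven weights have length at most 3, so the exponential is
    quadratic; it is the image of a unipotent 2 x 2 matrix in the Levi subgroup. *)
Lemma x_E i s : x_ i s = rho i 1 s 0 1 1.
Proof.
rewrite /x_ e_E scale_mx7 exp_nil3.
  rewrite -mx7_1 mulmx7 scale_mx7 !add_mx7; elim/ord2P: i; rewrite /eseq /=.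
    cbv [scale_seq add_seq]; entries ltac:(field).
  cbv [scale_seq add_seq]; entries ltac:(field).
rewrite -mx7_0 !mulmx7; elim/ord2P: i; rewrite /eseq /=.
  cbv [scale_seq add_seq]; entries ltac:(ring).
cbv [scale_seq add_seq]; entries ltac:(ring).
Qed.

Lemma y_E i s : y_ i s = rho i 1 0 s 1 1.
Proof.
rewrite /y_ f_E scale_mx7 exp_nil3.
  rewrite -mx7_1 mulmx7 scale_mx7 !add_mx7; elim/ord2P: i; rewrite /fseq /=.
    cbv [scale_seq add_seq]; entries ltac:(field).
  cbv [scale_seq add_seq]; entries ltac:(field).
rewrite -mx7_0 !mulmx7; elim/ord2P: i; rewrite /fseq /=.
  cbv [scale_seq add_seq]; entries ltac:(ring).
cbv [scale_seq add_seq]; entries ltac:(ring).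
Qed.

Lemma rho_1 i : rho i 1 0 0 1 1 = 1 :> 'M[C]_7.
Proof.
rewrite -mx7_1; elim/ord2P: i; rewrite /rho_seq /=.
  cbv [scale_seq add_seq]; entries ltac:(ring).
cbv [scale_seq add_seq]; entries ltac:(ring).
Qed.

Lemma sbar_E i : sbar C i = rho i 0 (-1) 1 0 1.
Proof. by rewrite /sbar !x_E y_E !rho_mul; congr rho; ring. Qed.

Definition torseq t : seq (seq C) :=
  let d := [:: t i1; t i2 / t i1; t i1 ^+ 2 / t i2; 1; t i2 / t i1 ^+ 2; t i1 / t i2; (t i1)^-1] in
  mkseq (fun i => mkseq (fun j => if i == j then nth 0 d i else 0) 7) 7.

Lemma tor_E t : tor t = mx7 (torseq t).
Proof.
apply/matrixP => i j; rewrite !mxE nth_mkseq // nth_mkseq // -val_eqE;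
  case: eqP => _; last by rewrite mulr0n.
rewrite mulr1n !big_ord_recl big_ord0 mulr1.
have -> : lift ord0 ord0 = i2 by apply/val_inj.
move: i; apply: ord7P; case=> [|[|[|[|[|[|[|//]]]]]]] ?;
  rewrite /coroot /= ?expr0z ?expr1z ?exprN1 ?mulr1 ?mul1r //.
- exact: mulrC.
- exact: mulrC.
Qed.

Lemma tor_rho1 t : (forall k, t k != 0) ->
  tor t = rho i1 (t i1) 0 0 (t i2 / t i1) (t i2)^-1.
Proof.
move=> t0; have h1 := t0 i1; have h2 := t0 i2; rewrite tor_E /torseq.
move: (t i1) (t i2) h1 h2 => t1 t2 h1 h2; rewrite /rho /rho_seq /=.
entries ltac:(first [ring | field; rewrite ?h1 ?h2 //]).
Qed.

Lemma tor_rho2 t : (forall k, t k != 0) ->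
  tor t = rho i2 (t i2 / t i1) 0 0 (t i1 ^+ 2 / t i2) (t i1)^-1.
Proof.
move=> t0; have h1 := t0 i1; have h2 := t0 i2; rewrite tor_E /torseq.
move: (t i1) (t i2) h1 h2 => t1 t2 h1 h2; rewrite /rho /rho_seq /=.
entries ltac:(first [ring | field; rewrite ?h1 ?h2 //]).
Qed.

Lemma torM t t' : tor t * tor t' = tor (fun k => t k * t' k).
Proof.
rewrite !tor_E /torseq mulmx7; move: (t i1) (t i2) (t' i1) (t' i2) => t1 t2 u1 u2.
entries ltac:(rewrite ?invfM ?exprMn; ring).
Qed.

Lemma tor1 : tor (fun=> 1) = 1 :> 'M[C]_7.
Proof. rewrite -mx7_1 tor_E /torseq; entries ltac:(field). Qed.

Lemma N_tor (a p u q v x : C) t : (forall k, t k != 0) ->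
  N_ [:: a; p; u; q; v; x] * tor t = tor t *
    N_ [:: a * t i1 ^+ 3 / t i2 ^+ 2; p * t i2 / t i1 ^+ 2; u * t i1 / t i2; q / t i1;
           v * t i2 / t i1 ^+ 3; x / t i2].
Proof.
move=> t0; have h1 := t0 i1; have h2 := t0 i2; rewrite tor_E /torseq.
move: (t i1) (t i2) h1 h2 => t1 t2 h1 h2; rewrite !mulmx7.
entries ltac:(field; rewrite ?h1 ?h2 //).
Qed.

Lemma N_0 : N_ [:: 0; 0; 0; 0; 0; 0] = 1 :> 'M[C]_7.
Proof. rewrite -mx7_1; entries ltac:(ring). Qed.

Lemma N_x1 s : x_ i1 s = N_ [:: 0; s; 0; 0; 0; 0].
Proof. rewrite x_E /rho /rho_seq /=; entries ltac:(ring). Qed.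

Lemma N_x2 s : x_ i2 s = N_ [:: s; 0; 0; 0; 0; 0].
Proof. rewrite x_E /rho /rho_seq /=; entries ltac:(ring). Qed.

(** The plain transpose does not exchange e_1 and f_1, whose entries 2 are not in transposed
    positions; rescaling the weight-0 vector by 1/2 repairs this. *)
Definition thetaD (k : 'I_7) : C := if k == 3 :> nat then 2^-1 else 1.

Definition theta (M : 'M[C]_7) : 'M[C]_7 :=
  \matrix_(k, l) (thetaD k * M l k / thetaD l).

Lemma thetaD_neq0 k : thetaD k != 0.
Proof. by rewrite /thetaD; case: ifP; rewrite ?oner_eq0 ?invr_eq0 ?pnatr_eq0. Qed.

Lemma thetaK : involutive theta.
Proof.
move=> M; apply/matrixP => k l; rewrite !mxE; field.
by rewrite !thetaD_neq0.
Qed.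

Lemma thetaM M N : theta (M * N) = theta N * theta M.
Proof.
apply/matrixP => k l; rewrite !mxE mulr_sumr mulr_suml; apply: eq_bigr => h _.
rewrite !mxE; field; by rewrite !thetaD_neq0.
Qed.

Lemma theta1 : theta 1 = 1.
Proof.
apply/matrixP => k l; rewrite !mxE eq_sym; case: eqP => [->|_].
  by rewrite mulr1 divff // thetaD_neq0.
by rewrite mulr0 mul0r.
Qed.

Lemma theta_x i s : theta (x_ i s) = y_ i s.
Proof.
rewrite x_E y_E; elim/ord2P: i; apply/matrixP; do 2 (apply: ord7P;
  case=> [|[|[|[|[|[|[|//]]]]]]] ?);
  rewrite /rho /rho_seq !mxE /thetaD /=; field; rewrite ?invr_eq0 ?oner_eq0 ?pnatr_eq0 //.
Qed.

Lemma theta_tor t : theta (tor t) = tor t.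
Proof.
apply/matrixP => k l; rewrite !mxE eq_sym; case: eqP => [->|_].
  by rewrite mulr1n mulrAC divff ?mul1r // thetaD_neq0.
by rewrite !mulr0n mulr0 mul0r.
Qed.

End Generators.

(** * Subgroups of G *)

Section Subgroups.
Variable C : numClosedFieldType.
Implicit Types (s : C) (t : 'I_2 -> C) (z : seq C) (x y g n : 'M[C]_7) (j : 'I_2).
Implicit Types (S Z H P U : set 'M[C]_7).

Lemma unit_inv x y : x * y = 1 -> x \is a GRing.unit /\ x^-1 = y.
Proof.
move=> xy; have ux : x \is a GRing.unit by case/mulmx1_unit: xy.
by split=> //; apply: (mulrI ux); rewrite divrr.
Qed.

Lemma generated_sub S H : is_subgroup H -> S `<=` H -> generated S `<=` H.
Proof. by move=> sH SH x; apply. Qed.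

Lemma sub_generated S : S `<=` generated S.
Proof. by move=> x Sx H [_]; apply. Qed.

Lemma generated_subgroup S : S `<=` [set x | x \is a GRing.unit] ->
  is_subgroup (generated S).
Proof.
move=> Su; have uU : is_subgroup [set x : 'M[C]_7 | x \is a GRing.unit].
  split=> //= [|x y|x]; [exact: unitr1 | by move=> ux uy; rewrite unitrMr | by rewrite unitrV].
split=> [x hx|H [[]]//|x y hx hy H [sH SH]|x hx H [sH SH]].
- exact: (hx _ (conj uU Su)).
- by case: sH (hx H (conj sH SH)) (hy H (conj sH SH)) => _ _ m _; apply: m.
- by case: sH (hx H (conj sH SH)) => _ _ _ i; apply: i.
Qed.

(** The units that stabilize Z under right multiplication, together with their inverses, form a
    subgroup. *)
Lemma generated_stable S Z :
  (forall g, S g -> g \is a GRing.unit) ->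
  (forall g x, S g -> Z x -> Z (x * g) /\ Z (x * g^-1)) ->
  forall g, generated S g -> forall x, Z x -> Z (x * g).
Proof.
move=> Su stab g hg.
pose T := [set g | [/\ g \is a GRing.unit, forall x, Z x -> Z (x * g)
                      & forall x, Z x -> Z (x * g^-1)]].
have [] // : T g.
apply: hg; split; last by move=> h Sh; split=> [|x Zx|x Zx]; [apply: Su | case: (stab h x) ..].
split=> [h []//||h k [uh h1 h2] [uk k1 k2]|h [uh h1 h2]].
- by split=> [|x|x]; rewrite ?unitr1 ?invr1 ?mulr1.
- split=> [|x /h1/k1|x /k2/h2]; first by rewrite unitrMr.
    by rewrite mulrA.
  by rewrite invrM // mulrA.
- by split=> [|x /h2|x /h1]; rewrite ?unitrV ?invrK.
Qed.

Lemma xK i s : x_ i s * x_ i (- s) = 1 :> 'M[C]_7.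
Proof. by rewrite !x_E rho_mul -(rho_1 C i); congr rho; ring. Qed.

Lemma yK i s : y_ i s * y_ i (- s) = 1 :> 'M[C]_7.
Proof. by rewrite !y_E rho_mul -(rho_1 C i); congr rho; ring. Qed.

Lemma x_unit i s : x_ i s \is a GRing.unit. Proof. by case: (unit_inv (xK i s)). Qed.
Lemma x_inv i s : (x_ i s)^-1 = x_ i (- s). Proof. by case: (unit_inv (xK i s)). Qed.
Lemma y_unit i s : y_ i s \is a GRing.unit. Proof. by case: (unit_inv (yK i s)). Qed.
Lemma y_inv i s : (y_ i s)^-1 = y_ i (- s). Proof. by case: (unit_inv (yK i s)). Qed.

Lemma torK t : (forall k, t k != 0) -> tor t * tor (fun k => (t k)^-1) = 1.
Proof.
move=> t0; rewrite torM -tor1; congr (tor _).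
by apply/funext => k; rewrite divff.
Qed.

Lemma tor_unit t : (forall k, t k != 0) -> tor t \is a GRing.unit.
Proof. by move=> /torK/unit_inv[]. Qed.

Lemma tor_inv t : (forall k, t k != 0) -> (tor t)^-1 = tor (fun k => (t k)^-1).
Proof. by move=> /torK/unit_inv[]. Qed.

(** Coordinates 0 and 1 belong to the simple roots $\alpha_2$ and $\alpha_1$ and are additive
    characters of U+; the other coordinates are not. *)
Lemma N_mul_coords z z' : exists z'', [/\ N_ z * N_ z' = N_ z'',
  nth 0 z'' 0 = nth 0 z 0 + nth 0 z' 0 & nth 0 z'' 1 = nth 0 z 1 + nth 0 z' 1].
Proof.
by have := N_mul (nth 0 z 0) (nth 0 z 1) (nth 0 z 2) (nth 0 z 3) (nth 0 z 4) (nth 0 z 5)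
  (nth 0 z' 0) (nth 0 z' 1) (nth 0 z' 2) (nth 0 z' 3) (nth 0 z' 4) (nth 0 z' 5);
  rewrite -[N_ [:: nth 0 z 0; _; _; _; _; _]]/(N_ z)
    -[N_ [:: nth 0 z' 0; _; _; _; _; _]]/(N_ z') => ->; eexists; split; first reflexivity.
Qed.

Lemma N_right_inverse z : exists z', [/\ N_ z * N_ z' = 1,
  nth 0 z' 0 = - nth 0 z 0 & nth 0 z' 1 = - nth 0 z 1].
Proof.
rewrite (N_eta z).
move: (nth 0 z 0) (nth 0 z 1) (nth 0 z 2) (nth 0 z 3) (nth 0 z 4) (nth 0 z 5).
move=> a p u q v x; pose u' := p * a - u.
pose q' := - (p * a * p - p * u' - u * p + q).
pose v' := - (- p * a * p ^+ 2 + p * p * u' - p * q' + u * p ^+ 2 - 2 * q * p + v).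
pose x' := - (p * a * p * u' + p * a * q' - p * u' ^+ 2 - u * p * u' - u * q'
  + 2 * q * u' - v * a + x).
exists [:: - a; - p; u'; q'; v'; x']; split=> //.
rewrite N_mul -[RHS]N_0; congr (N_ [:: _; _; _; _; _; _]); rewrite /x' /v' /q' /u'; ring.
Qed.

(* U+, the unipotent radical of B+ *)
Definition Uplus : set 'M[C]_7 := range (@N_ C).

Definition other (j : 'I_2) : 'I_2 := if j == i1 then i2 else i1.

(* the unipotent radical of P_j: the coordinate of x_j vanishes *)
Definition NI j : set 'M[C]_7 := [set N_ z | z in [set z | nth 0 z (j == i1) = 0]].

(** A condition on the two additive characters is all that distinguishes U+ from [NI j], where the
    truth value of [j == i1] is read as the number of the coordinate that vanishes. *)
Lemma coord_subgroup (Q : set (seq C)) :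
  Q [:: 0; 0; 0; 0; 0; 0] ->
  (forall z z' z'', Q z -> Q z' -> nth 0 z'' 0 = nth 0 z 0 + nth 0 z' 0 ->
    nth 0 z'' 1 = nth 0 z 1 + nth 0 z' 1 -> Q z'') ->
  (forall z z', Q z -> nth 0 z' 0 = - nth 0 z 0 -> nth 0 z' 1 = - nth 0 z 1 -> Q z') ->
  is_subgroup [set N_ z | z in Q].
Proof.
move=> Q0 QD QN; split.
- by move=> _ [z _ <-]; have [z' [/unit_inv[]]] := N_right_inverse z.
- by exists [:: 0; 0; 0; 0; 0; 0] => //; apply: N_0.
- move=> _ _ [z Qz <-] [z' Qz' <-]; have [z'' [-> h0 h1]] := N_mul_coords z z'.
  by exists z'' => //; apply: QD h0 h1.
- move=> _ [z Qz <-]; have [z' [/unit_inv[_ ->] h0 h1]] := N_right_inverse z.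
  by exists z' => //; apply: QN h0 h1.
Qed.

Lemma Uplus_subgroup : is_subgroup Uplus.
Proof. exact: coord_subgroup. Qed.

Lemma NI_subgroup j : is_subgroup (NI j).
Proof.
apply: coord_subgroup => /= [|z z' z'' |z z']; first by case: (j == i1).
  by case: (j == i1) => /= e e' h0 h1; rewrite ?h0 ?h1 e e' addr0.
by case: (j == i1) => /= e h0 h1; rewrite ?h0 ?h1 e oppr0.
Qed.

Lemma NI_Uplus j : NI j `<=` Uplus.
Proof. by move=> _ [z _ <-]; exists z. Qed.

Lemma x_Uplus i s : Uplus (x_ i s).
Proof. by elim/ord2P: i; rewrite ?N_x1 ?N_x2; eexists. Qed.

Lemma x_NI i s : NI (other i) (x_ i s).
Proof.
by elim/ord2P: i; [exists [:: 0; s; 0; 0; 0; 0] | exists [:: s; 0; 0; 0; 0; 0]];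
  rewrite ?N_x1 ?N_x2.
Qed.

Definition normalized H g := forall n, H n -> exists2 n', H n' & n * g = g * n'.

Lemma normalized_mem H g : is_subgroup H -> H g -> normalized H g.
Proof.
case=> Hu _ HM HV Hg n Hn; exists (g^-1 * (n * g)); first exact: (HM _ _ (HV _ Hg) (HM _ _ Hn Hg)).
by rewrite mulVKr //; apply: Hu.
Qed.

Lemma normalizedM H g h : normalized H g -> normalized H h -> normalized H (g * h).
Proof.
move=> hg hh n Hn; have [n1 H1 e1] := hg n Hn; have [n2 H2 e2] := hh n1 H1.
by exists n2 => //; rewrite mulrA e1 -!mulrA e2.
Qed.

Lemma tor_Uplus t : (forall k, t k != 0) -> normalized Uplus (tor t).
Proof.
move=> t0 _ [z _ <-].
rewrite (N_eta z).
by rewrite N_tor //; eexists; [eexists|reflexivity].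
Qed.

Lemma tor_NI j t : (forall k, t k != 0) -> normalized (NI j) (tor t).
Proof.
move=> t0 _ [z /= zj <-].
rewrite (N_eta z).
rewrite N_tor //; eexists; last reflexivity; eexists; last reflexivity.
by move: zj; case: (j == i1) => /= ->; rewrite !mul0r.
Qed.

Lemma rhox_NI j s : normalized (NI j) (rho j 1 s 0 1 1).
Proof.
move=> _ [z /= zj <-].
rewrite (N_eta z).
move: zj; elim/ord2P: j => /= ->.
  by rewrite rho1_N_x; eexists; last reflexivity; eexists; last reflexivity.
by rewrite rho2_N_x; eexists; last reflexivity; eexists; last reflexivity.
Qed.

Lemma rhoy_NI j s : normalized (NI j) (rho j 1 0 s 1 1).
Proof.
move=> _ [z /= zj <-].
rewrite (N_eta z).
move: zj; elim/ord2P: j => /= ->.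
  by rewrite rho1_N_y; eexists; last reflexivity; eexists; last reflexivity.
by rewrite rho2_N_y; eexists; last reflexivity; eexists; last reflexivity.
Qed.

Lemma ord2_cases (i j : 'I_2) : i = j \/ i = other j.
Proof. by elim/ord2P: i; elim/ord2P: j; auto. Qed.

Lemma x_norm_NI j i s : normalized (NI j) (x_ i s).
Proof.
case: (ord2_cases i j) => ->; first by rewrite x_E; apply: rhox_NI.
apply: normalized_mem (NI_subgroup j) _.
by have := x_NI (other j) s; elim/ord2P: j.
Qed.

Lemma y_norm_NI j s : normalized (NI j) (y_ j s).
Proof. by rewrite y_E; apply: rhoy_NI. Qed.

Definition Levi j : set 'M[C]_7 :=
  [set x | exists al be ga de w, (al * de - be * ga) * w = 1 /\ x = rho j al be ga de w].

Lemma Levi_mul j x y : Levi j x -> Levi j y -> Levi j (x * y).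
Proof.
case=> [a [b [c [d [w [h ->]]]]]] [a' [b' [c' [d' [w' [h' ->]]]]]].
rewrite rho_mul; do 5 eexists; split; last reflexivity.
by rewrite -[RHS]mulr1 -{1}h -h'; ring.
Qed.

Lemma Levi_x j s : Levi j (x_ j s).
Proof. by rewrite x_E; do 5 eexists; split; last reflexivity; ring. Qed.

Lemma Levi_y j s : Levi j (y_ j s).
Proof. by rewrite y_E; do 5 eexists; split; last reflexivity; ring. Qed.

Lemma Levi_tor j t : (forall k, t k != 0) -> Levi j (tor t).
Proof.
move=> t0; have h1 := t0 i1; have h2 := t0 i2.
elim/ord2P: j; [rewrite tor_rho1 | rewrite tor_rho2] => //.
  by do 5 eexists; split; last reflexivity; field; rewrite ?h1 ?h2.
by do 5 eexists; split; last reflexivity; field; rewrite ?h1 ?h2.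
Qed.

Definition levi_product j : set 'M[C]_7 :=
  [set x | exists l n, [/\ Levi j l, NI j n & x = l * n]].

Lemma levi_product_mul_Levi j x g :
  normalized (NI j) g -> Levi j g -> levi_product j x -> levi_product j (x * g).
Proof.
move=> ng Lg [l [n [Ll Nn ->]]]; have [n2 N2 e] := ng n Nn.
by exists (l * g), n2; split=> //; [apply: Levi_mul | rewrite -!mulrA e].
Qed.

Lemma levi_product_mul_NI j x g : NI j g -> levi_product j x -> levi_product j (x * g).
Proof.
move=> Ng [l [n [Ll Nn ->]]]; exists l, (n * g); split=> //; last by rewrite mulrA.
by case: (NI_subgroup j) => _ _ m _; apply: m.
Qed.

Lemma Levi_1 j : Levi j 1.
Proof. by exists 1, 0, 0, 1, 1; split; [ring | rewrite rho_1]. Qed.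

Lemma levi_product_1 j : levi_product j 1.
Proof.
exists 1, 1; split; rewrite ?mulr1 //; first exact: Levi_1.
by case: (NI_subgroup j).
Qed.

Lemma levi_product_x j x i s : levi_product j x -> levi_product j (x * x_ i s).
Proof.
case: (ord2_cases i j) => ->.
  by apply: levi_product_mul_Levi; [apply: x_norm_NI | apply: Levi_x].
by apply: levi_product_mul_NI; have := x_NI (other j) s; elim/ord2P: j.
Qed.

Lemma levi_product_y j x s : levi_product j x -> levi_product j (x * y_ j s).
Proof. by apply: levi_product_mul_Levi; [apply: y_norm_NI | apply: Levi_y]. Qed.

Lemma levi_product_tor j x t : (forall k, t k != 0) ->
  levi_product j x -> levi_product j (x * tor t).
Proof. by move=> t0; apply: levi_product_mul_Levi; [apply: tor_NI | apply: Levi_tor]. Qed.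

Definition borel_gens (u : 'I_2 -> C -> 'M[C]_7) : set 'M[C]_7 :=
  [set g | exists2 t : 'I_2 -> C, forall i, t i != 0 & g = tor t]
    `|` [set g | exists (i : 'I_2) (t : C), g = u i t].

Lemma Bplus_gens_unit g : borel_gens (@x_ C) g -> g \is a GRing.unit.
Proof. by case=> [[t t0 ->]|[i [s ->]]]; [apply: tor_unit | apply: x_unit]. Qed.

Lemma Bplus_subgroup : is_subgroup (Bplus C).
Proof. by apply: generated_subgroup => g; apply: Bplus_gens_unit. Qed.

Lemma invr_neq0_fun t : (forall k, t k != 0) -> forall k, (t k)^-1 != 0.
Proof. by move=> t0 k; rewrite invr_eq0. Qed.

Lemma Bplus_levi j g : Bplus C g -> forall x, levi_product j x -> levi_product j (x * g).
Proof.
apply: generated_stable => [h|h x]; first exact: Bplus_gens_unit.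
case=> [[t t0 ->]|[i [s ->]]] hx.
  rewrite tor_inv //; split; apply: levi_product_tor => //; exact: invr_neq0_fun.
by rewrite x_inv; split; apply: levi_product_x.
Qed.

Lemma parabolic_gens_unit j g : (Bplus C `|` range (@y_ C j)) g -> g \is a GRing.unit.
Proof.
case=> [Bg|[s _ <-]]; last exact: y_unit.
by case: Bplus_subgroup => u _ _ _; apply: u.
Qed.

Lemma parabolic_subgroup j : is_subgroup (parabolic C j).
Proof. by apply: generated_subgroup => g; apply: parabolic_gens_unit. Qed.

(** One inclusion of the Levi decomposition: the product L N contains 1 and is stable under right
    multiplication by the generators, since those in L normalize N. *)
Lemma parabolic_levi j : parabolic C j `<=` levi_product j.
Proof.
move=> g Pg; rewrite -[g]mul1r; move: g Pg 1 (levi_product_1 j).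
apply: generated_stable => [h|h x]; first exact: parabolic_gens_unit.
case=> [Bh|[s _ <-]] hx.
  split; first exact: Bplus_levi.
  by apply: Bplus_levi => //; case: Bplus_subgroup => _ _ _; apply.
by rewrite y_inv; split; apply: levi_product_y.
Qed.

Lemma Bplus_tor_Uplus g : Bplus C g ->
  exists t u, [/\ forall k, t k != 0, Uplus u & g = tor t * u].
Proof.
pose Z := [set x | exists t u, [/\ forall k, t k != 0, Uplus u & x = tor t * u]].
have [_ U1 UM _] := Uplus_subgroup.
have Z1 : Z 1.
  exists (fun=> 1), 1; rewrite mulr1 tor1; split=> // k; exact: oner_neq0.
move=> Bg; rewrite -[g]mul1r; move: g Bg 1 Z1.
have Ztor x t : (forall k, t k != 0) -> Z x -> Z (x * tor t).
  move=> t0 [t1 [u [h1 Uu ->]]]; have [u' Uu' e] := tor_Uplus t0 Uu.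
  exists (fun k => t1 k * t k), u'; split=> // [k|]; first by rewrite mulf_neq0.
  by rewrite -mulrA e mulrA torM.
have Zx x i s : Z x -> Z (x * x_ i s).
  move=> [t1 [u [h1 Uu ->]]]; exists t1, (u * x_ i s).
  by split=> //; [apply: UM => //; apply: x_Uplus | rewrite mulrA].
apply: (@generated_stable _ Z) => [h|h x]; first exact: Bplus_gens_unit.
case=> [[t t0 ->]|[i [s ->]]] hx.
  rewrite tor_inv //; split; apply: Ztor => //; exact: invr_neq0_fun.
by rewrite x_inv; split; apply: Zx.
Qed.

(** Conjugating x_2(a) by x_1(s) moves the coordinates u, q, v along a twisted cubic. Products of
    such elements yield the centre first and then all other coordinates. *)
Lemma Uplus_generated H : is_subgroup H -> (forall i s, H (x_ i s)) -> Uplus `<=` H.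
Proof.
case=> _ H1 HM HV Hx.
pose Kz (a u q v x : C) := H (N_ [:: a; 0; u; q; v; x]).
have KM (a u q v x a' u' q' v' x' : C) : Kz a u q v x -> Kz a' u' q' v' x' ->
    Kz (a + a') (u + u') (q + q') (v + v') (- u * q' + 2 * q * u' + v * a' + x + x').
  move=> h h'; have := HM _ _ h h'; rewrite N_mul /Kz.
  by congr (H (N_ [:: _; _; _; _; _; _])); ring.
have eqK (a u q v x a' u' q' v' x' : C) : Kz a u q v x -> a = a' -> u = u' -> q = q' ->
  v = v' -> x = x' -> Kz a' u' q' v' x' by move=> h <- <- <- <- <-.
have Ka a : Kz a 0 0 0 0 by rewrite /Kz -N_x2.
have Kas a s : Kz a (- a * s) (- a * s ^+ 2) (- a * s ^+ 3) 0.
  have := rho1_N_x a 0 0 0 0 s; rewrite -x_E => e.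
  have : H (x_ i1 (- s) * (N_ [:: a; 0; 0; 0; 0; 0] * x_ i1 s)).
    exact: (HM _ _ (Hx i1 (- s)) (HM _ _ (Ka a) (Hx i1 s))).
  rewrite e -x_inv mulKr ?x_unit // => h.
  by apply: eqK h _ _ _ _ _; ring.
have KB a s : Kz 0 (- a * s) (- a * s ^+ 2) (- a * s ^+ 3) 0.
  by apply: eqK (KM _ _ _ _ _ _ _ _ _ _ (Ka (- a)) (Kas a s)) _ _ _ _ _; ring.
(* Two elements of the cubic with opposite u, q, v: their product is central and has last coordinate
   x. *)
have Kx (x : C) : Kz 0 0 0 0 x.
  have [->|x0] := eqVneq x 0; first exact: Ka.
  have := KM _ _ _ _ _ _ _ _ _ _ (KB x^-1 (- x)) (KB (- x^-1) (- x)) => h.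
  by apply: eqK h _ _ _ _ _; field.
have K0 (u q v x : C) : Kz 0 u q v x.
  (* The parameters s = 1, -1, 2 give three independent points of the cubic, and e, b, d solve the
     linear system for (u, q, v). The last coordinate [x'] that results is corrected by [Kx]. *)
  pose d : C := (u - v) / 6; pose b := (u - q - 2 * d) / 2; pose e := - (q + u + 6 * d) / 2.
  have [x' h] : exists x' : C, Kz 0 u q v x'.
    have := KM _ _ _ _ _ _ _ _ _ _ (KM _ _ _ _ _ _ _ _ _ _ (KB e 1) (KB b (- 1))) (KB d 2).
    move=> h; refine (ex_intro _ _ (eqK _ _ _ _ _ _ _ _ _ _ h _ _ _ _ erefl));
      rewrite /e /b /d; field; rewrite ?pnatr_eq0 //.
  by apply: eqK (KM _ _ _ _ _ _ _ _ _ _ h (Kx (x - x'))) _ _ _ _ _; ring.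
have Kall (a u q v x : C) : Kz a u q v x.
  by apply: eqK (KM _ _ _ _ _ _ _ _ _ _ (Ka a) (K0 u q v x)) _ _ _ _ _; ring.
move=> _ [z _ <-].
rewrite (N_eta z).
move: (nth 0 z 0) (nth 0 z 1) (nth 0 z 2) (nth 0 z 3) (nth 0 z 4) (nth 0 z 5).
move=> a p u q v x; pose u' := u - p * a; pose q' := q + p * u'; pose v' := v + p * q'.
have := HM _ _ (Hx i1 p) (Kall a u' q' v' (x + p * u' ^+ 2 + p * a * q')).
rewrite N_x1 N_mul; congr (H (N_ [:: _; _; _; _; _; _])); rewrite /v' /q' /u'; ring.
Qed.

End Subgroups.

(** * Unipotent radicals *)

Section FunctionRings.
Variable C : numClosedFieldType.

Record function_ring (T : Type) (P : (T -> C) -> Prop) : Prop := {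
  fr_cst : forall c, P (fun=> c) ;
  fr_add : forall f g, P f -> P g -> P (fun x => f x + g x) ;
  fr_mul : forall f g, P f -> P g -> P (fun x => f x * g x) }.

Section FunctionRing.
Variables (T : Type) (P : (T -> C) -> Prop).
Hypothesis frP : function_ring P.

Lemma fr_opp f : P f -> P (fun x => - f x).
Proof.
move=> Pf; rewrite (_ : (fun x => - f x) = fun x => -1 * f x).
  by apply: fr_mul => //; apply: fr_cst.
by apply/funext => x; rewrite mulN1r.
Qed.

Lemma fr_exp f k : P f -> P (fun x => f x ^+ k).
Proof.
move=> Pf; elim: k => [|k IHk]; first exact: fr_cst.
rewrite (_ : (fun x => f x ^+ k.+1) = fun x => f x * f x ^+ k); first exact: fr_mul.
by apply/funext => x; rewrite exprS.
Qed.

Lemma fr_sum (I : Type) (r : seq I) (F : I -> T -> C) :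
  (forall i, P (F i)) -> P (fun x => \sum_(i <- r) F i x).
Proof.
move=> PF; elim: r => [|i r IHr].
  by under eq_fun do rewrite big_nil; apply: fr_cst.
by under eq_fun do rewrite big_cons; apply: fr_add.
Qed.

Lemma fr_N_entry (zs : T -> seq C) : (forall k, P (fun x => nth 0 (zs x) k)) ->
  forall r c, P (fun x => N_ (zs x) r c).
Proof.
move=> Pz r c; under eq_fun do rewrite mxE; move: r c.
do 2 (apply: ord7P; case=> [|[|[|[|[|[|[|//]]]]]]] ?); rewrite /=;
  repeat first [exact: Pz | exact: (fr_cst frP) | apply: (fr_add frP) | apply: (fr_mul frP)
    | apply: fr_opp | apply: fr_exp].
Qed.

End FunctionRing.

Definition pfun (n : nat) (f : ('I_n -> C) -> C) := exists p : mpoly n C, forall v, f v = meval v p.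

Lemma pfun_ring n : function_ring (@pfun n).
Proof.
split=> [c|f g [p hp] [q hq]|f g [p hp] [q hq]].
- by exists (mpolyC n c) => v; rewrite mevalC.
- by exists (p + q) => v; rewrite hp hq mevalD.
- by exists (p * q) => v; rewrite hp hq mevalM.
Qed.

Lemma pfun_var n (i : 'I_n) : pfun (fun v => v i).
Proof. by exists (mpolyX C (mnm1 i)) => v; rewrite mevalXU. Qed.

Lemma pfun_meval n (p : mpoly n C) : pfun (fun v => meval v p).
Proof. by exists p. Qed.

Lemma pfun_comp m n (f : ('I_m -> C) -> C) (h : 'I_m -> ('I_n -> C) -> C) :
  pfun f -> (forall k, pfun (h k)) -> pfun (fun v => f (fun k => h k v)).
Proof.
case=> p hp /choice[q hq]; exists (mpoly_eval (mpolyC n (R := C)) q p) => v.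
rewrite hp; pose ev : {rmorphism mpoly n C -> C} := meval v.
have := @eq_rmorphism m C _ (mpoly_polynomial_ring m C) C
  (mpoly_eval idfun (fun k => h k v)) (ev \o mpoly_eval (mpolyC n (R := C)) q).
apply=> [c|i] /=.
  by rewrite /ev /= !mmapC mevalC.
by rewrite /ev /= !mmapX !mmap1U hq.
Qed.

Lemma pfun_mul_eq0 n (f g : ('I_n -> C) -> C) : pfun f -> pfun g ->
  (forall v, f v * g v = 0) -> (exists v, f v <> 0) -> forall v, g v = 0.
Proof.
move=> [p hp] [q hq] fg [v0 fv0] v.
have /eqP : p * q = 0.
  by apply: mpoly_eval_eq0 => u; rewrite mevalM -hp -hq fg.
rewrite mulf_eq0 => /orP[] /eqP e; last by rewrite hq e meval0.
by case: fv0; rewrite hp e meval0.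
Qed.

Lemma regular_ring (X : set 'M[C]_7) : function_ring (regular X).
Proof.
split=> [c|f g [p hp] [q hq]|f g [p hp] [q hq]].
- by exists (mpolyC _ c) => v _; rewrite /evalmx mevalC.
- by exists (p + q) => v Xv; rewrite hp // hq // /evalmx mevalD.
- by exists (p * q) => v Xv; rewrite hp // hq // /evalmx mevalM.
Qed.

Lemma regular_entry (X : set 'M[C]_7) i j : regular X (fun x => x i j).
Proof.
exists (mpolyX C (mnm1 (mxvec_index i j))) => x _.
by rewrite /evalmx mevalXU mxvecE.
Qed.

Lemma eq_regular (X : set 'M[C]_7) f g : (forall x, X x -> f x = g x) ->
  regular X f -> regular X g.
Proof. by move=> fg [p hp]; exists p => x Xx; rewrite -fg // hp. Qed.

Lemma regular_mull_mulr (X : set 'M[C]_7) (a b : 'M[C]_7) i j :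
  regular X (fun x => (a * x * b) i j).
Proof.
under eq_fun do rewrite mxE; apply: (fr_sum (regular_ring X)) => k.
under eq_fun do rewrite mxE; apply: (fr_mul (regular_ring X));
  last exact: fr_cst (regular_ring X) _.
apply: (fr_sum (regular_ring X)) => l; apply: (fr_mul (regular_ring X)).
  exact: fr_cst (regular_ring X) _.
exact: regular_entry.
Qed.

Lemma regular_comp (X Y : set 'M[C]_7) (h : 'M[C]_7 -> 'M[C]_7) f :
  (forall x, X x -> Y (h x)) -> (forall i j, regular X (fun x => h x i j)) ->
  regular Y f -> regular X (f \o h).
Proof.
move=> XY hh [p hp]; have /choice[q hq] : forall k, exists q, forall x, X x ->
    mxvec (h x) 0 k = evalmx q x.
  by move=> k; case/mxvec_indexP: k => i j; have [q hq] := hh i j; exists q => x Xx;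
    rewrite mxvecE hq.
have [r hr] := @pfun_comp (7 * 7) (7 * 7) (fun v => meval v p) (fun k v => meval v (q k))
  (pfun_meval p) (fun k => pfun_meval (q k)).
exists r => x Xx; rewrite /= hp ?[RHS]/evalmx -?hr; last exact: XY.
by rewrite /evalmx; congr (meval _ p); apply/funext => k; rewrite hq.
Qed.

Lemma evalmx_pfun n (g : ('I_n -> C) -> 'M[C]_7) p :
  (forall i j, pfun (fun v => g v i j)) -> pfun (fun v => evalmx p (g v)).
Proof.
move=> hg; apply: (@pfun_comp _ _ (fun u => meval u p) (fun k v => mxvec (g v) 0 k)).
  exact: pfun_meval.
move=> k; case/mxvec_indexP: k => i j.
by under eq_fun do rewrite mxvecE; apply: hg.
Qed.

Lemma zariski_closed_family (I : Type) (f : I -> 'M[C]_7 -> C) :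
  (forall i, regular setT (f i)) ->
  zariski_closed [set x | x \is a GRing.unit /\ forall i, f i x = 0].
Proof.
move=> hf; exists [set p | exists i, forall x, f i x = evalmx p x].
apply/seteqP; split=> x [ux h]; split=> //.
  by move=> p [i <-].
move=> i; have [p hp] := hf i; rewrite hp //; apply: h; exists i => y; exact: hp.
Qed.

(** The image of an affine space is irreducible: if p in I is nonzero at g v0, then p q vanishes on
    the whole image for every q in J; polynomial functions form a domain, so every q vanishes and B
    is the whole image. *)
Lemma zariski_connected_range n (g : ('I_n -> C) -> 'M[C]_7) :
  (forall i j, pfun (fun v => g v i j)) -> zariski_connected (range g).
Proof.
move=> hg A B [I eA] [J eB] AB AB0.
have [A0|/existsNP[v0 Av0]] := pselect (forall v, A (g v)).
  right; apply/eqP/negPn/negP => /set0P[x Bx].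
  have : (range g) x by rewrite -AB; right.
  case=> v _ ev; have : (A `&` B) x by split; rewrite -?ev //; rewrite ev.
  by rewrite AB0.
left; have gu v : g v \is a GRing.unit.
  have : (A `|` B) (g v) by rewrite AB; exists v.
  by rewrite eA eB => -[] [].
have [p Ip pv0] : exists2 p, I p & evalmx p (g v0) <> 0.
  apply: contrapT => h; apply: Av0; rewrite eA; split=> // p Ip.
  by apply: contrapT => pv; apply: h; exists p.
have allB v : B (g v).
  rewrite eB; split=> // q Jq.
  apply: (pfun_mul_eq0 (evalmx_pfun p hg) (evalmx_pfun q hg)); last by exists v0.
  move=> u; have : (A `|` B) (g u) by rewrite AB; exists u.
  by rewrite eA eB => -[[_ /(_ _ Ip) ->]|[_ /(_ _ Jq) ->]]; rewrite ?mul0r ?mulr0.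
apply/eqP/negPn/negP => /set0P[x Ax].
have : (range g) x by rewrite -AB; left.
case=> v _ ev; have : (A `&` B) x by split; rewrite // -ev.
by rewrite AB0.
Qed.

End FunctionRings.

(** * The radical of the Borel subgroup and a lower bound for that of P_j *)

Section Radicals.
Variable C : numClosedFieldType.
Implicit Types (s : C) (t : 'I_2 -> C) (z : seq C) (x y g n : 'M[C]_7) (j : 'I_2).
Implicit Types (S Z H P U : set 'M[C]_7).

(** For k = 0, 1 these are the groups [NI]; for k = 6, beyond the six coordinates that [N_] reads,
    this is all of U+. *)
Definition Ncoord k : set 'M[C]_7 := [set N_ z | z in [set z : seq C | nth 0 z k = 0]].

Lemma Uplus_Ncoord : @Uplus C = Ncoord 6.
Proof.
apply/seteqP; split=> _ [z _ <-]; last by exists z.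
by exists [:: nth 0 z 0; nth 0 z 1; nth 0 z 2; nth 0 z 3; nth 0 z 4; nth 0 z 5].
Qed.

Definition coords x : seq C :=
  [:: x (inord 1) (inord 2); x 0 (inord 1); x 0 (inord 2); x 0 (inord 3) / 2;
      x 0 (inord 4); x 0 (inord 5)].

Lemma coordsK z : N_ (coords (N_ z)) = N_ z.
Proof.
rewrite [RHS]N_eta.
rewrite /coords !mxE !inordK //=; congr (N_ [:: _; _; _; _; _; _]).
by rewrite mulrC mulKf // pnatr_eq0.
Qed.

Lemma coords_nth z k : (k < 6)%N -> nth 0 (coords (N_ z)) k = nth 0 z k.
Proof.
case: k => [|[|[|[|[|[|//]]]]]] _; rewrite /coords !mxE !inordK //=.
by rewrite mulrC mulKf // pnatr_eq0.
Qed.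

Lemma coords_regular (X : set 'M[C]_7) k : regular X (fun x => nth 0 (coords x) k).
Proof.
case: k => [|[|[|[|[|[|k]]]]]] /=; try exact: regular_entry.
  by apply: (fr_mul (regular_ring X)); [apply: regular_entry | apply: fr_cst (regular_ring X) _].
by rewrite nth_nil; apply: fr_cst (regular_ring X) _.
Qed.

Lemma N_unit z : N_ z \is a GRing.unit.
Proof. by have [z' [/unit_inv[]]] := N_right_inverse z. Qed.

(** U+ is cut out by the polynomial equations x = N_ (coords x), to which the vanishing of
    coordinate k is added as the index [None]. *)
Lemma Ncoord_closed k : (k <= 6)%N -> zariski_closed (Ncoord k).
Proof.
move=> k6.
pose f (u : option ('I_7 * 'I_7)) x := if u is Some (r, c) then x r c - N_ (coords x) r c
  else nth 0 (coords x) k.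
have -> : Ncoord k = [set x | x \is a GRing.unit /\ forall u, f u x = 0].
  apply/seteqP; split=> [_ [z /= zk <-]|x [ux h]].
    split; first exact: N_unit.
    case=> [[r c]|] /=; first by rewrite coordsK subrr.
    move: k6; rewrite leq_eqVlt => /orP[/eqP ->|k6]; first by rewrite nth_default.
    by rewrite coords_nth.
  exists (coords x); first exact: (h None).
  by apply/matrixP => r c; apply/eqP; rewrite eq_sym -subr_eq0; apply/eqP/(h (Some (r, c))).
apply: zariski_closed_family => -[[r c]|] /=; last exact: coords_regular.
apply: (fr_add (regular_ring setT)); first exact: regular_entry.
apply: (fr_opp (regular_ring setT)).
by apply: (fr_N_entry (regular_ring setT)) => l; apply: coords_regular.
Qed.

Lemma Ncoord_connected k : zariski_connected (Ncoord k).
Proof.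
pose zs (v : 'I_6 -> C) := mkseq (fun l => if l == k then 0 else v (inord l)) 6.
have -> : Ncoord k = range (fun v => N_ (zs v)).
  apply/seteqP; split=> [_ [z /= zk <-]|_ [v _ <-]]; last first.
    exists (zs v) => //=; have [k6|k6] := ltnP k 6; first by rewrite nth_mkseq // eqxx.
    by rewrite nth_default ?size_mkseq.
  exists (fun l => nth 0 z l) => //.
  have zsE l : (l < 6)%N -> nth 0 (zs (fun l => nth 0 z l)) l = nth 0 z l.
    by move=> l6; rewrite nth_mkseq // inordK //; case: eqP => // ->.
  rewrite [RHS]N_eta.
  by rewrite -(zsE 0%N) // -(zsE 1%N) // -(zsE 2%N) // -(zsE 3%N) // -(zsE 4%N) // -(zsE 5%N).
apply: zariski_connected_range; apply: (fr_N_entry (pfun_ring C 6)) => l.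
have [l6|l6] := ltnP l 6; last first.
  by under eq_fun do rewrite nth_default ?size_mkseq //; apply: fr_cst (pfun_ring C 6) _.
under eq_fun do rewrite nth_mkseq //.
by case: eqP => _; [apply: fr_cst (pfun_ring C 6) _ | apply: pfun_var].
Qed.

Lemma strict_upper_nilpotent (X : 'M[C]_7) :
  (forall i j : 'I_7, (j <= i)%N -> X i j = 0) -> X ^+ 7 = 0.
Proof.
move=> hX; have pw k (i j : 'I_7) : (j < i + k)%N -> (X ^+ k) i j = 0.
  elim: k i j => [|k IHk] i j ji.
    by rewrite expr0 mxE; case: eqP ji => // ->; rewrite addn0 ltnn.
  rewrite exprS mxE big1 // => l _; have [li|il] := leqP l i.
    by rewrite hX // mul0r.
  by rewrite IHk ?mulr0 // (leq_trans ji) // addnS -addSn leq_add2r.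
apply/matrixP => i j; rewrite [RHS]mxE; apply: pw.
by rewrite (leq_trans (ltn_ord j)) // leq_addl.
Qed.

Lemma N_upper z (i j : 'I_7) : (j <= i)%N -> N_ z i j = (i == j)%:R.
Proof.
rewrite mxE -val_eqE; move: i j.
by do 2 (apply: ord7P; case=> [|[|[|[|[|[|[|//]]]]]]] ?).
Qed.

Lemma N_unipotent z : unipotent (N_ z).
Proof.
exists 7%N; apply: strict_upper_nilpotent => i j ji.
have -> : (N_ z - 1) i j = N_ z i j - (i == j)%:R by rewrite !mxE.
by rewrite N_upper // subrr.
Qed.

Lemma mem_radical P U u : is_subgroup U -> U `<=` P -> zariski_closed U ->
  zariski_connected U -> (forall g, P g -> normalized U g) ->
  (forall g, P g -> g \is a GRing.unit /\ P g^-1) -> (forall n, U n -> unipotent n) ->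
  U u -> unipotent_radical P u.
Proof.
move=> sU UP cU kU nU Pu uU Uu; exists U => //; split=> // g n Pg Un.
have [ug Pg'] := Pu g Pg; have [n' Un' e] := nU _ Pg' n Un.
by rewrite -mulrA e mulVKr.
Qed.

Lemma normalized_generated S H : is_subgroup H ->
  (forall g, S g -> [/\ g \is a GRing.unit, normalized H g & normalized H g^-1]) ->
  forall g, generated S g -> normalized H g.
Proof.
move=> sH hS g hg.
pose T := [set g | [/\ g \is a GRing.unit, normalized H g & normalized H g^-1]].
have [] // : T g; apply: hg; split; last exact: hS.
split=> [h []//||h k [uh h1 h2] [uk k1 k2]|h [uh h1 h2]].
- by split; rewrite ?unitr1 ?invr1 // => n Hn; exists n; rewrite ?mulr1 ?mul1r.
- split; [by rewrite unitrMr | exact: normalizedM |].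
  by rewrite invrM //; apply: normalizedM.
- by split; rewrite ?unitrV ?invrK.
Qed.

Lemma Bplus_normalized H : is_subgroup H ->
  (forall t, (forall k, t k != 0) -> normalized H (tor t)) ->
  (forall i s, normalized H (x_ i s)) ->
  forall g, Bplus C g -> normalized H g.
Proof.
move=> sH nt nx; apply: normalized_generated => // g [[t t0 ->]|[i [s ->]]].
  split; [exact: tor_unit | exact: nt | rewrite tor_inv //; apply: nt; exact: invr_neq0_fun].
by split; [exact: x_unit | exact: nx | rewrite x_inv].
Qed.

Lemma parabolic_normalized j g : parabolic C j g -> normalized (NI j) g.
Proof.
have nB h : Bplus C h -> normalized (NI j) h.
  apply: Bplus_normalized; first exact: NI_subgroup.
    by move=> t; apply: tor_NI.
  by move=> i s; apply: x_norm_NI.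
move: g; apply: normalized_generated; first exact: NI_subgroup.
move=> h [Bh|[s _ <-]].
  have [u _ _ v] := Bplus_subgroup C.
  by split; [exact: (u h Bh) | exact: (nB h Bh) | exact: (nB _ (v h Bh))].
by split; [exact: y_unit | exact: y_norm_NI | rewrite y_inv; apply: y_norm_NI].
Qed.

Lemma subgroup_unit_inv P g : is_subgroup P -> P g -> g \is a GRing.unit /\ P g^-1.
Proof. by case=> u _ _ v Pg; split; [apply: u | apply: v]. Qed.

Lemma x_Bplus i s : Bplus C (x_ i s).
Proof. by apply: sub_generated; right; exists i, s. Qed.

Lemma Uplus_Bplus : @Uplus C `<=` Bplus C.
Proof. by apply: Uplus_generated; [apply: Bplus_subgroup | apply: x_Bplus]. Qed.

Lemma Bplus_parabolic j : Bplus C `<=` parabolic C j.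
Proof. by move=> g Bg; apply: sub_generated; left. Qed.

Lemma NI_radical j : NI j `<=` unipotent_radical (parabolic C j).
Proof.
move=> u; apply: mem_radical.
- exact: NI_subgroup.
- by move=> n /NI_Uplus/Uplus_Bplus/Bplus_parabolic.
- by apply: (@Ncoord_closed (j == i1)); case: (j == i1).
- exact: (@Ncoord_connected (j == i1)).
- exact: parabolic_normalized.
- by move=> g; apply: subgroup_unit_inv; apply: parabolic_subgroup.
- by move=> _ [z _ <-]; apply: N_unipotent.
Qed.

Lemma Uplus_radical : @Uplus C `<=` Nplus C.
Proof.
move=> u; apply: mem_radical.
- exact: Uplus_subgroup.
- exact: Uplus_Bplus.
- by rewrite Uplus_Ncoord; apply: Ncoord_closed.
- by rewrite Uplus_Ncoord; apply: Ncoord_connected.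
- apply: Bplus_normalized; first exact: Uplus_subgroup.
    by move=> t; apply: tor_Uplus.
  by move=> i s; apply: normalized_mem (Uplus_subgroup C) (x_Uplus i s).
- by move=> g; apply: subgroup_unit_inv; apply: Bplus_subgroup.
- by move=> _ [z _ <-]; apply: N_unipotent.
Qed.

Definition upper_triangular x := forall i j : 'I_7, (j < i)%N -> x i j = 0.

Lemma upper_triangularM x y : upper_triangular x -> upper_triangular y ->
  upper_triangular (x * y).
Proof.
move=> hx hy i j ji; rewrite mxE big1 // => k _; have [ki|ik] := ltnP k i.
  by rewrite hx ?mul0r.
by rewrite hy ?mulr0 // (leq_trans ji).
Qed.

Lemma upper_triangular_diag x y k : upper_triangular x -> upper_triangular y ->
  (x * y) k k = x k k * y k k.
Proof.
move=> hx hy; rewrite mxE (bigD1 k) //= big1 ?addr0 // => l lk.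
have [ki|ik] := ltnP l k; first by rewrite hx ?mul0r.
by rewrite hy ?mulr0 // ltn_neqAle eq_sym val_eqE lk.
Qed.

Lemma upper_triangular_N z : upper_triangular (N_ z).
Proof. by move=> i j ji; rewrite N_upper 1?ltnW // -val_eqE gtn_eqF. Qed.

Lemma upper_triangular_tor t : upper_triangular (tor t).
Proof. by move=> i j ji; rewrite !mxE -val_eqE gtn_eqF. Qed.

Lemma unipotent_diag x k : upper_triangular x -> unipotent x -> x k k = 1.
Proof.
move=> hx [m hm]; have hx1 : upper_triangular (x - 1).
  by move=> i j ji; rewrite !mxE hx // -val_eqE gtn_eqF // subrr.
have [up dg] : upper_triangular ((x - 1) ^+ m) /\ ((x - 1) ^+ m) k k = (x k k - 1) ^+ m.
  elim: {hm}m => [|m [IH1 IH2]].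
    by split=> [i j ji|]; rewrite !expr0 !mxE ?eqxx // -val_eqE gtn_eqF.
  rewrite !exprS; split; first exact: upper_triangularM.
  by rewrite upper_triangular_diag // IH2 !mxE eqxx.
move: dg; rewrite hm mxE => /esym/eqP; rewrite expf_eq0 => /andP[_].
by rewrite subr_eq0 => /eqP.
Qed.

(** A unipotent element of B+ is upper triangular with unit diagonal, so its torus part is 1. *)
Lemma Nplus_Uplus : Nplus C = @Uplus C.
Proof.
apply/seteqP; split=> [u [U [[sU UB] cU kU nU uU] Uu]|]; last exact: Uplus_radical.
have [t [n [t0 [z _ ez] eu]]] := Bplus_tor_Uplus (UB u Uu).
have tri := upper_triangularM (@upper_triangular_tor t) (@upper_triangular_N z).
have dg k : tor t k k = 1.
  have := unipotent_diag k (_ : upper_triangular u) (uU u Uu).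
  rewrite eu -ez upper_triangular_diag; try exact: upper_triangular_tor;
    try exact: upper_triangular_N.
  by rewrite N_upper // eqxx mulr1; apply.
exists z => //; rewrite eu -ez; have -> : tor t = 1; last by rewrite mul1r.
apply/matrixP => i j; have [->|ij] := eqVneq i j; first by rewrite dg mxE eqxx.
by rewrite !mxE (negbTE ij).
Qed.

End Radicals.

(** * The unipotent radical of P_j *)

Section ParabolicRadical.
Variable C : numClosedFieldType.
Implicit Types (x y g u n : 'M[C]_7) (j : 'I_2).

Lemma tr2 (X : 'M[C]_2) : \tr X = X i1 i1 + X i2 i2.
Proof.
rewrite /mxtrace !big_ord_recl big_ord0 addr0.
by have -> : lift ord0 ord0 = ord_max :> 'I_2 by apply/val_inj.
Qed.

Lemma det2 (X : 'M[C]_2) : \det X = X i1 i1 * X i2 i2 - X i1 i2 * X i2 i1.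
Proof.
have l0 : lift ord0 ord0 = ord_max :> 'I_2 by apply/val_inj.
have l1 : lift ord_max ord0 = ord0 :> 'I_2 by apply/val_inj.
rewrite (expand_det_row _ ord0) !big_ord_recl big_ord0 addr0 l0 /cofactor !det_mx11 !mxE.
by rewrite l0 l1 /=; ring.
Qed.

(** Once the determinant is 0, Cayley-Hamilton gives X^2 = tr(X) X, so X^(k + 1) = tr(X)^k X, and a
    nonzero trace would force X = 0. *)
Lemma nilpotent2 (X : 'M[C]_2) m : X ^+ m = 0 -> \tr X = 0 /\ \det X = 0.
Proof.
move=> Xm; have d0 : \det X = 0.
  have dX k : \det (X ^+ k) = \det X ^+ k.
    by elim: k => [|k IHk]; rewrite ?expr0 ?det1 // !exprS -IHk -det_mulmx.
  apply/eqP; move: (dX m); rewrite Xm => e.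
  have m0 : (0 < m)%N.
    by case: m Xm {e} => // /eqP; rewrite expr0 oner_eq0.
  have /esym/eqP : 0 = \det X ^+ m by rewrite -e det0.
  by rewrite expf_eq0 m0.
split=> //; apply/eqP/negPn/negP => t0.
have XX : X * X = \tr X *: X.
  have l0 : lift ord0 ord0 = ord_max :> 'I_2 by apply/val_inj.
  move: d0; rewrite det2 tr2 => d0.
  have e : X i1 i1 * X i2 i2 = X i1 i2 * X i2 i1 by apply: subr0_eq.
  apply/matrixP => i k; rewrite !mxE !big_ord_recl big_ord0 l0.
  elim/ord2P: i; elim/ord2P: k; [rewrite mulrDl|rewrite mulrDl|rewrite mulrDl|rewrite mulrDl]; ring: e.
have pw k : X ^+ k.+1 = \tr X ^+ k *: X.
  elim: k => [|k IHk]; first by rewrite expr0 scale1r.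
  by rewrite exprS IHk -scalerAr XX scalerA -exprSr.
case: m Xm => [/eqP|m]; first by rewrite expr0 oner_eq0.
rewrite pw => /eqP; rewrite scaler_eq0 expf_eq0 (negbTE t0) andbF /= => /eqP X0.
by move: t0; rewrite X0 mxtrace0 eqxx.
Qed.

Section Block.
Variable k0 : nat.
Hypothesis k0_le : (k0 <= 1)%N.

Definition level (i : nat) : nat := (k0 <= i) + (k0.+2 <= i).

(** The levels separate the indices below k0, the pair k0, k0 + 1, and the rest. With k0 = 0 for j =
    1 and k0 = 1 for j = 2 the pair carries the natural representation of the Levi subgroup. *)
Definition block_upper x := forall i c : 'I_7, (level c < level i)%N -> x i c = 0.

Definition idx (a : 'I_2) : 'I_7 := inord (k0 + a).

Definition block x : 'M[C]_2 := \matrix_(a, b) x (idx a) (idx b).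

Lemma val_idx a : idx a = (k0 + a)%N :> nat.
Proof. by rewrite inordK //; have := ltn_ord a; lia. Qed.

Lemma block_upperM x y : block_upper x -> block_upper y -> block_upper (x * y).
Proof.
move=> hx hy i c ci; rewrite mxE big1 // => l _.
have [li|il] := ltnP (level l) (level i); first by rewrite hx ?mul0r.
by rewrite hy ?mulr0 // (leq_trans ci).
Qed.

Lemma blockM x y : block_upper x -> block_upper y -> block (x * y) = block x * block y.
Proof.
move=> hx hy; apply/matrixP => a b; rewrite [RHS]mxE !big_ord_recl big_ord0 addr0 !mxE.
have -> : lift ord0 ord0 = ord_max :> 'I_2 by apply/val_inj.
rewrite (bigD1 (idx ord0)) //= (bigD1 (idx ord_max)) //=; last first.
  by rewrite -val_eqE /= !val_idx /=; lia.
rewrite big1 ?addr0 // => l /andP[l0 l1].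
rewrite -val_eqE /= val_idx /= in l0; rewrite -val_eqE /= val_idx /= in l1.
have [lk|kl] := ltnP l k0.
  rewrite hx ?mul0r // /level val_idx; have := ltn_ord a; move: lk; lia.
rewrite hy ?mulr0 // /level val_idx; have := ltn_ord b; lia.
Qed.

Lemma block1 : block 1 = 1.
Proof.
apply/matrixP => a b; by rewrite !mxE -!val_eqE /= !val_idx eqn_add2l.
Qed.

Lemma unipotent_block u : block_upper u -> unipotent u ->
  exists m, (block u - 1) ^+ m = 0.
Proof.
move=> hu [m hm]; exists m.
have hu1 : block_upper (u - 1).
  move=> i c ci; rewrite !mxE hu //; have [e|] := eqVneq i c; last by rewrite subr0.
  by rewrite e ltnn in ci.
have bB : block (u - 1) = block u - 1.
  by rewrite -block1; apply/matrixP => a b; rewrite !mxE.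
have [_ <-] : block_upper ((u - 1) ^+ m) /\ block ((u - 1) ^+ m) = (block u - 1) ^+ m.
  elim: {hm}m => [|m [IH1 IH2]].
    rewrite !expr0 block1; split=> // i c ci; rewrite mxE; case: eqP => // e.
    by rewrite e ltnn in ci.
  by rewrite !exprS; split; [apply: block_upperM | rewrite blockM // IH2 bB].
by rewrite hm; apply/matrixP => a b; rewrite !mxE.
Qed.

Lemma unipotent_block_trace u : block_upper u -> unipotent u ->
  \tr (block u) = 2 /\ \det (block u) = 1.
Proof.
move=> hu uu; have [m /nilpotent2[tr0 d0]] := unipotent_block hu uu.
have e : \tr (block u) = 2.
  by rewrite -[block u](subrK 1) mxtraceD tr0 add0r mxtrace1.
split=> //; move: d0 e; rewrite !det2 tr2 !mxE /=.
move: (u (idx i1) (idx i1)) (u (idx i2) (idx i2)) => a d d0 e.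
have {}e : d = 2 - a by rewrite -e; ring.
by rewrite e in d0 *; apply/eqP; rewrite -subr_eq0 -[X in _ == X]d0; apply/eqP; ring.
Qed.

End Block.


Definition k0_ j : nat := (j != i1).

Lemma k0_le j : (k0_ j <= 1)%N.
Proof. exact: leq_b1. Qed.

Notation bt j := (block_upper (k0_ j)).
Notation bl j := (block (k0_ j)).

Lemma block_upper_N j (z : seq C) : bt j (N_ z).
Proof.
move=> i c ci; have lt : (c < i)%N by move: ci; rewrite /level; lia.
by rewrite N_upper 1?ltnW // -val_eqE gtn_eqF.
Qed.

Lemma block_upper_rho j (al be ga de w : C) : bt j (rho j al be ga de w).
Proof.
move=> i c; rewrite mxE /rho_seq; elim/ord2P: j => /=; move: i c;
  by do 2 (apply: ord7P; case=> [|[|[|[|[|[|[|//]]]]]]] ?).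
Qed.

Lemma block_rho j (al be ga de w : C) : let B := bl j (rho j al be ga de w) in
  [/\ B i1 i1 = al, B i1 i2 = be, B i2 i1 = ga & B i2 i2 = de].
Proof. by elim/ord2P: j; rewrite /= !mxE /idx /= !inordK. Qed.

Lemma block_NI j n : NI j n -> bl j n = 1.
Proof.
case=> z /= zj <-; apply/matrixP => a b; rewrite [RHS]mxE mxE.
have [ba|ab] := leqP b a.
  rewrite N_upper; last by rewrite !val_idx ?k0_le // leq_add2l.
  by rewrite -val_eqE /= !val_idx ?k0_le // eqn_add2l.
have [-> ->] : a = i1 /\ b = i2.
  by move: a b ab; do 2 (apply: ord2P).
rewrite -[RHS]zj mxE /idx /k0_ !inordK; by elim/ord2P: j {zj}.
Qed.

Lemma block_upper_parabolic j g : parabolic C j g -> bt j g.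
Proof.
move=> /parabolic_levi[l [n [[al [be [ga [de [w [_ ->]]]]]] [z _ <-] ->]]].
by apply: block_upperM; [apply: block_upper_rho | apply: block_upper_N].
Qed.

Lemma mul2E (X Y : 'M[C]_2) a b : (X * Y) a b = X a i1 * Y i1 b + X a i2 * Y i2 b.
Proof.
rewrite mxE !big_ord_recl big_ord0 addr0.
by have -> : lift ord0 ord0 = ord_max :> 'I_2 by apply/val_inj.
Qed.

Lemma x_parabolic j i s : parabolic C j (x_ i s).
Proof. exact: (Bplus_parabolic (x_Bplus i s)). Qed.

Lemma y_parabolic j s : parabolic C j (y_ j s).
Proof. by apply: sub_generated; right; exists s. Qed.

(** Let B be the 2 x 2 block of u, an element of a normal unipotent subgroup, so tr B = 2 and det B
    = 1. For g = x_j(1) the product of u and its conjugate by g is again unipotent, and its block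
    has trace 2 - ga^2, so ga = 0. Likewise y_j(1) gives be = 0. Hence B = 1 and the Levi part of u
    is trivial. *)
Lemma radical_NI j : unipotent_radical (parabolic C j) = NI j.
Proof.
apply/seteqP; split=> [u|]; last exact: NI_radical.
case=> U [[[Uu U1 UM UV] UP] _ _ nU uU] Un.
have btU v : U v -> bt j v by move=> /UP/block_upper_parabolic.
have trB v : U v -> \tr (bl j v) = 2 /\ \det (bl j v) = 1.
  by move=> Uv; apply: (unipotent_block_trace (k0_le j)); [apply: btU | apply: uU].
have blM v v' : bt j v -> bt j v' -> bl j (v * v') = bl j v * bl j v'.
  exact: (blockM (k0_le j)).
have conj g g' : parabolic C j g -> g^-1 = g' -> bt j g' ->
    \tr (bl j u * (bl j g * bl j u * bl j g')) = 2.
  move=> Pg eg btg'; have Uc := nU _ _ Pg Un.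
  have [<- _] := trB _ (UM _ _ Un Uc).
  have btg := block_upper_parabolic Pg.
  rewrite blM ?eg ?blM //; try exact: btU; try by apply: block_upperM => //; exact: btU.
  by rewrite -eg; apply: btU.
have [tr1 dt1] := trB u Un.
have cx := conj _ _ (@x_parabolic j j 1) (x_inv j 1)
    (block_upper_parabolic (@x_parabolic j j (- 1))).
have cy := conj _ _ (@y_parabolic j 1) (y_inv j 1) (block_upper_parabolic (@y_parabolic j (- 1))).
have [l [n [[al [be [ga [de [w [dw el]]]]]] Nn eu]]] := parabolic_levi (UP u Un).
have bu : bl j u = bl j (rho j al be ga de w).
  rewrite eu el blM ?(block_NI Nn) ?mulr1 //; first exact: block_upper_rho.
  by case: Nn => z _ <-; apply: block_upper_N.
have [e11 e12 e21 e22] := block_rho j al be ga de w.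
have rx s := block_rho j 1 s 0 1 1; have ry s := block_rho j 1 0 s 1 1.
rewrite bu tr2 e11 e22 in tr1; rewrite bu det2 e11 e12 e21 e22 in dt1.
have [x11 x12 x21 x22] := rx 1; have [x11' x12' x21' x22'] := rx (- 1).
have [y11 y12 y21 y22] := ry 1; have [y11' y12' y21' y22'] := ry (- 1).
rewrite bu !x_E tr2 !mul2E e11 e12 e21 e22 x11 x12 x21 x22 x11' x12' x21' x22' in cx.
rewrite bu !y_E tr2 !mul2E e11 e12 e21 e22 y11 y12 y21 y22 y11' y12' y21' y22' in cy.
have deE : de = 2 - al by rewrite -tr1; ring.
have ga2 : ga ^+ 2 = 0.
  transitivity ((al + de) ^+ 2 - 2 * (al * de - be * ga) - 2); last by rewrite tr1 dt1; ring.
  by rewrite -[X in _ = _ - X]cx; ring.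
have be2 : be ^+ 2 = 0.
  transitivity ((al + de) ^+ 2 - 2 * (al * de - be * ga) - 2); last by rewrite tr1 dt1; ring.
  by rewrite -[X in _ = _ - X]cy; ring.
have ga0 : ga = 0 by apply/eqP; rewrite -sqrf_eq0 ga2.
have be0 : be = 0 by apply/eqP; rewrite -sqrf_eq0 be2.
have al1 : al = 1.
  apply/eqP; rewrite -subr_eq0 -sqrf_eq0; apply/eqP.
  by move: dt1; rewrite ga0 deE => e; rewrite -[RHS](subrr 1) -[X in _ = _ - X]e; ring.
have de1 : de = 1 by rewrite deE al1; ring.
have w1 : w = 1 by move: dw; rewrite dt1 mul1r.
by rewrite eu el al1 be0 ga0 de1 w1 rho_1 mul1r.
Qed.

End ParabolicRadical.

(** * The minors *)

Section Transpose.
Variable C : numClosedFieldType.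
Implicit Types (s : C) (t : 'I_2 -> C) (x y g u n : 'M[C]_7) (i j : 'I_2).
Implicit Types (S Z H P U : set 'M[C]_7).

Definition tset S : set 'M[C]_7 := [set x | S (theta x)].

Lemma tsetK S : tset (tset S) = S.
Proof. by apply/seteqP; split=> x; rewrite /tset /= thetaK. Qed.

Lemma theta_unit x : (theta x \is a GRing.unit) = (x \is a GRing.unit).
Proof.
have h y : y \is a GRing.unit -> theta y \is a GRing.unit.
  by move=> uy; case: (@unit_inv C (theta y) (theta y^-1)) => //; rewrite -thetaM mulVr ?theta1.
by apply/idP/idP => [/h|/h//]; rewrite thetaK.
Qed.

Lemma theta_inv x : x \is a GRing.unit -> theta x^-1 = (theta x)^-1.
Proof.
by move=> ux; case: (@unit_inv C (theta x) (theta x^-1)) => [|_ ->//];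
  rewrite -thetaM mulVr ?theta1.
Qed.

Lemma tset_subgroup H : is_subgroup H -> is_subgroup (tset H).
Proof.
case=> Hu H1 HM HV; split=> [x /Hu|||x Hx]; rewrite /tset /= ?theta_unit ?theta1 //.
  by move=> x y Hx Hy; rewrite thetaM; apply: HM.
by rewrite theta_inv; [apply: HV | rewrite -theta_unit; apply: Hu].
Qed.

Lemma theta_regular (X : set 'M[C]_7) (i j : 'I_7) : regular X (fun x => theta x i j).
Proof.
under eq_fun do rewrite mxE; have R := regular_ring X.
by apply: (fr_mul R);
    [apply: (fr_mul R); [exact: (fr_cst R) | exact: regular_entry] | exact: (fr_cst R)].
Qed.

Lemma tset_closed Z : zariski_closed Z -> zariski_closed (tset Z).
Proof.
case=> I ->.
have -> : tset [set x | x \is a GRing.unit /\ forall p, I p -> evalmx p x = 0]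
    = [set x | x \is a GRing.unit /\ forall p : {p | I p}, evalmx (sval p) (theta x) = 0].
  apply/seteqP; split=> x; rewrite /tset /= theta_unit => -[ux h]; split=> //.
    by case=> p Ip; apply: h.
  by move=> p Ip; apply: (h (exist _ p Ip)).
apply: zariski_closed_family => p.
by apply: (regular_comp (Y := setT) (h := @theta C)) => // [i j|];
  [apply: theta_regular | exists (sval p)].
Qed.

Lemma tset_connected Z : zariski_connected Z -> zariski_connected (tset Z).
Proof.
move=> cZ A B cA cB AB AB0.
have : tset A = set0 \/ tset B = set0.
  apply: cZ; try exact: tset_closed.
    by rewrite -[RHS]tsetK -AB.
  by rewrite -[LHS]/(tset (A `&` B)) AB0.
by case=> e; [left|right]; rewrite -[LHS]tsetK e.
Qed.

Lemma tset_unipotent u : unipotent (theta u) -> unipotent u.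
Proof.
case=> m hm; exists m; have -> : u - 1 = theta (theta u - 1).
  rewrite -[u in LHS]thetaK -[in LHS]theta1.
  by apply/matrixP => i j; rewrite !mxE; ring.
have thX k x : theta x ^+ k = theta (x ^+ k).
  elim: k => [|k IHk]; first by rewrite !expr0 theta1.
  by rewrite exprSr exprS IHk -thetaM.
by rewrite thX hm; apply/matrixP => i j; rewrite !mxE mulr0 mul0r.
Qed.

Lemma tset_radical P : is_subgroup P ->
  tset (unipotent_radical P) `<=` unipotent_radical (tset P).
Proof.
move=> [Pu _ _ PV] u [U [[sU UP] cU kU nU uU] Uu]; exists (tset U) => //; split.
- by split; [apply: tset_subgroup | move=> x; apply: UP].
- exact: tset_closed.
- exact: tset_connected.
- move=> p v Pp Uv; rewrite /tset /= thetaM thetaM.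
  have up : p \is a GRing.unit by rewrite -theta_unit; apply: Pu.
  (* The anti-automorphism turns conjugation by p into conjugation by the inverse of theta p. *)
  rewrite theta_inv // mulrA; have := nU _ _ (PV _ Pp) Uv.
  by rewrite invrK.
- by move=> v /uU; apply: tset_unipotent.
Qed.

Lemma Bminus_tset : Bminus C = tset (Bplus C).
Proof.
have Bm_gens_unit g : borel_gens (@y_ C) g -> g \is a GRing.unit.
  by case=> [[t t0 ->]|[i [s ->]]]; [apply: tor_unit | apply: y_unit].
have sBm : is_subgroup (Bminus C) by apply: generated_subgroup => g; apply: Bm_gens_unit.
apply/seteqP; split.
  apply: generated_sub; first exact/tset_subgroup/Bplus_subgroup.
  move=> _ [[t t0 ->]|[i [s ->]]]; rewrite /tset /=.
    by rewrite theta_tor; apply: sub_generated; left; exists t.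
  by rewrite -theta_x thetaK; apply: x_Bplus.
have h : Bplus C `<=` tset (Bminus C).
  apply: generated_sub; first exact: tset_subgroup.
  move=> _ [[t t0 ->]|[i [s ->]]]; rewrite /tset /=.
    by rewrite theta_tor; apply: sub_generated; left; exists t.
  by rewrite theta_x; apply: sub_generated; right; exists i, s.
by move=> x /h; rewrite /tset /= thetaK.
Qed.

Lemma Nminus_tset : Nminus C = tset (@Uplus C).
Proof.
rewrite /Nminus Bminus_tset -Nplus_Uplus; have sB := Bplus_subgroup C.
apply/seteqP; split; last exact: tset_radical.
move=> u hu; have := tset_radical (tset_subgroup sB); rewrite tsetK.
by apply; rewrite /tset /= thetaK.
Qed.

Definition G2_gens : set 'M[C]_7 :=
  [set g | exists (i : 'I_2) (t : C), g = x_ i t \/ g = y_ i t].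

Lemma G2_gens_unit g : G2_gens g -> g \is a GRing.unit.
Proof. by case=> i [s [->|->]]; [apply: x_unit | apply: y_unit]. Qed.

Lemma G2_subgroup : is_subgroup (G2 C).
Proof. by apply: generated_subgroup => g; apply: G2_gens_unit. Qed.

Lemma G2_x i s : G2 C (x_ i s).
Proof. by apply: sub_generated; exists i, s; left. Qed.

Lemma G2_y i s : G2 C (y_ i s).
Proof. by apply: sub_generated; exists i, s; right. Qed.

Lemma G2M x y : G2 C x -> G2 C y -> G2 C (x * y).
Proof. by case: G2_subgroup => _ _ m _; apply: m. Qed.

Lemma G2_1 : G2 C 1.
Proof. by case: G2_subgroup. Qed.

Lemma G2_theta x : G2 C x -> G2 C (theta x).
Proof.
move: x; apply: (@generated_sub C G2_gens (tset (G2 C))).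
  exact/tset_subgroup/G2_subgroup.
move=> _ [i [s [->|->]]]; rewrite /tset /=; first by rewrite theta_x; apply: G2_y.
by rewrite -theta_x thetaK; apply: G2_x.
Qed.

Lemma G2_Uplus x : Uplus x -> G2 C x.
Proof. exact: (Uplus_generated G2_subgroup (fun i s => @G2_x i s)). Qed.

Lemma G2_Nminus x : Nminus C x -> G2 C x.
Proof. by rewrite Nminus_tset /tset /= => /G2_Uplus/G2_theta; rewrite thetaK. Qed.

Definition tor_ i (c : C) := tor (fun k => if k == i then c else 1).

Lemma tor_neq0 i (c : C) : c != 0 -> forall k, (if k == i then c else 1) != 0.
Proof. by move=> c0 k; case: (k == i); rewrite ?oner_eq0. Qed.

Lemma tor_rho i (c : C) : c != 0 -> tor_ i c = rho i c 0 0 c^-1 1.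
Proof.
move=> c0; rewrite /tor_; elim/ord2P: i; [rewrite tor_rho1 | rewrite tor_rho2];
  try exact: tor_neq0; by rewrite /= ?invr1 ?expr1n ?mulr1 ?mul1r ?divr1.
Qed.

Lemma G2_tor t : (forall k, t k != 0) -> G2 C (tor t).
Proof.
move=> t0; have -> : tor t = tor_ i1 (t i1) * tor_ i2 (t i2).
  rewrite torM; congr tor; apply/funext => k.
  by elim/ord2P: k => /=; rewrite ?mulr1 ?mul1r.
have h i (c : C) : c != 0 -> G2 C (tor_ i c).
  move=> c0.
  (* With n(c) = x_i(c) y_i(-1/c) x_i(c) this is the classical expression n(c) n(1)^-1 of the
     coroot. *)
  have -> : tor_ i c = x_ i c * y_ i (- c^-1) * x_ i c * (x_ i (-1) * y_ i 1 * x_ i (-1)).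
    by rewrite tor_rho // !x_E !y_E !rho_mul; congr rho; field.
  exact: (G2M (G2M (G2M (G2_x _ _) (G2_y _ _)) (G2_x _ _))
    (G2M (G2M (G2_x _ _) (G2_y _ _)) (G2_x _ _))).
by exact: (G2M (h _ _ (t0 _)) (h _ _ (t0 _))).
Qed.

Definition big_cell : set 'M[C]_7 := [set x | exists u t v,
  [/\ Nminus C u, forall k, t k != 0, Uplus v & x = u * tor t * v]].

Lemma Nminus_subgroup : is_subgroup (Nminus C).
Proof. by rewrite Nminus_tset; apply/tset_subgroup/Uplus_subgroup. Qed.

Lemma tor_y_Nminus t i s : (forall k, t k != 0) ->
  exists2 u, Nminus C u & tor t * y_ i s = u * tor t.
Proof.
move=> t0; have [n Un e] := tor_Uplus t0 (x_Uplus i s).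
exists (theta n); first by rewrite Nminus_tset /tset /= thetaK.
by rewrite -{1}theta_tor -theta_x -thetaM e thetaM theta_tor.
Qed.

Lemma Uplus_NI_x i v : Uplus v -> exists n s, NI i n /\ v = n * x_ i s.
Proof.
case=> z _ <-.
have NK w i' s : N_ z * x_ i' (- s) = w -> N_ z = w * x_ i' s.
  by move=> <-; rewrite -[x_ i' s]invrK x_inv mulrK // x_unit.
elim/ord2P: i.
  have [z' [e _ z1]] := N_mul_coords z [:: 0; - nth 0 z 1; 0; 0; 0; 0].
  exists (N_ z'), (nth 0 z 1); split; first by exists z' => //=; rewrite z1 subrr.
  by apply: NK; rewrite N_x1.
have [z' [e z0 _]] := N_mul_coords z [:: - nth 0 z 0; 0; 0; 0; 0; 0].
exists (N_ z'), (nth 0 z 0); split; first by exists z' => //=; rewrite z0 subrr.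
by apply: NK; rewrite N_x2.
Qed.

(** The factorization of a 2 x 2 matrix with upper left entry c into lower unipotent, diagonal and
    upper unipotent factors. *)
Lemma xy_exchange i (a s : C) : 1 + a * s != 0 -> let c := 1 + a * s in
  x_ i a * y_ i s = y_ i (s / c) * tor_ i c * x_ i (a / c).
Proof. by move=> c0 c; rewrite tor_rho // !x_E !y_E !rho_mul /c; congr rho; field. Qed.

Lemma big_cell_x x i s : big_cell x -> big_cell (x * x_ i s).
Proof.
case=> u [t [v [Nu t0 Uv ->]]]; exists u, t, (v * x_ i s); split=> //; last by rewrite mulrA.
by have [_ _ m _] := Uplus_subgroup C; apply: m => //; apply: x_Uplus.
Qed.

(** Write v = n x_i(a). The factors of x_i(a) y_i(s) are moved into place past n and t by normality,
    so on each line s |-> x y_i(s) only the zeros of 1 + a s are excluded. *)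
Lemma big_cell_y x i : big_cell x ->
  exists a : C, forall s, 1 + a * s != 0 -> big_cell (x * y_ i s).
Proof.
case=> u [t [v [Nu t0 /(Uplus_NI_x i)[n [a [Nn ev]]] ->]]]; exists a => s c0.
have e := xy_exchange i c0; set c := 1 + a * s in c0 e.
have [n1 Nn1 e1] := y_norm_NI (s / c) Nn.
have [u1 Nu1 e2] := tor_y_Nminus i (s / c) t0.
have [n2 Nn2 e3] := tor_NI (tor_neq0 i c0) Nn1.
exists (u * u1), (fun k => t k * (if k == i then c else 1)), (n2 * x_ i (a / c)); split.
- by case: Nminus_subgroup => _ _ m _; apply: m.
- by move=> k; rewrite mulf_neq0 // tor_neq0.
- have [_ _ m _] := Uplus_subgroup C; apply: m; last exact: x_Uplus.
  exact: NI_Uplus Nn2.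
- rewrite ev -torM -!mulrA e -!mulrA (mulrA n) e1 -!mulrA (mulrA n1) e3 (mulrA (tor t)) e2.
  by rewrite -!mulrA.
Qed.

Lemma pfun_mulmx_y x i : forall k l, @pfun C 1 (fun v => (x * y_ i (v ord0)) k l).
Proof.
move=> k l; have R := pfun_ring C 1; under eq_fun do rewrite mxE.
apply: (fr_sum R) => h; apply: (fr_mul R); first exact: (fr_cst R).
under eq_fun do rewrite y_E mxE /rho_seq; move: h l.
elim/ord2P: i => /=; do 2 (apply: ord7P; case=> [|[|[|[|[|[|[|//]]]]]]] ?); rewrite /=;
  repeat first [exact: (fr_cst R) | exact: pfun_var | apply: (fr_add R) | apply: (fr_mul R)
    | apply: (fr_opp R) | apply: (fr_exp R)].
Qed.

(* N^- H N^+ is dense in G: its closure is stable under right multiplication by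
   the generators. *)
Lemma big_cell_dense p : (forall x, big_cell x -> evalmx p x = 0) ->
  forall x, G2 C x -> evalmx p x = 0.
Proof.
pose Z := [set x : 'M[C]_7 | forall p, (forall y, big_cell y -> evalmx p y = 0) -> evalmx p x = 0].
have bc1 : big_cell 1.
  exists 1, (fun=> 1), 1; rewrite tor1 !mulr1; split=> //.
  - by case: Nminus_subgroup.
  - by move=> k; rewrite oner_eq0.
  - by case: (Uplus_subgroup C).
have right g x : Z x -> (forall p, (forall y, big_cell y -> evalmx p y = 0) ->
    forall y, big_cell y -> evalmx p (y * g) = 0) -> Z (x * g).
  move=> Zx hg q hq; have [r hr] : regular setT (evalmx q \o (fun y => y * g)).
    apply: (regular_comp (Y := setT)) => // [k l|]; last by exists q.
    by under eq_fun do rewrite -[_ * g]mul1r mulrA; apply: regular_mull_mulr.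
  rewrite -[LHS]/((evalmx q \o (fun y => y * g)) x) hr //; apply: Zx => y By.
  by rewrite -hr //=; apply: hg.
have Zx x i s : Z x -> Z (x * x_ i s).
  by move=> hx; apply: right hx _ => q hq y By; apply: hq; apply: big_cell_x.
have Zy x i s : Z x -> Z (x * y_ i s).
  move=> hx; apply: right hx _ => q hq y By; have [a ha] := big_cell_y i By.
  have R := pfun_ring C 1.
  (* The value is polynomial in s and vanishes wherever 1 + a s does not, hence for all s. *)
  have : forall v : 'I_1 -> C, evalmx q (y * y_ i (v ord0)) = 0.
    apply: (@pfun_mul_eq0 C 1 (fun v => 1 + a * v ord0)).
    - apply: (fr_add R); first exact: (fr_cst R).
      by apply: (fr_mul R); [exact: (fr_cst R) | exact: pfun_var].
    - exact: (evalmx_pfun q (pfun_mulmx_y y i)).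
    - move=> v; have [->|c0] := eqVneq (1 + a * v ord0) 0; first by rewrite mul0r.
      by rewrite hq ?mulr0 //; apply: ha.
    - by exists (fun=> 0) => /eqP; rewrite mulr0 addr0 oner_eq0.
  by move/(_ (fun=> s)).
move=> hp x Gx; suff : Z x by apply.
rewrite -[x]mul1r; have Z1 : Z 1 by move=> q; apply.
apply: (@generated_stable C G2_gens Z _ _ x Gx 1 Z1) => [h|h y]; first exact: G2_gens_unit.
case=> i [s [->|->]] hy.
  by rewrite x_inv; split; apply: Zx.
by rewrite y_inv; split; apply: Zy.
Qed.

End Transpose.

(** * Generalized minors as linear and alternating forms in the rows *)

Section Minors.
Variable C : numClosedFieldType.
Implicit Types (s c : C) (t : 'I_2 -> C) (x y g u v M W : 'M[C]_7).

Notation k1 := (inord 1 : 'I_7).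

(** Degree 4 suffices: a 2 x 2 minor of x y_i(t) is bilinear in two rows, each of them quadratic in
    t. *)
Lemma derive1_quartic (c0 c1 c2 c3 c4 : C) :
  derive1 (fun t : C => c0 + c1 * t + c2 * t ^+ 2 + c3 * t ^+ 3 + c4 * t ^+ 4) 0 = c1.
Proof.
have hX n : is_derive (0 : C) (1 : C) (id ^+ n : C -> C) ((n%:R * 0 ^+ n.-1) *: (1 : C)).
  exact: is_deriveX.
have hZ (c : C) n : is_derive (0 : C) (1 : C) (c *: (id ^+ n : C -> C))
    (c *: ((n%:R * 0 ^+ n.-1) *: (1 : C))).
  exact: is_deriveZ.
have h := is_deriveD (is_deriveD (is_deriveD (is_deriveD
  (is_derive_cst c0 (0 : C) (1 : C)) (hZ c1 1%N)) (hZ c2 2%N)) (hZ c3 3%N)) (hZ c4 4%N).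
rewrite derive1E.
have -> : (fun t : C => c0 + c1 * t + c2 * t ^+ 2 + c3 * t ^+ 3 + c4 * t ^+ 4)
    = cst c0 + c1 *: (id ^+ 1) + c2 *: (id ^+ 2) + c3 *: (id ^+ 3) + c4 *: (id ^+ 4).
  by apply/funext => t; rewrite !fctE.
rewrite (@derive_val _ _ _ _ _ _ _ h).
rewrite /= !expr0n /= !mulr0 !scale0r !scaler0 !addr0 add0r.
by rewrite mulr1 scale1r -[RHS]mulr1.
Qed.

(* The generalized minors of level omega_1 are linear in row 0 of x, those of
   level omega_2 are alternating bilinear in its rows 0 and 1. *)
Definition lin M x := (x * M) 0 0.
Definition alt W x := (x * W * x^T) 0 k1.

Lemma altE W x : alt W x = \sum_k \sum_l x 0 k * W k l * x k1 l.
Proof.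
rewrite /alt !mxE exchange_big /=; apply: eq_bigr => l _.
by rewrite !mxE mulr_suml; apply: eq_bigr.
Qed.

Lemma lin_mul M x y : lin M (x * y) = lin (y * M) x.
Proof. by rewrite /lin mulrA. Qed.

Lemma alt_mul W x y : alt W (x * y) = alt (y * W * y^T) x.
Proof. by rewrite /alt trmx_mul !mulrA. Qed.

Lemma linD M M' x : lin (M + M') x = lin M x + lin M' x.
Proof. by rewrite /lin mulrDr mxE. Qed.

Lemma linZ c M x : lin (c *: M) x = c * lin M x.
Proof. by rewrite /lin -scalerAr mxE. Qed.

Lemma altD W W' x : alt (W + W') x = alt W x + alt W' x.
Proof. by rewrite /alt mulrDr mulrDl mxE. Qed.

Lemma altZ c W x : alt (c *: W) x = c * alt W x.
Proof. by rewrite /alt -scalerAr -scalerAl mxE. Qed.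

Lemma f_cube i : f_ C i * f_ C i * f_ C i = 0.
Proof.
rewrite f_E -mx7_0 !mulmx7; elim/ord2P: i; rewrite /fseq /=.
  entries ltac:(ring).
entries ltac:(ring).
Qed.

Lemma y_expand i s : y_ i s = 1 + s *: f_ C i + (s ^+ 2 / 2) *: (f_ C i * f_ C i).
Proof.
have h : s *: f_ C i * (s *: f_ C i) = s ^+ 2 *: (f_ C i * f_ C i).
  by rewrite -scalerAl -scalerAr scalerA -expr2.
rewrite /y_ exp_nil3 h ?scalerA; first by rewrite [2^-1 * _]mulrC.
by rewrite -scalerAl -scalerAr f_cube !scaler0.
Qed.

Lemma dagger_lin i f M : (forall x, G2 C x -> f x = lin M x) ->
  forall x, G2 C x -> dagger (f_ C i) f x = lin (f_ C i * M) x.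
Proof.
move=> hf x Gx; rewrite /dagger; set F := f_ C i.
rewrite -(derive1_quartic (lin M x) (lin (F * M) x) (2^-1 * lin (F * F * M) x) 0 0).
congr (derive1 _ 0); apply/funext => s.
rewrite -/(y_ i s) hf; last by apply: G2M => //; apply: G2_y.
rewrite lin_mul y_expand -/F.
have -> : (1 + s *: F + (s ^+ 2 / 2) *: (F * F)) * M
    = M + s *: (F * M) + (s ^+ 2 / 2) *: (F * F * M).
  by rewrite !mulrDl mul1r !scalerAl.
by rewrite !linD (linZ s) (linZ (s ^+ 2 / 2)) /=; field.
Qed.

(** f_i acts as a derivation on the tensor W. The forms [W1], ..., [W4] are the coefficients of the
    quartic in s that y_i(s) produces. *)
Lemma dagger_alt i f W : (forall x, G2 C x -> f x = alt W x) ->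
  forall x, G2 C x -> dagger (f_ C i) f x = alt (f_ C i * W + W * (f_ C i)^T) x.
Proof.
move=> hf x Gx; rewrite /dagger; set F := f_ C i.
pose W1 := F * W + W * F^T.
pose W2 := 2^-1 *: (F * F * W) + 2^-1 *: (W * (F * F)^T) + F * W * F^T.
pose W3 := 2^-1 *: (F * F * W * F^T) + 2^-1 *: (F * W * (F * F)^T).
pose W4 := (2^-1 * 2^-1) *: (F * F * W * (F * F)^T).
rewrite -/W1 -(derive1_quartic (alt W x) (alt W1 x) (alt W2 x) (alt W3 x) (alt W4 x)).
congr (derive1 _ 0); apply/funext => s.
rewrite -/(y_ i s) hf; last by apply: G2M => //; apply: G2_y.
rewrite alt_mul y_expand -/F.
have -> : (1 + s *: F + (s ^+ 2 / 2) *: (F * F))^T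
    = 1 + s *: F^T + (s ^+ 2 / 2) *: (F * F)^T.
  by rewrite !linearD !linearZ /= trmx1.
move: (F * F) (F * F)^T F^T @W1 @W2 @W3 @W4 => F2 F2t Ft W1 W2 W3 W4.
have -> : (1 + s *: F + (s ^+ 2 / 2) *: F2) * W * (1 + s *: Ft + (s ^+ 2 / 2) *: F2t)
    = W + s *: W1 + s ^+ 2 *: W2 + s ^+ 3 *: W3 + s ^+ 4 *: W4.
  rewrite /W1 /W2 /W3 /W4 !mulrDl !mul1r !mulrDr !mulr1 !scalerDr.
  have ZZ (a b : C) (X Y : 'M[C]_7) : (a *: X) * W * (b *: Y) = (a * b) *: (X * W * Y).
    by rewrite -!scalerAl -scalerAr scalerA.
  rewrite !ZZ; have Zr (b : C) (Y : 'M[C]_7) : W * (b *: Y) = b *: (W * Y) by rewrite -scalerAr.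
  have Zl (b : C) (Y : 'M[C]_7) : (b *: Y) * W = b *: (Y * W) by rewrite -scalerAl.
  rewrite !Zr !Zl !scalerA.
  move: (F * W * Ft) (F * W * F2t) (F2 * W * Ft) (F2 * W * F2t) (F * W) (F2 * W)
    (W * Ft) (W * F2t) => E1 E2 E3 E4 E5 E6 E7 E8.
  by apply/matrixP => k l; rewrite !mxE; field.
move: W1 W2 W3 W4 => W1 W2 W3 W4.
by rewrite !altD (altZ s) (altZ (s ^+ 2)) (altZ (s ^+ 3)) (altZ (s ^+ 4)) /=; ring.
Qed.

Definition W0 : 'M[C]_7 := mx7 [:: [:: 0; 1; 0; 0; 0; 0; 0]; [:: -1; 0; 0; 0; 0; 0; 0];
  [:: 0; 0; 0; 0; 0; 0; 0]; [:: 0; 0; 0; 0; 0; 0; 0]; [:: 0; 0; 0; 0; 0; 0; 0];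
  [:: 0; 0; 0; 0; 0; 0; 0]; [:: 0; 0; 0; 0; 0; 0; 0]].

(** $V_{\omega_2}$ is the component of the exterior square generated by e_0 /\ e_1, whose weight is
    $2\omega_1 - \alpha_1 = \omega_2$; so its highest minor is the principal 2 x 2 minor. *)
Definition Dfun (i : 'I_2) x := if i == i1 then lin 1 x else alt W0 x.

Lemma Nminus_row0 u x j : Nminus C u -> (u * x) 0 j = x 0 j.
Proof.
rewrite Nminus_tset => -[z _ ez]; have eu : u = theta (N_ z) by rewrite ez thetaK.
rewrite mxE (bigD1 0) //= big1 ?addr0 => [|k k0].
  by rewrite eu mxE N_upper // mulr1 divff ?mul1r // thetaD_neq0.
rewrite eu mxE N_upper // -val_eqE /=; case: (nat_of_ord k) (k0 : nat_of_ord k != 0%N) => // l _.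
by rewrite mulr0 !mul0r.
Qed.

Lemma Nminus_row1 u x j : Nminus C u -> (u * x) k1 j = u k1 0 * x 0 j + x k1 j.
Proof.
rewrite Nminus_tset => -[z _ ez]; have eu : u = theta (N_ z) by rewrite ez thetaK.
have k1E : k1 = 1%N :> nat by rewrite inordK.
rewrite mxE (bigD1 0) //= (bigD1 k1) //= ?big1 ?addr0 => [|k /andP[k0 kk]|].
- by congr (_ + _); rewrite eu mxE N_upper // eqxx mulr1 divff ?mul1r // thetaD_neq0.
- have lt : (1 < k)%N.
    by move: k0 kk; rewrite -!val_eqE /= k1E; case: (nat_of_ord k) => [|[]].
  rewrite eu mxE N_upper ?k1E 1?ltnW // -val_eqE /= k1E gtn_eqF //.
  by rewrite mulr0 !mul0r.
- by rewrite -val_eqE /= k1E.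
Qed.

Lemma tor_row t x i j : (tor t * x) i j = tor t i i * x i j.
Proof.
rewrite mxE (bigD1 i) //= big1 ?addr0 // => k ki.
by rewrite [tor t i k]mxE eq_sym (negbTE ki) mulr0n mul0r.
Qed.

Lemma tor_00 t : tor t 0 0 = t i1.
Proof. by rewrite tor_E mxE. Qed.

Lemma tor_11 t : tor t k1 k1 = t i2 / t i1.
Proof. by rewrite tor_E mxE !inordK. Qed.

Lemma lin_semi u t M x : Nminus C u -> lin M (u * tor t * x) = t i1 * lin M x.
Proof. by move=> Nu; rewrite /lin -!mulrA Nminus_row0 // tor_row tor_00. Qed.

Lemma lin0 W x : W^T = - W -> \sum_k \sum_l x 0 k * W k l * x 0 l = 0.
Proof.
move=> Wa; set S := LHS; have : S = - S.
  rewrite {1}/S exchange_big /= -sumrN; apply: eq_bigr => k _.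
  rewrite -sumrN; apply: eq_bigr => l _.
  by move/matrixP/(_ k l): Wa; rewrite !mxE => ->; ring.
by move/eqP; rewrite -subr_eq0 opprK -mulr2n mulrn_eq0 /= => /eqP.
Qed.

(** Lower unipotent elements add to row 1 a multiple of row 0, which an alternating form does not
    see; the torus scales the rows by t_1 and t_2 / t_1. *)
Lemma alt_semi u t W x : W^T = - W -> Nminus C u -> (forall k, t k != 0) ->
  alt W (u * tor t * x) = t i2 * alt W x.
Proof.
move=> Wa Nu t0; rewrite !altE.
have r0 k : (u * tor t * x) 0 k = t i1 * x 0 k by rewrite -mulrA Nminus_row0 // tor_row tor_00.
have r1 k : (u * tor t * x) k1 k = u k1 0 * t i1 * x 0 k + t i2 / t i1 * x k1 k.
  by rewrite -mulrA Nminus_row1 // !tor_row tor_00 tor_11 mulrA.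
transitivity (u k1 0 * t i1 ^+ 2 * (\sum_k \sum_l x 0 k * W k l * x 0 l)
    + t i2 * (\sum_k \sum_l x 0 k * W k l * x k1 l)); last by rewrite lin0 // mulr0 add0r.
rewrite !mulr_sumr -big_split; apply: eq_bigr => k _ /=.
rewrite !mulr_sumr -big_split; apply: eq_bigr => l _ /=.
rewrite r0 r1; field; exact: t0.
Qed.

Lemma W0_antisym : W0^T = - W0.
Proof.
apply/matrixP; do 2 (apply: ord7P; case=> [|[|[|[|[|[|[|//]]]]]]] ?);
  by rewrite !mxE /= ?oppr0 ?opprK.
Qed.

Lemma alt_W0 x : alt W0 x = x 0 0 * x k1 k1 - x 0 k1 * x k1 0.
Proof.
have k0E : ord0 = 0 :> 'I_7 by [].
have kE : lift ord0 ord0 = k1 :> 'I_7 by apply/val_inj; rewrite /= inordK.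
rewrite altE !big_ord_recl !big_ord0 !mxE /= !kE !k0E; ring.
Qed.

Lemma Dfun_Uplus i v : Uplus v -> Dfun i v = 1.
Proof.
case=> z _ <-; rewrite /Dfun; case: ifP => _.
  by rewrite /lin mulr1 mxE.
by rewrite alt_W0 !mxE !inordK //=; ring.
Qed.

Lemma regular_lin (X : set 'M[C]_7) M : regular X (lin M).
Proof.
have := @regular_mull_mulr C X 1 M 0 0.
by apply: eq_regular => x _; rewrite mul1r.
Qed.

Lemma regular_alt (X : set 'M[C]_7) W : regular X (alt W).
Proof.
have R := regular_ring X.
have : regular X (fun x => \sum_k \sum_l x 0 k * W k l * x k1 l).
  apply: (fr_sum R) => k; apply: (fr_sum R) => l.
  apply: (fr_mul R); last exact: regular_entry.
  by apply: (fr_mul R); [exact: regular_entry | exact: (fr_cst R)].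
by apply: eq_regular => x _; rewrite altE.
Qed.

Lemma is_Delta_Dfun i : is_Delta i (Dfun i).
Proof.
split=> [|u v t Nu].
  by rewrite /Dfun; elim/ord2P: i => /=; [apply: regular_lin | apply: regular_alt].
rewrite Nplus_Uplus => Uv t0; have := Dfun_Uplus i Uv.
rewrite /Dfun; elim/ord2P: i => /= e.
  by rewrite lin_semi // e mulr1.
by rewrite alt_semi // ?e ?mulr1 //; apply: W0_antisym.
Qed.

Lemma is_Delta_unique i f h : is_Delta i f -> is_Delta i h ->
  forall x, G2 C x -> f x = h x.
Proof.
case=> rf hf [rh hh] x Gx; have R := regular_ring (G2 C).
have [p hp] := fr_add R rf (fr_opp R rh).
apply/eqP; rewrite -subr_eq0 hp //; apply/eqP; apply: (@big_cell_dense C p _ x Gx).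
move=> _ [u [t [v [Nu t0 Uv ->]]]].
rewrite -hp; last by apply: G2M; [apply: G2M; [apply: G2_Nminus | apply: G2_tor] | apply: G2_Uplus].
by rewrite hf ?hh ?Nplus_Uplus // subrr.
Qed.

Lemma Delta_E i x : G2 C x -> Delta i x = Dfun i x.
Proof.
move=> Gx; apply: is_Delta_unique (is_Delta_Dfun i) _ Gx.
exact: (@xgetPex _ (cst 0) [set f | is_Delta i f] (ex_intro _ _ (is_Delta_Dfun i))).
Qed.

End Minors.

(** * The functions of the seed for i = 1 *)

Section SeedFunctions.
Variable C : numClosedFieldType.
Implicit Types (s c : C) (t : 'I_2 -> C) (x y g u v M W : 'M[C]_7) (f h : 'M[C]_7 -> C).
Implicit Types (w : seq 'I_2).

Lemma G2_wbar w : G2 C (wbar C w).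
Proof.
rewrite /wbar; elim/big_rec: _ => [|i x _ hx]; first exact: G2_1.
apply: (G2M _ hx); exact: (G2M (G2M (G2_x _ _) (G2_y _ _)) (G2_x _ _)).
Qed.

Lemma DeltaW_lin w x : G2 C x -> DeltaW i1 w x = lin (wbar C w) x.
Proof.
move=> Gx; rewrite /DeltaW Delta_E; last by apply: (G2M Gx); apply: G2_wbar.
by rewrite /Dfun /= lin_mul mulr1.
Qed.

Lemma DeltaW_alt w x : G2 C x ->
  DeltaW i2 w x = alt (wbar C w * W0 C * (wbar C w)^T) x.
Proof.
move=> Gx; rewrite /DeltaW Delta_E; last by apply: (G2M Gx); apply: G2_wbar.
by rewrite /Dfun /= alt_mul.
Qed.

Section Homogeneous.
Variable i : 'I_2.

Lemma V_mul n m f h : V_ i n f -> V_ i m h -> V_ i (n + m) (f * h).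
Proof.
case=> rf ef [rh eh]; split; first exact: (fr_mul (regular_ring _) rf rh).
move=> u x t Nu Gx t0; rewrite -[LHS]/(f (u * tor t * x) * h (u * tor t * x)).
rewrite ef // eh // exprD -[X in _ = _ * X]/(f x * h x); ring.
Qed.

Lemma V_add n f h : V_ i n f -> V_ i n h -> V_ i n (f + h).
Proof.
case=> rf ef [rh eh]; split; first exact: (fr_add (regular_ring _) rf rh).
move=> u x t Nu Gx t0; rewrite -[LHS]/(f (u * tor t * x) + h (u * tor t * x)).
by rewrite ef // eh // -mulrDr.
Qed.

Lemma V_opp n f : V_ i n f -> V_ i n (- f).
Proof.
case=> rf ef; split; first exact: (fr_opp (regular_ring _) rf).
move=> u x t Nu Gx t0; rewrite -[LHS]/(- f (u * tor t * x)).
by rewrite ef // -mulrN.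
Qed.

Lemma V_0 n : V_ i n (0 : 'M[C]_7 -> C).
Proof.
split=> [|u x t _ _ _]; first exact: (fr_cst (regular_ring _) 0).
by rewrite -[LHS]/(0 : C) -[X in _ = _ * X]/(0 : C) mulr0.
Qed.

Lemma A_of_V n f : V_ i n f -> A_ i f.
Proof.
move=> Vf; exists n.+1, (fun k => if k == n then f else 0); split=> [k|x Gx].
  by case: eqP => [->//|_]; apply: V_0.
rewrite (bigD1 ord_max) //= eqxx big1 ?addr0 // => k kn.
by rewrite -val_eqE /= in kn; rewrite (negbTE kn).
Qed.

End Homogeneous.

Lemma G2_cell u t x : Nminus C u -> (forall k, t k != 0) -> G2 C x -> G2 C (u * tor t * x).
Proof. by move=> Nu t0 Gx; apply: (G2M (G2M (G2_Nminus Nu) (G2_tor t0)) Gx). Qed.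

Lemma V_lin f M : (forall x, G2 C x -> f x = lin M x) -> V_ i1 1 f.
Proof.
move=> hf; split; first by apply: eq_regular (regular_lin _ M) => x /hf.
move=> u x t Nu Gx t0; rewrite !hf ?lin_semi ?expr1 //; exact: G2_cell.
Qed.

Lemma V_alt f W : W^T = - W -> (forall x, G2 C x -> f x = alt W x) -> V_ i2 1 f.
Proof.
move=> Wa hf; split; first by apply: eq_regular (regular_alt _ W) => x /hf.
move=> u x t Nu Gx t0; rewrite !hf ?alt_semi ?expr1 //; exact: G2_cell.
Qed.

(** [lin M] depends on column 0 of M only. For M = wbar w this column is the extremal vector of
    weight $w\omega_1$. *)
Definition col_basis M (j : nat) := forall k : 'I_7, M k 0 = (k == j :> nat)%:R.

Lemma col_basis_mul M N (j j' : nat) : (j < 7)%N -> col_basis N j ->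
  (forall k : 'I_7, M k (inord j) = (k == j' :> nat)%:R) -> col_basis (M * N) j'.
Proof.
move=> j7 hN hM k; rewrite mxE (bigD1 (inord j)) //= big1 ?addr0 => [|l lj].
  by rewrite hN inordK // eqxx mulr1 hM.
by rewrite hN -(val_eq7 _ j7) (negbTE lj) mulr0.
Qed.

Lemma col_basis1 : col_basis 1 0.
Proof. by move=> k; rewrite mxE -val_eqE. Qed.

Lemma lin_col M j x : (j < 7)%N -> col_basis M j -> lin M x = x 0 (inord j).
Proof.
move=> j7 hM; rewrite /lin mxE (bigD1 (inord j)) //= big1 ?addr0 => [|l lj].
  by rewrite hM inordK // eqxx mulr1.
by rewrite hM -(val_eq7 _ j7) (negbTE lj) mulr0.
Qed.

Ltac column k :=
  rewrite ?sbar_E ?f_E; move: k; rewrite /rho /rho_seq /fseq /=;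
  apply: ord7P; case=> [|[|[|[|[|[|[|//]]]]]]] ?; rewrite mxE inordK //=; ring.

Lemma sbar2_col0 (k : 'I_7) : sbar C i2 k (inord 0) = (k == 0 :> nat)%:R.
Proof. column k. Qed.
Lemma sbar1_col0 (k : 'I_7) : sbar C i1 k (inord 0) = (k == 1 :> nat)%:R.
Proof. column k. Qed.
Lemma sbar2_col1 (k : 'I_7) : sbar C i2 k (inord 1) = (k == 2 :> nat)%:R.
Proof. column k. Qed.
Lemma sbar1_col2 (k : 'I_7) : sbar C i1 k (inord 2) = (k == 4 :> nat)%:R.
Proof. column k. Qed.
Lemma sbar2_col4 (k : 'I_7) : sbar C i2 k (inord 4) = (k == 5 :> nat)%:R.
Proof. column k. Qed.
Lemma sbar1_col5 (k : 'I_7) : sbar C i1 k (inord 5) = (k == 6 :> nat)%:R.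
Proof. column k. Qed.
Lemma f1_col0 (k : 'I_7) : f_ C i1 k (inord 0) = (k == 1 :> nat)%:R.
Proof. column k. Qed.
Lemma f2_col1 (k : 'I_7) : f_ C i2 k (inord 1) = (k == 2 :> nat)%:R.
Proof. column k. Qed.
Lemma f1_col2 (k : 'I_7) : f_ C i1 k (inord 2) = (k == 3 :> nat)%:R.
Proof. column k. Qed.

Lemma wbar_cons (k : 'I_2) w : wbar C (k :: w) = sbar C k * wbar C w.
Proof. by rewrite /wbar big_cons. Qed.

Lemma wbar_nil : wbar C [::] = 1.
Proof. by rewrite /wbar big_nil. Qed.

(** Read from the right, the reflections carry e_0 to e_1, e_2, e_4, e_5, e_6 without signs. The
    word [w0] starts at its right end with s_2, which fixes e_0. *)
Lemma wbar_cols : [/\ col_basis (wbar C [:: i1]) 1, col_basis (wbar C [:: i2; i1]) 2,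
  col_basis (wbar C [:: i1; i2; i1]) 4, col_basis (wbar C [:: i2; i1; i2; i1]) 5
  & col_basis (wbar C w0) 6].
Proof.
have step k w (j j' : nat) (hw : col_basis (wbar C w) j)
    (hk : forall l : 'I_7, sbar C k l (inord j) = (l == j' :> nat)%:R) (j7 : (j < 7)%N) :
    col_basis (wbar C (k :: w)) j'.
  by rewrite wbar_cons; apply: col_basis_mul hw hk.
have h0 : col_basis (wbar C [::]) 0 by rewrite wbar_nil; apply: col_basis1.
have h1 := step _ _ _ _ h0 sbar1_col0 isT.
have h2 := step _ _ _ _ h1 sbar2_col1 isT.
have h3 := step _ _ _ _ h2 sbar1_col2 isT.
have h4 := step _ _ _ _ h3 sbar2_col4 isT.
have g0 := step _ _ _ _ h0 sbar2_col0 isT.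
have g1 := step _ _ _ _ g0 sbar1_col0 isT.
have g2 := step _ _ _ _ g1 sbar2_col1 isT.
have g3 := step _ _ _ _ g2 sbar1_col2 isT.
have g4 := step _ _ _ _ g3 sbar2_col4 isT.
have g5 := step _ _ _ _ g4 sbar1_col5 isT.
by split.
Qed.

Lemma Delta1_E x : G2 C x -> Delta i1 x = x 0 0.
Proof. by move=> Gx; rewrite Delta_E // /Dfun /= /lin mulr1. Qed.

(** Index 3 has weight 0 and lies on no extremal orbit; f_1 f_2 f_1 reaches it from the highest
    weight vector. *)
Lemma X0_lin : exists2 M, col_basis M 3 & forall x, G2 C x -> X0 C x = 2^-1 * lin M x.
Proof.
exists (f_ C i1 * (f_ C i2 * (f_ C i1 * 1))) => [|x Gx].
  apply: (col_basis_mul (j := 2)) f1_col2 => //; apply: (col_basis_mul (j := 1)) f2_col1 => //.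
  by apply: (col_basis_mul (j := 0)) col_basis1 f1_col0.
rewrite -[LHS]/(2^-1 * _ x); congr (_ * _).
do 3 (apply: dagger_lin Gx => {}x Gx).
by rewrite Delta1_E // /lin mulr1.
Qed.

Definition functions1_on x : seq C :=
  let q := x 0 (inord 3) / 2 in
  let x00 := x 0 0 in let x1 := x 0 (inord 1) in let x2 := x 0 (inord 2) in
  let x4 := x 0 (inord 4) in let x5 := x 0 (inord 5) in let x6 := x 0 (inord 6) in
  [:: x5; x1 * x2 ^+ 2 - x00 * x2 * q - x00 ^+ 2 * x5; x2; x6;
      q * (x00 * x6 + x1 * x5) - x00 * x4 * x5 - x1 * x2 * x6; x00].

Lemma functions1_E x k : G2 C x -> nth 0 (functions1 C) k x = nth 0 (functions1_on x) k.
Proof.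
move=> Gx; have [c1 c2 c4 c5 c6] := wbar_cols; have [M cM hX] := X0_lin.
have D w l (l7 : (l < 7)%N) (cl : col_basis (wbar C w) l) : DeltaW i1 w x = x 0 (inord l).
  by rewrite DeltaW_lin // (lin_col _ _ cl).
have [[D1 D2] D4] := (D _ 1%N isT c1, D _ 2%N isT c2, D _ 4%N isT c4).
have [D5 D6] := (D _ 5%N isT c5, D _ 6%N isT c6).
have X3 : X0 C x = x 0 (inord 3) / 2 by rewrite hX // (lin_col _ _ cM) // mulrC.
have D0 := Delta1_E Gx.
case: k => [|[|[|[|[|[|k]]]]]] /=; rewrite ?fctE /= ?D1 ?D2 ?D4 ?D5 ?D6 ?X3 ?D0 //.
by rewrite !nth_nil.
Qed.

Lemma functions1_A k : A_ i1 (nth 0 (functions1 C) k).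
Proof.
have D w : V_ i1 1 (@DeltaW C i1 w) by apply: V_lin => x; apply: DeltaW_lin.
have D0 : V_ i1 1 (@Delta C i1).
  by apply: (V_lin (M := 1)) => x Gx; rewrite Delta1_E // /lin mulr1.
have X : V_ i1 1 (X0 C).
  have [M _ hM] := X0_lin; apply: (V_lin (M := 2^-1 *: M)) => x Gx.
  by rewrite linZ hM.
case: k => [|[|[|[|[|[|k]]]]]]; rewrite /functions1 /=.
- exact: A_of_V (D _).
- apply: (A_of_V (n := 3)); apply: V_add; first apply: V_add.
  + exact: (V_mul (D _) (V_mul (D _) (D _))).
  + apply: V_opp; exact: (V_mul (V_mul D0 (D _)) X).
  + apply: V_opp; exact: (V_mul (V_mul D0 D0) (D _)).
- exact: A_of_V (D _).
- exact: A_of_V (D _).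
- apply: (A_of_V (n := 3)); apply: V_add; first apply: V_add.
  + exact: (V_mul X (V_add (V_mul D0 (D _)) (V_mul (D _) (D _)))).
  + apply: V_opp; exact: (V_mul (V_mul D0 (D _)) (D _)).
  + apply: V_opp; exact: (V_mul (V_mul (D _) (D _)) (D _)).
- exact: A_of_V D0.
- by rewrite nth_nil; apply: (A_of_V (n := 0)); apply: V_0.
Qed.

End SeedFunctions.

(** * The functions of the seed for i = 2 *)

Section SeedFunctions2.
Variable C : numClosedFieldType.
Implicit Types (x y g u v M W : 'M[C]_7) (f h : 'M[C]_7 -> C).

(* the alternating form sum c (e_k /\ e_l) over the entries (k, l, c) of cs *)
Definition wedge_seq (cs : seq (nat * nat * C)) : seq (seq C) :=
  mkseq (fun a => mkseq (fun b => foldr (fun e r =>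
    (if (a == e.1.1) && (b == e.1.2) then e.2
     else if (a == e.1.2) && (b == e.1.1) then - e.2 else 0) + r) 0 cs) 7) 7.

Definition wedge cs := mx7 (wedge_seq cs).

Definition proper_wedge (cs : seq (nat * nat * C)) := all (fun e => (e.1.1 < e.1.2 < 7)%N) cs.

Lemma wedge_antisym cs : proper_wedge cs -> (wedge cs)^T = - wedge cs.
Proof.
move=> hcs; apply/matrixP => k l; rewrite !mxE !nth_mkseq //.
elim: cs hcs => [|[[a b] c] cs IH] /=; first by rewrite oppr0.
case/andP=> /andP[ab _] /IH ->; rewrite opprD; congr (_ + _).
rewrite [(nat_of_ord l == a) && _]andbC [(nat_of_ord l == b) && _]andbC.
case: (eqVneq (nat_of_ord k) b) => kb; case: (eqVneq (nat_of_ord k) a) => ka;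
  case: (eqVneq (nat_of_ord l) a) => la; case: (eqVneq (nat_of_ord l) b) => lb;
  rewrite /= ?opprK ?oppr0 //; by exfalso; lia.
Qed.

Definition minor k l x :=
  x 0 (inord k) * x (inord 1) (inord l) - x 0 (inord l) * x (inord 1) (inord k).

Lemma alt_wedge cs x : proper_wedge cs ->
  alt (wedge cs) x = \sum_(e <- cs) e.2 * minor e.1.1 e.1.2 x.
Proof.
elim: cs => [|[[a b] c] cs IH] hcs.
  rewrite big_nil altE big1 // => k _; rewrite big1 // => l _.
  by rewrite !mxE !nth_mkseq // mulr0 mul0r.
move: hcs => /= /andP[/andP[ab b7] hcs]; have a7 := ltn_trans ab b7.
rewrite big_cons -(IH hcs) /=.
have -> : wedge ((a, b, c) :: cs) = c *: (delta_mx (inord a) (inord b)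
    - delta_mx (inord b) (inord a)) + wedge cs.
  apply/matrixP => k l; rewrite !mxE !nth_mkseq //= !val_eq7 //; congr (_ + _).
  case: (eqVneq (nat_of_ord k) a) => ka; case: (eqVneq (nat_of_ord k) b) => kb;
  case: (eqVneq (nat_of_ord l) a) => la; case: (eqVneq (nat_of_ord l) b) => lb;
  rewrite /= ?subr0 ?sub0r ?mulrN ?mulr1 ?mulr0 ?oppr0 //; by exfalso; lia.
rewrite altD altZ; congr (c * _ + _).
have altd (k l : 'I_7) : alt (delta_mx k l) x = x 0 k * x (inord 1) l.
  rewrite altE (bigD1 k) //= [X in _ + X]big1 ?addr0 => [|k' kk]; last first.
    by rewrite big1 // => l' _; rewrite mxE (negbTE kk) mulr0 mul0r.
  rewrite (bigD1 l) //= [X in _ + X]big1 ?addr0 => [|l' ll];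
    last by rewrite mxE (negbTE ll) andbF mulr0 mul0r.
  by rewrite mxE !eqxx mulr1.
by rewrite altD -scaleN1r altZ !altd /minor mulN1r.
Qed.

Definition tr_seq (l : seq (seq C)) := mkseq (fun i => mkseq (fun j => nth 0 (nth [::] l j) i) 7) 7.

Lemma tr_mx7 l : (mx7 l)^T = mx7 (tr_seq l).
Proof. by apply/matrixP => i j; rewrite !mxE !nth_mkseq. Qed.

Ltac wedge_entries tac :=
  rewrite /wedge ?tr_mx7 !mulmx7 ?add_mx7 ?scale_mx7;
    cbv [wedge_seq tr_seq add_seq scale_seq fst snd];
  entries tac.

Lemma W0_wedge : W0 C = wedge [:: (0%N, 1%N, 1)].
Proof. by rewrite /W0 /wedge; cbv [wedge_seq]; entries ltac:(ring). Qed.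

(** These are the six extremal vectors of $V_{\omega_2}$ in descending order, again without signs
    for the chosen lifts; s_1 fixes the lowest one. *)
Lemma sbar_wedge : [/\ sbar C i2 * wedge [:: (0%N, 1%N, 1)] * (sbar C i2)^T = wedge [:: (0%N, 2%N, 1)],
  sbar C i1 * wedge [:: (0%N, 2%N, 1)] * (sbar C i1)^T = wedge [:: (1%N, 4%N, 1)],
  sbar C i2 * wedge [:: (1%N, 4%N, 1)] * (sbar C i2)^T = wedge [:: (2%N, 5%N, 1)],
  sbar C i1 * wedge [:: (2%N, 5%N, 1)] * (sbar C i1)^T = wedge [:: (4%N, 6%N, 1)] &
  sbar C i2 * wedge [:: (4%N, 6%N, 1)] * (sbar C i2)^T = wedge [:: (5%N, 6%N, 1)]
  /\ sbar C i1 * wedge [:: (5%N, 6%N, 1)] * (sbar C i1)^T = wedge [:: (5%N, 6%N, 1)]].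
Proof.
by rewrite !sbar_E /rho /rho_seq /=; split; last split; wedge_entries ltac:(ring).
Qed.

Definition lieW i (W : 'M[C]_7) := f_ C i * W + W * (f_ C i)^T.

(** The first three identities lead from the highest weight vector to 6 Y_2, the other four to the
    two second derivatives of Y_2 in [Y_{-2}], with c = 1/3 as the coefficient of Y_2. *)
Lemma lieW_wedge (c : C) : [/\ lieW i2 (wedge [:: (0%N, 1%N, 1)]) = wedge [:: (0%N, 2%N, 1)],
  lieW i1 (wedge [:: (0%N, 2%N, 1)]) = wedge [:: (1%N, 2%N, 1); (0%N, 3%N, 1)],
  lieW i1 (wedge [:: (1%N, 2%N, 1); (0%N, 3%N, 1)]) = wedge [:: (1%N, 3%N, 2); (0%N, 4%N, 2)] &
  [/\ lieW i2 (wedge [:: (1%N, 3%N, c); (0%N, 4%N, c)]) = wedge [:: (2%N, 3%N, c); (0%N, 5%N, c)],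
  lieW i1 (wedge [:: (2%N, 3%N, c); (0%N, 5%N, c)])
    = wedge [:: (2%N, 4%N, 2 * c); (1%N, 5%N, c); (0%N, 6%N, c)],
  lieW i1 (wedge [:: (1%N, 3%N, c); (0%N, 4%N, c)]) = wedge [:: (1%N, 4%N, 3 * c)] &
  lieW i2 (wedge [:: (1%N, 4%N, 3 * c)]) = wedge [:: (2%N, 4%N, 3 * c); (1%N, 5%N, 3 * c)]]].
Proof.
rewrite /lieW !f_E /fseq /=; split; last split; wedge_entries ltac:(ring).
Qed.

Lemma wbar_wedges :
  let conj w := wbar C w * W0 C * (wbar C w)^T in
  [/\ conj [:: i1; i2] = wedge [:: (1%N, 4%N, 1)],
    conj [:: i1; i2; i1; i2] = wedge [:: (4%N, 6%N, 1)]
    & conj w0 = wedge [:: (5%N, 6%N, 1)]].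
Proof.
move=> conj; have [s1 s2 s3 s4 [s5 s6]] := sbar_wedge.
have step k w W W' : conj w = W -> sbar C k * W * (sbar C k)^T = W' -> conj (k :: w) = W'.
  by move=> <- <-; rewrite /conj wbar_cons trmx_mul !mulrA.
have h0 : conj [::] = wedge [:: (0%N, 1%N, 1)].
  by rewrite /conj wbar_nil trmx1 mulr1 mul1r W0_wedge.
have h2 := step _ _ _ _ (step _ _ _ _ h0 s1) s2.
have h4 := step _ _ _ _ (step _ _ _ _ h2 s3) s4.
by split=> //; apply: step (step _ _ _ _ h4 s5) s6.
Qed.

Lemma Delta2_E x : G2 C x -> Delta i2 x = alt (wedge [:: (0%N, 1%N, 1)]) x.
Proof. by move=> Gx; rewrite Delta_E // -W0_wedge. Qed.

Lemma Y2_E x : G2 C x -> Y2 C x = alt (wedge [:: (1%N, 3%N, 3^-1); (0%N, 4%N, 3^-1)]) x.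
Proof.
move=> Gx; have [h1 h2 h3 _] := lieW_wedge 0.
have -> : Y2 C x = 6^-1 * alt (wedge [:: (1%N, 3%N, 2); (0%N, 4%N, 2)]) x.
  rewrite -[LHS]/(6^-1 * _ x); congr (_ * _); rewrite -h3 -h2 -h1.
  by do 3 (apply: dagger_alt Gx => {}x Gx); rewrite Delta2_E.
by rewrite !alt_wedge // !big_cons !big_nil /=; field.
Qed.

Lemma Ym2_E x : G2 C x ->
  (2 *: dagger (f_ C i1) (dagger (f_ C i2) (Y2 C)) - dagger (f_ C i2) (dagger (f_ C i1) (Y2 C))) x
  = alt (wedge [:: (2%N, 4%N, 3^-1); (1%N, 5%N, - 3^-1); (0%N, 6%N, 2 / 3)]) x.
Proof.
move=> Gx; have [_ _ _ [h1 h2 h3 h4]] := lieW_wedge 3^-1.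
have e1 y : G2 C y -> dagger (f_ C i1) (dagger (f_ C i2) (Y2 C)) y
    = alt (wedge [:: (2%N, 4%N, 2 * 3^-1); (1%N, 5%N, 3^-1); (0%N, 6%N, 3^-1)]) y.
  move=> Gy; rewrite -h2 -h1; do 2 (apply: dagger_alt Gy => {}y Gy); exact: Y2_E.
have e2 y : G2 C y -> dagger (f_ C i2) (dagger (f_ C i1) (Y2 C)) y
    = alt (wedge [:: (2%N, 4%N, 3 * 3^-1); (1%N, 5%N, 3 * 3^-1)]) y.
  move=> Gy; rewrite -h4 -h3; do 2 (apply: dagger_alt Gy => {}y Gy); exact: Y2_E.
by rewrite -[LHS]/(2 * _ x - _ x) e1 // e2 // !alt_wedge // !big_cons !big_nil /=; field.
Qed.

Definition functions2_on x : seq C :=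
  [:: minor 4 6 x; (minor 1 3 x + minor 0 4 x) / 3; minor 1 4 x; minor 5 6 x;
      (minor 2 4 x - minor 1 5 x + 2 * minor 0 6 x) / 3; minor 0 1 x].

Lemma functions2_wedges k : (k < 6)%N -> exists2 cs, proper_wedge cs &
  forall x, G2 C x -> nth 0 (functions2 C) k x = alt (wedge cs) x /\
    alt (wedge cs) x = nth 0 (functions2_on x) k.
Proof.
have [w2 w4 w6] := wbar_wedges.
case: k => [|[|[|[|[|[|//]]]]]] _ /=.
- exists [:: (4%N, 6%N, 1)] => // x Gx; rewrite DeltaW_alt // w4; split=> //.
  by rewrite alt_wedge // big_seq1 mul1r.
- exists [:: (1%N, 3%N, 3^-1); (0%N, 4%N, 3^-1)] => // x Gx; rewrite Y2_E //; split=> //.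
  by rewrite alt_wedge // !big_cons big_nil /=; field.
- exists [:: (1%N, 4%N, 1)] => // x Gx; rewrite DeltaW_alt // w2; split=> //.
  by rewrite alt_wedge // big_seq1 mul1r.
- exists [:: (5%N, 6%N, 1)] => // x Gx; rewrite DeltaW_alt // w6; split=> //.
  by rewrite alt_wedge // big_seq1 mul1r.
- exists [:: (2%N, 4%N, 3^-1); (1%N, 5%N, - 3^-1); (0%N, 6%N, 2 / 3)] => // x Gx.
  rewrite Ym2_E //; split=> //.
  by rewrite alt_wedge // !big_cons big_nil /=; field.
- exists [:: (0%N, 1%N, 1)] => // x Gx; rewrite Delta2_E //; split=> //.
  by rewrite alt_wedge // big_seq1 mul1r.
Qed.

Lemma functions2_E x k : (k < 6)%N -> G2 C x ->
  nth 0 (functions2 C) k x = nth 0 (functions2_on x) k.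
Proof. by move=> k6 Gx; have [cs _ /(_ x Gx)[-> ->]] := functions2_wedges k6. Qed.

Lemma functions2_A k : (k < 6)%N -> A_ i2 (nth 0 (functions2 C) k).
Proof.
move=> k6; have [cs pcs h] := functions2_wedges k6.
apply: (A_of_V (n := 1)); apply: V_alt (wedge_antisym pcs) _ => x Gx.
by have [] := h x Gx.
Qed.

End SeedFunctions2.

(** * The function field of N_i *)

Section FunctionField.
Variables (C : numClosedFieldType) (K : fieldType) (iota : ('M[C]_7 -> C) -> K).
Variables (N : set 'M[C]_7) (m : nat).
Variables (chart : 'M[C]_7 -> 'I_m -> C) (g : ('I_m -> C) -> 'M[C]_7).
Hypothesis iotaP : is_function_field N iota.
Hypothesis chart_regular : forall k, regular N (fun x => chart x k).
Hypothesis g_mem : forall v, N (g v).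
Hypothesis gK : forall v, chart (g v) = v.
Hypothesis chartK : forall x, N x -> g (chart x) = x.
Hypothesis g_pfun : forall k l, pfun (fun v => g v k l).

Lemma iota_ext f h : regular N f -> (forall x, N x -> f x = h x) -> iota f = iota h.
Proof.
move=> rf fh; have rh := eq_regular fh rf.
apply: subr0_eq; rewrite -(iota_B iotaP) //.
apply/(iota_eq0 iotaP) => [|x Nx]; last by rewrite -[LHS]/(f x - h x) fh // subrr.
exact: (fr_add (regular_ring N) rf (fr_opp (regular_ring N) rh)).
Qed.

Definition chart_fun (p : mpoly m C) : 'M[C]_7 -> C := fun x => meval (chart x) p.

Lemma chart_fun_regular p : regular N (chart_fun p).
Proof.
have R := regular_ring N.
have h : forall p : mpoly m C, regular N (fun x => mpoly_eval idfun (chart x) p).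
  apply: mpoly_ind => [c|k|a b ra rb|a b ra rb].
  - by apply: eq_regular (fr_cst R c) => x _; rewrite /mpoly_eval /= mmapC.
  - by apply: eq_regular (chart_regular k) => x _; rewrite /mpoly_eval /= mmapX mmap1U.
  - by apply: eq_regular (fr_add R ra rb) => x _; rewrite rmorphD.
  - by apply: eq_regular (fr_mul R ra rb) => x _; rewrite rmorphM.
exact: h.
Qed.

(** [chart] and [g] identify N with an affine space, so that the polynomial ring becomes the ring of
    regular functions inside K. *)
Definition chart_iota (p : mpoly m C) : K := iota (chart_fun p).

Fact chart_iota_zmod : zmod_morphism chart_iota.
Proof.
move=> p q; rewrite /chart_iota -(iota_B iotaP); try exact: chart_fun_regular.
by congr iota; apply/funext => x; rewrite /chart_fun mevalB.
Qed.

Fact chart_iota_monoid : monoid_morphism chart_iota.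
Proof.
split=> [|p q].
  rewrite -(iota_1 iotaP) /chart_iota; congr iota.
  by apply/funext => x; rewrite /chart_fun meval1.
rewrite /chart_iota -(iota_M iotaP); try exact: chart_fun_regular.
by congr iota; apply/funext => x; rewrite /chart_fun mevalM.
Qed.

HB.instance Definition _ := GRing.isZmodMorphism.Build (mpoly m C) K chart_iota chart_iota_zmod.
HB.instance Definition _ := GRing.isMonoidMorphism.Build (mpoly m C) K chart_iota chart_iota_monoid.

Definition chart_morphism : {rmorphism mpoly m C -> K} := chart_iota.

Lemma chart_morphism_inj : injective chart_morphism.
Proof.
move=> p q e; apply: subr0_eq; apply: mpoly_eval_eq0 => v.
have /(iota_eq0 iotaP (chart_fun_regular (p - q))) h : chart_iota (p - q) = 0.
  by rewrite chart_iota_zmod; apply/eqP; rewrite subr_eq0; apply/eqP.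
by rewrite -(h (g v) (g_mem v)) /chart_fun gK.
Qed.

Lemma chart_morphism_range : range chart_morphism = iota @` [set f | regular N f].
Proof.
apply/seteqP; split=> _ [f /= rf <-].
  by exists (chart_fun f) => //; apply: chart_fun_regular.
have [p hp] := rf; have [q hq] := evalmx_pfun p g_pfun.
exists q => //; apply/esym/iota_ext => // x Nx.
by rewrite hp // -{1}(chartK Nx) hq.
Qed.

Lemma chart_morphism_frac z : exists a b,
  chart_morphism b != 0 /\ z = chart_morphism a / chart_morphism b.
Proof.
have [f [h [rf rh h0 ->]]] := iota_frac iotaP z.
have : (range chart_morphism) (iota f) by rewrite chart_morphism_range; exists f.
have : (range chart_morphism) (iota h) by rewrite chart_morphism_range; exists h.
by move=> [b _ eb] [a _ ea]; exists a, b; rewrite ea eb.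
Qed.

Lemma chart_morphism_cst c : chart_morphism (mpolyC m c) = iota (cst c).
Proof.
by rewrite /chart_morphism /= /chart_iota; congr iota; apply/funext => x; rewrite /chart_fun mevalC.
Qed.

End FunctionField.

Section ChartValues.
Variables (C : numClosedFieldType) (A : idomainType) (PR : polynomial_ring (3 + 2) C A).
Notation X := (pvar PR).

Lemma point_ys1 v (k : 'I_(3 + 2)) :
  point PR v (nth 0 (ys1 (X j0) (X j1) (X j2) (X j3) (X j4)) k)
    = nth 0 (ys1 (v j0) (v j1) (v j2) (v j3) (v j4)) k.
Proof.
by elim/ord5P: k; rewrite /= ?(rmorphD, rmorphN, rmorphM, rmorphXn) /= ?point_var.
Qed.

Lemma point_ys2 v (k : 'I_(3 + 2)) :
  point PR v (nth 0 (ys2 (X j0) (X j1) (X j2) (X j3) (X j4)) k)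
    = nth 0 (ys2 (v j0) (v j1) (v j2) (v j3) (v j4)) k.
Proof.
by elim/ord5P: k; rewrite /= ?(rmorphD, rmorphN, rmorphM, rmorphXn) /= ?point_var.
Qed.

End ChartValues.

(** * The coordinates of N_1 and N_2 and the two cluster structures *)

Section Realizations.
Variables (C : numClosedFieldType) (K : fieldType) (iota : ('M[C]_7 -> C) -> K).

Notation PR := (mpoly_polynomial_ring (3 + 2) C).

(** The coordinates a, ..., e of [ys1], that is, cluster variables restricted to N_1, expressed by
    the entries of row 0. *)
Definition N1_chart (x : 'M[C]_7) (k : 'I_(3 + 2)) : C :=
  let p1 := nth 0 (coords x) 1 in let p2 := nth 0 (coords x) 2 in
  let q := nth 0 (coords x) 3 in let p4 := nth 0 (coords x) 4 in
  let p5 := nth 0 (coords x) 5 in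
  nth 0 [:: p2; p1 * p2 - q; p1 * q - p4; p2 * (p1 * p2 - q) - p5; p1] k.

Definition N1_seq (v : 'I_(3 + 2) -> C) : seq C :=
  [:: 0; v j4; v j0; v j4 * v j0 - v j1; v j4 * (v j4 * v j0 - v j1) - v j2;
      v j0 * v j1 - v j3].

(** The coordinates p, ..., t of [ys2]. The signs are those of the minors: s = -p4 is the minor of
    columns 1 and 4 when p1 = 0. *)
Definition N2_chart (x : 'M[C]_7) (k : 'I_(3 + 2)) : C :=
  let a := nth 0 (coords x) 0 in let p2 := nth 0 (coords x) 2 in
  let q := nth 0 (coords x) 3 in let p4 := nth 0 (coords x) 4 in
  let p5 := nth 0 (coords x) 5 in
  nth 0 [:: a; - p2; - q; - p4; - a * p4 - p2 * q + p5] k.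

Definition N2_seq (v : 'I_(3 + 2) -> C) : seq C :=
  [:: v j0; 0; - v j1; - v j2; - v j3; v j4 - v j0 * v j3 + v j1 * v j2].

Lemma N1_chart_regular (X : set 'M[C]_7) k : regular X (fun x => N1_chart x k).
Proof.
have R := regular_ring X; rewrite /N1_chart; elim/ord5P: k => /=;
  repeat first [exact: regular_entry | exact: (fr_cst R) | apply: (fr_add R) | apply: (fr_mul R)
    | apply: (fr_opp R)].
Qed.

Lemma N2_chart_regular (X : set 'M[C]_7) k : regular X (fun x => N2_chart x k).
Proof.
have R := regular_ring X; rewrite /N2_chart; elim/ord5P: k => /=;
  repeat first [exact: regular_entry | exact: (fr_cst R) | apply: (fr_add R) | apply: (fr_mul R)
    | apply: (fr_opp R)].
Qed.

Lemma N1_seqK v : N1_chart (N_ (N1_seq v)) = v.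
Proof.
by apply/funext; rewrite /N1_chart; apply: ord5P; rewrite /= !mxE !inordK //=; field.
Qed.

Lemma N2_seqK v : N2_chart (N_ (N2_seq v)) = v.
Proof.
by apply/funext; rewrite /N2_chart; apply: ord5P; rewrite /= !mxE !inordK //=; field.
Qed.

Lemma N1_mem v : NI i2 (N_ (N1_seq v)).
Proof. by exists (N1_seq v). Qed.

Lemma N2_mem v : NI i1 (N_ (N2_seq v)).
Proof. by exists (N2_seq v). Qed.

Lemma N1_chartK x : NI i2 x -> N_ (N1_seq (N1_chart x)) = x.
Proof.
case=> z /= z0 <-; rewrite /N1_chart /N1_seq /= !mxE !inordK //=.
rewrite [RHS]N_eta.
by rewrite z0; congr (N_ [:: _; _; _; _; _; _]); field.
Qed.

Lemma N2_chartK x : NI i1 x -> N_ (N2_seq (N2_chart x)) = x.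
Proof.
case=> z /= z0 <-; rewrite /N2_chart /N2_seq /= !mxE !inordK //=.
rewrite [RHS]N_eta.
by rewrite z0; congr (N_ [:: _; _; _; _; _; _]); field.
Qed.

Lemma N1_pfun k l : pfun (fun v => N_ (N1_seq v) k l).
Proof.
have R := pfun_ring C (3 + 2); apply: (fr_N_entry R).
by case=> [|[|[|[|[|[|h]]]]]] /=; rewrite ?nth_nil;
  repeat first [exact: pfun_var | exact: (fr_cst R) | apply: (fr_add R) | apply: (fr_mul R)
    | apply: (fr_opp R)].
Qed.

Lemma N2_pfun k l : pfun (fun v => N_ (N2_seq v) k l).
Proof.
have R := pfun_ring C (3 + 2); apply: (fr_N_entry R).
by case=> [|[|[|[|[|[|h]]]]]] /=; rewrite ?nth_nil;
  repeat first [exact: pfun_var | exact: (fr_cst R) | apply: (fr_add R) | apply: (fr_mul R)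
    | apply: (fr_opp R)].
Qed.

Notation X := (pvar PR).

Lemma functions1_chart x (k : 'I_(3 + 2)) : NI i2 x ->
  chart_fun N1_chart (nth 0 (ys1 (X j0) (X j1) (X j2) (X j3) (X j4)) k) x
    = nth 0 (functions1_on x) k.
Proof.
case=> z /= z0 <-; rewrite -[LHS]/(point PR (N1_chart (N_ z)) _) /functions1_on.
rewrite point_ys1 /N1_chart.
by elim/ord5P: k; rewrite /= !mxE !inordK //= ?z0; field.
Qed.

Lemma functions2_chart x (k : 'I_(3 + 2)) : NI i1 x ->
  chart_fun N2_chart (nth 0 (ys2 (X j0) (X j1) (X j2) (X j3) (X j4)) k) x
    = nth 0 (functions2_on x) k.
Proof.
case=> z /= z0 <-; rewrite -[LHS]/(point PR (N2_chart (N_ z)) _) /functions2_on /minor.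
rewrite point_ys2 /N2_chart.
by elim/ord5P: k; rewrite /= !mxE !inordK //= ?z0; field.
Qed.

Lemma NI_G2 j (x : 'M[C]_7) : NI j x -> G2 C x.
Proof. by move/NI_Uplus/G2_Uplus. Qed.

Lemma Delta_NI i j (x : 'M[C]_7) : NI j x -> Delta i x = 1.
Proof. by move=> Nx; rewrite Delta_E ?Dfun_Uplus; [|apply: NI_Uplus Nx|apply: NI_G2 Nx]. Qed.

Definition conclusion i j :=
  let S := restrict_seed iota (Sigma C i) in
  let c : C -> K := fun z => iota (cst z) in
  [/\ forall k, A_ i (extended_cluster (Sigma C i) k),
      forall x : 'M[C]_7, NI j x -> Delta i x = 1,
      is_seed c S &
      extend_scalars c (cluster_algebra (polynomial_ground_ring S) S)
        = iota @` [set f | regular (@NI C j) f]].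

Lemma cluster_structure1 : is_function_field (@NI C i2) iota -> conclusion i1 i2.
Proof.
move=> iotaP S c.
pose phi := chart_morphism iotaP (@N1_chart_regular (NI i2)).
have inj : injective phi := chart_morphism_inj N1_mem N1_seqK.
have cE : c = fun z => phi (pcst PR z) by apply/funext => z; rewrite /phi chart_morphism_cst.
have rg : range phi = iota @` [set f | regular (NI i2) f].
  exact: (chart_morphism_range iotaP _ N1_chartK N1_pfun).
have frac := chart_morphism_frac iotaP (@N1_chart_regular (NI i2)) N1_chartK N1_pfun.
have SE k : extended_cluster S k
    = phi (nth 0 (ys1 (X j0) (X j1) (X j2) (X j3) (X j4)) k).
  apply/esym; rewrite /phi /=; apply: (iota_ext iotaP) => [|x Nx].
    exact: chart_fun_regular (@N1_chart_regular (NI i2)) _.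
  by rewrite functions1_chart // functions1_E //; apply: NI_G2 Nx.
have SM k l : exchange_matrix S k l = b1 k l.
  by rewrite !mxE; elim/ord5P: k; elim/ord3P: l.
have [gen eq] := cluster_algebra_chart1 inj frac SE SM.
split=> [k|x Nx||]; first exact: functions1_A.
- exact: Delta_NI Nx.
- split; first by rewrite cE.
  exists (fun k => nth 0%N [:: 1; 3; 1]%N k); split; first by elim/ord3P.
  by elim/ord3P; elim/ord3P; rewrite !mxE.
- by rewrite cE eq.
Qed.

Lemma cluster_structure2 : is_function_field (@NI C i1) iota -> conclusion i2 i1.
Proof.
move=> iotaP S c.
pose phi := chart_morphism iotaP (@N2_chart_regular (NI i1)).
have inj : injective phi := chart_morphism_inj N2_mem N2_seqK.
have cE : c = fun z => phi (pcst PR z) by apply/funext => z; rewrite /phi chart_morphism_cst.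
have rg : range phi = iota @` [set f | regular (NI i1) f].
  exact: (chart_morphism_range iotaP _ N2_chartK N2_pfun).
have frac := chart_morphism_frac iotaP (@N2_chart_regular (NI i1)) N2_chartK N2_pfun.
have SE k : extended_cluster S k
    = phi (nth 0 (ys2 (X j0) (X j1) (X j2) (X j3) (X j4)) k).
  apply/esym; rewrite /phi /=; apply: (iota_ext iotaP) => [|x Nx].
    exact: chart_fun_regular (@N2_chart_regular (NI i1)) _.
  rewrite functions2_chart // functions2_E //; last exact: NI_G2 Nx.
  exact: ltn_trans (ltn_ord k) _.
have SM k l : exchange_matrix S k l = b2 k l.
  by rewrite !mxE; elim/ord5P: k; elim/ord3P: l.
have [gen eq] := cluster_algebra_chart2 inj frac SE SM.
split=> [k|x Nx||]; first exact: functions2_A.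
- exact: Delta_NI Nx.
- split; first by rewrite cE.
  exists (fun k => nth 0%N [:: 3; 1; 3]%N k); split; first by elim/ord3P.
  by elim/ord3P; elim/ord3P; rewrite !mxE.
- by rewrite cE eq.
Qed.

End Realizations.


Theorem corollary2p2 (R : realType) (i j : 'I_2) (K : fieldType)
    (iota : ('M[R[i]]_7 -> R[i]) -> K) :
  j != i ->
  let N := unipotent_radical (parabolic (R[i]) j) in
  is_function_field N iota ->
  let S := restrict_seed iota (Sigma (R[i]) i) in
  let c : R[i] -> K := fun z => iota (cst z) in
  [/\ forall k, A_ i (extended_cluster (Sigma (R[i]) i) k),
      forall x, N x -> Delta i x = 1,
      is_seed c S &
      extend_scalars c (cluster_algebra (polynomial_ground_ring S) S)
        = iota @` [set f | regular N f]].
Proof.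
rewrite (radical_NI _ j) => ji N iotaP; rewrite {}/N in iotaP *.
have [[ei ej]|[ei ej]] : (i = i1 /\ j = i2) \/ (i = i2 /\ j = i1).
- by move: ji {iotaP}; elim/ord2P: i; elim/ord2P: j; auto.
- by subst i j; apply: cluster_structure1.
- by subst i j; apply: cluster_structure2.
Qed.
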